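(* Let $L,\rho_1,\rho_2,k_1,k_2,k_3>0$ and let $g,\xi,p$ satisfy (A1) and (A2) of the context. Assume that $$\frac{k_1}{\rho_1}=\frac{k_2}{\rho_2}\qquad\text{and}\qquad k_1=k_3 .$$ Then there exists $l_0>0$ (depending only on $L$, the coefficients $\rho_1,\rho_2,k_1,k_2,k_3$ and $g$) such that for every $l\in(0,l_0)$, every $t_0>0$, and all data $(\varphi_0,\varphi_1)\in H^1_0(0,L)\times L^2(0,L)$, $(\psi_0,\psi_1),(w_0,w_1)\in H^1_*(0,L)\times L^2_*(0,L)$, the energy $E$ of the weak solution $(\varphi,\psi,w)$ of $(P)$ satisfies, for all $t>t_0$, $$E(t)\le C\exp\left(-\lambda\int_{t_0}^t\xi(s)\,ds\right)\qquad\text{if } p=1,$$ and $$E(t)\le C\left(\frac{1}{1+\int_{t_0}^t\xi^{2p-1}(s)\,ds}\right)^{\frac{1}{2p-2}}\qquad\text{if } 1<p<\tfrac32,$$ where $C>0$ is a constant independent of $t$ (but possibly depending on the initial data) and $\lambda>0$ is a constant independent of both $t$ and the initial data. Moreover, if $1<p<\frac32$ and $$\int_{t_0}^{+\infty}\left(\frac{1}{1+\int_{t_0}^t\xi^{2p-1}(s)\,ds}\right)^{\frac{1}{2p-2}}dt<+\infty,$$ then, for all $t>t_0$, $$E(t)\le C\left(\frac{1}{1+\int_{t_0}^t\xi^{p}(s)\,ds}\right)^{\frac{1}{p-1}},$$ again with a constant $C>0$ independent of $t$ but possibly depending on the initial data.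
   Context: Function spaces: $L^2_*(0,L)=\{v\in L^2(0,L):\int_0^L v\,dx=0\}$ and $H^1_*(0,L)=H^1(0,L)\cap L^2_*(0,L)$. Problem $(P)$ (finite-memory Bresse system), with positive constants $l,k_1,k_2,k_3,\rho_1,\rho_2$, for $(x,t)\in(0,L)\times(0,\infty)$: $$\rho_1\varphi_{tt}-k_1(\varphi_x+\psi+lw)_x-lk_3(w_x-l\varphi)=0,$$ $$\rho_2\psi_{tt}-k_2\psi_{xx}+k_1(\varphi_x+\psi+lw)+\int_0^t g(t-s)\psi_{xx}(s)\,ds=0,$$ $$\rho_1w_{tt}-k_3(w_x-l\varphi)_x+lk_1(\varphi_x+\psi+lw)=0,$$ with boundary conditions $\varphi(0,t)=\varphi(L,t)=\psi_x(0,t)=\psi_x(L,t)=w_x(0,t)=w_x(L,t)=0$ for $t\ge0$, and initial conditions $\varphi(\cdot,0)=\varphi_0$, $\varphi_t(\cdot,0)=\varphi_1$, $\psi(\cdot,0)=\psi_0$, $\psi_t(\cdot,0)=\psi_1$, $w(\cdot,0)=w_0$, $w_t(\cdot,0)=w_1$. Hypotheses on the relaxation function: (A1) $g:[0,\infty)\to[0,\infty)$ is a non-increasing differentiable function with $g(0)>0$ and $k_2-\int_0^{+\infty}g(s)\,ds>0$. (A2) $\xi:[0,\infty)\to(0,\infty)$ is a non-increasing differentiable function and $p$ is a constant with $1\le p<\frac32$ such that $g'(t)\le-\xi(t)g^p(t)$ for all $t\ge0$. Well-posedness (known): under (A1), for data $(\varphi_0,\varphi_1)\in H^1_0(0,L)\times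 L^2(0,L)$ and $(\psi_0,\psi_1),(w_0,w_1)\in H^1_*(0,L)\times L^2_*(0,L)$, problem $(P)$ has a unique global weak solution with $\varphi\in C([0,\infty);H^1_0(0,L))\cap C^1([0,\infty);L^2(0,L))$ and $\psi,w\in C([0,\infty);H^1_*(0,L))\cap C^1([0,\infty);L^2_*(0,L))$. Energy: for $t\ge0$, $$E(t)=\frac12\int_0^L\Big[\rho_1\varphi_t^2+\rho_2\psi_t^2+\rho_1w_t^2+\Big(k_2-\int_0^tg(s)ds\Big)\psi_x^2+k_3(w_x-l\varphi)^2+k_1(\varphi_x+\psi+lw)^2\Big]dx+\frac12(g\circ\psi_x)(t),$$ where $(g\circ v)(t)=\int_0^L\int_0^tg(t-s)\big(v(t)-v(s)\big)^2ds\,dx$. *)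

(* Defs.v *)
From HB Require Import structures.
From mathcomp Require Import all_boot all_order all_algebra.
From mathcomp Require Import all_classical all_reals all_analysis.

Set Implicit Arguments.
Unset Strict Implicit.
Unset Printing Implicit Defensive.

Import Order.TTheory GRing.Theory Num.Theory.
Import numFieldNormedType.Exports.

Local Open Scope classical_set_scope.
Local Open Scope ring_scope.

Section HalfLine.
Context {R : realType}.
Implicit Types (f : R -> R) (t : R).

(* A function on the half-line [0, +oo) is a function R -> R of which only the
   values at t >= 0 matter; its derivative at 0 is the right derivative. *)
Definition halfline : set R := `[0, +oo[.

Definition hl_quotient f t (s : R) : R := (s - t)^-1 * (f s - f t).

Definition hl_derivable f t : Prop :=
  cvg (hl_quotient f t s @[s --> within halfline t^']).

Definition hl_derive f t : R :=
  lim (hl_quotient f t s @[s --> within halfline t^']).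

Definition hl_nonincreasing f : Prop :=
  forall s t : R, 0 <= s -> s <= t -> f t <= f s.

Definition hypA1 (k2 : R) (g : R -> R) : Prop :=
  [/\ forall t : R, 0 <= t -> 0 <= g t,
      hl_nonincreasing g,
      forall t : R, 0 <= t -> hl_derivable g t,
      0 < g 0
    & (0 < k2%:E - \int[lebesgue_measure]_(s in halfline) (g s)%:E)%E].

Definition hypA2 (g xi : R -> R) (p : R) : Prop :=
  [/\ forall t : R, 0 <= t -> 0 < xi t,
      hl_nonincreasing xi,
      forall t : R, 0 <= t -> hl_derivable xi t,
      1 <= p < 3 / 2
    & forall t : R, 0 <= t -> hl_derive g t <= - xi t * g t `^ p].

End HalfLine.

(* Elements of L^2(0,L) are given by representatives R -> R, of which only the
   restriction to ]0, L[ matters.  In H1 and its subspaces the second argument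
   is (a representative of) the weak derivative of the first. *)
Section Spaces.
Context {R : realType}.
Variable L : R.
Implicit Types v vx eta : R -> R.

Definition dom : set R := `]0, L[.

Definition inL2 v : Prop := v \_ dom \in Lfun lebesgue_measure 2%:E.

Definition normL2 v : R := fine 'N[lebesgue_measure]_2%:E[EFin \o (v \_ dom)].

Definition dotL2 u v : R := \int[lebesgue_measure]_(x in dom) (u x * v x).

Definition mean0 v : Prop := \int[lebesgue_measure]_(x in dom) v x = 0.

Definition inL2s v : Prop := inL2 v /\ mean0 v.

Definition test_function eta : Prop :=
  (forall (n : nat) (x : R), derivable (derive1n n eta) x 1) /\
  exists a b : R, [/\ 0 < a, b < L & forall x, ~~ (a <= x <= b) -> eta x = 0].

Definition weak_deriv v vx : Prop :=
  forall eta, test_function eta -> dotL2 v (derive1 eta) = - dotL2 vx eta.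

Definition H1 v vx : Prop := [/\ inL2 v, inL2 vx & weak_deriv v vx].

(* Closure of the test functions in the norm of H^1(0,L). *)
Definition H10 v vx : Prop :=
  H1 v vx /\
  forall e : R, 0 < e -> exists2 eta, test_function eta &
    normL2 (v \- eta) < e /\ normL2 (vx \- derive1 eta) < e.

Definition H1s v vx : Prop := H1 v vx /\ mean0 v.

Definition inH10 v : Prop := exists vx, H10 v vx.

Definition inH1s v : Prop := exists vx, H1s v vx.

Definition eqL2 u v : Prop :=
  {ae lebesgue_measure, forall x, dom x -> u x = v x}.

(* Functions of time with values in L^2(0,L): the time comes first. *)
Implicit Types u ut : R -> R -> R.

Definition contL2 u : Prop :=
  forall t : R, 0 <= t ->
    normL2 (u s \- u t) @[s --> within halfline (nbhs t)] --> (0 : R).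

Definition derivL2 u ut : Prop :=
  forall t : R, 0 <= t ->
    normL2 (fun x => (s - t)^-1 * (u s x - u t x) - ut t x)
      @[s --> within halfline t^'] --> (0 : R).

End Spaces.

(* An unknown of the system: u t x together with its x- and t-derivatives. *)
Record evolution (R : realType) := Evolution {
  evol :> R -> R -> R;
  evol_x : R -> R -> R;
  evol_t : R -> R -> R }.

Section Bresse.
Context {R : realType}.
Variables (L rho1 rho2 k1 k2 k3 l : R) (g : R -> R).
Implicit Types phi psi w : evolution R.

(* u in C([0,oo); V) /\ C^1([0,oo); H), with u_x, u_t the derivatives of u; here
   V is a subspace of H^1(0,L) and H a subspace of L^2(0,L). *)
Definition regular (V : (R -> R) -> (R -> R) -> Prop) (H : (R -> R) -> Prop)
    (u : evolution R) : Prop :=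
  [/\ forall t : R, 0 <= t -> V (u t) (evol_x u t) /\ H (evol_t u t),
      contL2 L u, contL2 L (evol_x u), derivL2 L u (evol_t u)
    & contL2 L (evol_t u)].

Definition shear phi psi w (t x : R) : R :=
  evol_x phi t x + psi t x + l * w t x.

Definition axial phi w (t x : R) : R := evol_x w t x - l * phi t x.

(* The equations are multiplied by a function v, integrated by parts over
   (0,L), and required to hold for every t > 0.  The Neumann conditions are the
   natural boundary conditions, encoded by letting v range over H^1(0,L) in the
   last two equations; phi(0,t) = phi(L,t) = 0 is encoded by phi(t) in H^1_0. *)
Definition weak_eq_phi phi psi w : Prop :=
  forall v vx, H10 L v vx -> forall t : R, 0 < t ->
    is_derive t (1 : R) (fun s => rho1 * dotL2 L (evol_t phi s) v)
      (- k1 * dotL2 L (shear phi psi w t) vx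
       + l * k3 * dotL2 L (axial phi w t) v).

Definition weak_eq_psi phi psi w : Prop :=
  forall v vx, H1 L v vx -> forall t : R, 0 < t ->
    is_derive t (1 : R) (fun s => rho2 * dotL2 L (evol_t psi s) v)
      (- k2 * dotL2 L (evol_x psi t) vx
       - k1 * dotL2 L (shear phi psi w t) v
       + \int[lebesgue_measure]_(s in `[0, t])
           (g (t - s) * dotL2 L (evol_x psi s) vx)).

Definition weak_eq_w phi psi w : Prop :=
  forall v vx, H1 L v vx -> forall t : R, 0 < t ->
    is_derive t (1 : R) (fun s => rho1 * dotL2 L (evol_t w s) v)
      (- k3 * dotL2 L (axial phi w t) vx
       - l * k1 * dotL2 L (shear phi psi w t) v).

(* [jointly_measurable] fixes a representative of the continuous L^2-valued
   function psi_x; such a representative always exists, and one is needed for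
   the pointwise integral in s occurring in [memory] to make sense. *)
Definition jointly_measurable (v : R -> R -> R) : Prop :=
  measurable_fun (halfline `*` dom L)
    (fun z : measurableTypeR R * measurableTypeR R => v z.1 z.2).

Record weak_solution (phi0 phi1 psi0 psi1 w0 w1 : R -> R) phi psi w : Prop := {
  phi_regular : regular (H10 L) (inL2 L) phi;
  psi_regular : regular (H1s L) (inL2s L) psi;
  w_regular : regular (H1s L) (inL2s L) w;
  psi_x_measurable : jointly_measurable (evol_x psi);
  phi_eq : weak_eq_phi phi psi w;
  psi_eq : weak_eq_psi phi psi w;
  w_eq : weak_eq_w phi psi w;
  phi_init : eqL2 L (phi 0) phi0 /\ eqL2 L (evol_t phi 0) phi1;
  psi_init : eqL2 L (psi 0) psi0 /\ eqL2 L (evol_t psi 0) psi1;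
  w_init : eqL2 L (w 0) w0 /\ eqL2 L (evol_t w 0) w1 }.

Definition admissible_data (phi0 phi1 psi0 psi1 w0 w1 : R -> R) : Prop :=
  [/\ inH10 L phi0 /\ inL2 L phi1,
      inH1s L psi0 /\ inL2s L psi1
    & inH1s L w0 /\ inL2s L w1].

Definition memory (v : R -> R -> R) (t : R) : R :=
  \int[lebesgue_measure]_(x in dom L)
    \int[lebesgue_measure]_(s in `[0, t]) (g (t - s) * (v t x - v s x) ^+ 2).

Definition energy phi psi w (t : R) : R :=
  2^-1 * (\int[lebesgue_measure]_(x in dom L)
     (rho1 * evol_t phi t x ^+ 2 + rho2 * evol_t psi t x ^+ 2
      + rho1 * evol_t w t x ^+ 2
      + (k2 - \int[lebesgue_measure]_(s in `[0, t]) g s) * evol_x psi t x ^+ 2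
      + k3 * axial phi w t x ^+ 2 + k1 * shear phi psi w t x ^+ 2))
  + 2^-1 * memory (evol_x psi) t.

End Bresse.

(* Main.v *)
Require Import Defs.
From HB Require Import structures.
From mathcomp Require Import all_boot all_order all_algebra.
From mathcomp Require Import all_classical all_reals all_analysis.
From mathcomp Require Import measurable_realfun.
From mathcomp Require Import ring lra.

(** Expand phi in sines and psi, w in cosines on (0,L).  These are the bases that
    fit the boundary conditions, and the coefficients are constant, so the system
    splits into modes: the coefficients a, b, c of phi, psi, w at a frequency
    mu = n pi / L solve three scalar integro-differential equations ([is_mode]),
    coupled through the shear S = mu a + b + l c and the axial force
    N = - mu c - l a.  Testing the weak equations with one sine or cosine shows
    that these coefficients are twice differentiable in time, so all multiplier
    computations are elementary, with no approximation of the weak solution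
    ([mode_ofP]).

    With r(s) = b(t) - b(t-s), the energy E of one mode contains a memory part W,
    the integral of g r^2, and E' = - D, where D is up to a boundary term half the
    integral of - g' r^2 ([der_mode_nrj]).  A combination H of five
    multipliers satisfies |H| <= C E and H' <= - m E + M W + C D with constants
    that do not depend on mu ([multiplier_weights]).  This is where l must be
    small, and where the equal speeds enter: in the derivative of the multiplier
    that recovers the shear, the products of the two velocities, of order mu,
    cancel exactly when rho2 = rho1 k2 / k1.  Then F = H + C E is nonnegative, is
    bounded by a multiple of E, and F' <= - m E + M W.  All of this adds up over any
    finite set of modes, with the same constants ([lyapunov]).

    It remains to absorb xi W by the dissipation.  As xi is nonincreasing,
    xi(t) W(t) is at most the integral of xi(s) g(s) r(s)^2, and the hypothesis on g
    says that D controls the integral of xi g^p r^2.  If p = 1 these are the same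
    integral and a Gronwall argument gives the exponential rate ([exp_decay]).  If
    p > 1, Young's inequality gives g <= lam g^p + lam^(-1/al) g^(1/2) with
    al = 2p - 2, where xi g^(1/2) has a finite integral because p < 3/2
    ([xi_sqrt_integ]).  Optimizing in lam yields a differential inequality with
    exponent al + 1, whence the polynomial rate ([poly_decay]).  If the energy is
    integrable in time, the integral of r(s)^2 in s is bounded, hence the cruder
    g <= lam g^p + lam^(-1/al) with al = p - 1 is enough; the integrability
    hypothesis of the last claim provides this through the previous rate.

    The bounds are uniform in the number of modes, and the solution enters them only
    through a bound of the initial energy of the modes, which Bessel's inequality
    gives in terms of the data ([init_modes_le]).  Parseval's identity ([parseval_cs], [parseval_sn]) returns
    to the energy of the solution; for the memory term it is integrated in time,
    by Tonelli's theorem and monotone convergence ([memory_le], [energy_le]). *)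

Set Implicit Arguments.
Unset Strict Implicit.
Unset Printing Implicit Defensive.

Import Order.TTheory GRing.Theory Num.Theory.
Import numFieldNormedType.Exports.

Local Open Scope classical_set_scope.
Local Open Scope ring_scope.


(** * Calculus on the real line *)

Ltac pos := repeat first [assumption | done | exact: ltr01 | exact: sqr_ge0 | apply: ltW; assumption
  | rewrite invr_ge0 | rewrite invr_gt0 | apply: mulr_gt0 | apply: mulr_ge0 | apply: addr_gt0 | apply: addr_ge0
  | apply: powR_gt0 | exact: powR_ge0 | apply: exprn_gt0 | apply: exprn_ge0 ].

Section Calculus.
Context {R : realType}.
Implicit Types (f g h : R -> R) (a b c t x : R).
Local Notation mu := (@lebesgue_measure R).

Definition der f x a : Prop := is_derive x (1 : R) f a.

Lemma der_eq x f a b : der f x a -> a = b -> der f x b.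
Proof. by move=> ? <-. Qed.

Lemma derC x c : der (fun=> c) x (0 : R).
Proof. exact: is_derive_cst. Qed.

Lemma derI x : der (fun y : R => y) x (1 : R).
Proof. exact: is_derive_id. Qed.

Lemma derD x f g a b : der f x a -> der g x b ->
  der (fun y => f y + g y) x (a + b).
Proof. by move=> fa gb; exact: (is_deriveD fa gb). Qed.

Lemma derN x f a : der f x a -> der (fun y => - f y) x (- a).
Proof. by move=> fa; exact: (is_deriveN fa). Qed.

Lemma derB x f g a b : der f x a -> der g x b ->
  der (fun y => f y - g y) x (a - b).
Proof. by move=> fa gb; exact: (is_deriveB fa gb). Qed.

Lemma derM x f g a b : der f x a -> der g x b ->
  der (fun y => f y * g y) x (a * g x + f x * b).
Proof.
move=> fa gb; apply: der_eq (is_deriveM fa gb) _.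
by rewrite /GRing.scale /= addrC mulrC.
Qed.

Lemma derZ x c f a : der f x a -> der (fun y => c * f y) x (c * a).
Proof. by move=> fa; apply: der_eq (derM (derC x c) fa) _; rewrite mul0r add0r. Qed.

Lemma derX2 x f a : der f x a ->
  der (fun y => f y ^+ 2) x (2 * f x * a).
Proof.
move=> fa; apply: der_eq (derM fa fa) _.
by ring.
Qed.

Lemma der_sum x (n : nat) (f : 'I_n -> R -> R) (a : 'I_n -> R) :
  (forall i, der (f i) x (a i)) ->
  der (fun y => \sum_(i < n) f i y) x (\sum_(i < n) a i).
Proof.
elim: n f a => [|n IH] f a fa.
  rewrite big_ord0; have -> : (fun y => \sum_(i < 0) f i y) = fun=> 0.
    by apply/funext => y; rewrite big_ord0.
  exact: derC.
rewrite big_ord_recr /=.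
have -> : (fun y => \sum_(i < n.+1) f i y) =
    (fun y => \sum_(i < n) f (widen_ord (leqnSn n) i) y + f ord_max y).
  by apply/funext => y; rewrite big_ord_recr.
by apply: derD (fa _); exact: IH.
Qed.

Lemma der_comp x f g a b : der f x a -> der g (f x) b ->
  der (fun y => g (f y)) x (b * a).
Proof.
move=> fa gb; have := is_derive1_comp gb fa; rewrite /der.
by rewrite /GRing.scale /= /comp.
Qed.

Lemma der_near x f g a : (\forall y \near x, f y = g y) ->
  der f x a -> der g x a.
Proof. by move=> fg; apply: near_eq_is_derive; rewrite ?oner_eq0. Qed.

Lemma near_ge a x : a < x -> \forall y \near x, a <= y.
Proof. by move=> ax; apply: filterS (lt_nbhsr ax) => y /ltW. Qed.

Lemma near_le a x : x < a -> \forall y \near x, y <= a.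
Proof. by move=> ax; apply: filterS (lt_nbhsl ax) => y /ltW. Qed.

Lemma der_cont x f a : der f x a -> {for x, continuous f}.
Proof. by move=> [fa _]; apply: differentiable_continuous; exact/derivable1_diffP. Qed.

Lemma cont_within f (A : set R) :
  (forall x, A x -> {for x, continuous f}) -> {within A, continuous f}.
Proof.
move=> cf; apply/continuous_in_subspaceT => x; rewrite inE => Ax; exact: cf.
Qed.

Lemma der_ge0_le f df a b : a <= b -> {within `[a, b], continuous f} ->
  (forall x, a < x -> x < b -> der f x (df x) /\ 0 <= df x) -> f a <= f b.
Proof.
move=> ab cf dfx; apply: (@ger0_derive1_ndecr R f a b) => //.
- by move=> x; rewrite in_itv /= => /andP[ax xb]; have [[]] := dfx x ax xb.
- move=> x; rewrite in_itv /= => /andP[ax xb]; have [[_ d0] ?] := dfx x ax xb.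
  by rewrite derive1E d0.
Qed.

Lemma der_le0_ge f df a b : a <= b -> {within `[a, b], continuous f} ->
  (forall x, a < x -> x < b -> der f x (df x) /\ df x <= 0) -> f b <= f a.
Proof.
move=> ab cf dfx; rewrite -lerN2.
apply: (@der_ge0_le (fun x => - f x) (fun x => - df x)) => //.
  by move=> x; apply: continuousN; exact: cf.
move=> x ax xb; have [d0 ?] := dfx x ax xb.
by split; [exact: derN|rewrite oppr_ge0].
Qed.

Lemma continuous_itv_integrable f a b : continuous f ->
  mu.-integrable `[a, b] (EFin \o f).
Proof.
move=> cf; apply: continuous_compact_integrable; first exact: segment_compact.
exact: continuous_subspaceT.
Qed.

(** Oriented primitive vanishing at 0, differentiable on the right of its base
    point [c]. *)
Definition primb c f t := \int[mu]_(s in `[c, t]) f s - \int[mu]_(s in `[c, 0]) f s.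

Lemma primb0 c f : primb c f 0 = 0. Proof. by rewrite /primb subrr. Qed.

Lemma der_primb c f t : continuous f -> c < t -> der (primb c f) t (f t).
Proof.
move=> cf t1.
have [|d1 d2] := @continuous_FTC1_closed R f c t (t + 1) _ (continuous_itv_integrable _ _ cf) t1 (cf t).
  by rewrite ltrDl.
have -> : f t = f t - 0 by rewrite subr0.
by apply: derB (derC _ _); apply: DeriveDef; [exact: d1|rewrite -derive1E; exact: d2].
Qed.

Lemma primb_itv c f a b : continuous f -> c <= a -> a <= b ->
  \int[mu]_(s in `[a, b]) f s = primb c f b - primb c f a.
Proof.
move=> cf a1 ab; rewrite /primb.
have -> (x y z : R) : x - y - (z - y) = x - z by ring.
have := @Rintegral_itvB R f (BLeft c) (BRight b) a (continuous_itv_integrable _ _ cf).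
rewrite !bnd_simp => ->//.
rewrite Rintegral_itv_obnd_cbnd //.
apply: (integrableS _ _ _ (continuous_itv_integrable a b cf)) => //.
by apply: subset_itvr; rewrite bnd_simp.
Qed.

(** Integral over [0,t], which vanishes for t < 0: this makes it a continuous
    function of t on the whole line. *)
Definition integ f t := \int[mu]_(s in `[0, t]) f s.

(** Reduces continuity and differentiability of [integ] at times t >= 0 to those
    of a primitive based at -1, for which 0 is an interior point. *)
Lemma integE f t : continuous f -> integ f t = primb (-1) f (Num.max t 0).
Proof.
move=> cf; rewrite /integ; have [t0|t0] := lerP 0 t; last first.
  by rewrite primb0 set_itv_ge ?Rintegral_set0// bnd_simp -ltNge.
by rewrite (primb_itv (c := -1))// ?primb0 ?subr0// lerN10.
Qed.

Lemma Rintegral_eq0 (D : set R) f : (forall x, D x -> f x = 0) -> \int[mu]_(x in D) f x = 0.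
Proof.
move=> f0; rewrite /Rintegral (eq_integral (fun=> 0%E)) ?integral0//.
by move=> x; rewrite inE => /f0 ->.
Qed.

Lemma integ0 f : integ f 0 = 0.
Proof. by rewrite /integ set_itv1 Rintegral_set1. Qed.

Lemma integ_lt0 f t : t < 0 -> integ f t = 0.
Proof. by move=> t0; rewrite /integ set_itv_ge ?Rintegral_set0// bnd_simp -ltNge. Qed.

Lemma integ_cst c t : 0 <= t -> integ (fun=> c) t = c * t.
Proof.
move=> t0; rewrite /integ Rintegral_cst//= lebesgue_measure_itv /= lte_fin.
have [r1|r1] := ltP 0 t; first by rewrite -EFinD /= subr0.
have -> : t = 0 by apply/eqP; rewrite eq_le t0 r1.
by [].
Qed.

Lemma integ_continuous f : continuous f -> continuous (integ f).
Proof.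
move=> cf; have -> : integ f = primb (-1) f \o (fun t => Num.max t 0).
  by apply/funext => t; rewrite integE.
move=> t; apply: continuous_comp.
  by apply: continuous_max; [exact: cvg_id|exact: cvg_cst].
apply: der_cont (der_primb cf _).
by rewrite (@lt_le_trans _ _ 0)// ?ltrN10// le_max lexx orbT.
Qed.

Lemma der_integ f t : continuous f -> 0 < t -> der (integ f) t (f t).
Proof.
move=> cf t0; apply: der_near (der_primb (c := -1) cf _); last first.
  by rewrite (lt_trans _ t0)// ltrN10.
near=> s; rewrite integE// max_l//.
by near: s; exact: near_ge.
Unshelve. all: by end_near. Qed.

Lemma integD f g t : continuous f -> continuous g ->
  integ (fun s => f s + g s) t = integ f t + integ g t.
Proof. by move=> cf cg; apply: RintegralD => //; exact: continuous_itv_integrable. Qed.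

Lemma integB f g t : continuous f -> continuous g ->
  integ (fun s => f s - g s) t = integ f t - integ g t.
Proof. by move=> cf cg; apply: RintegralB => //; exact: continuous_itv_integrable. Qed.

Lemma integZ c f t : continuous f -> integ (fun s => c * f s) t = c * integ f t.
Proof. by move=> cf; apply: RintegralZl => //; exact: continuous_itv_integrable. Qed.

Lemma eq_integ f g t : (forall s, 0 <= s -> s <= t -> f s = g s) -> integ f t = integ g t.
Proof.
move=> fg; apply: eq_Rintegral => s; rewrite inE /= in_itv /= => /andP[]; exact: fg.
Qed.

Lemma le_integ f g t : continuous f -> continuous g ->
  (forall s, 0 <= s -> s <= t -> f s <= g s) -> integ f t <= integ g t.
Proof.
move=> cf cg fg; apply: le_Rintegral => //; try exact: continuous_itv_integrable.
by move=> s; rewrite /= in_itv /= => /andP[]; exact: fg.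
Qed.

Lemma integ_ge0 f t : (forall s, 0 <= s -> s <= t -> 0 <= f s) -> 0 <= integ f t.
Proof.
by move=> f0; apply: Rintegral_ge0 => s; rewrite /= in_itv /= => /andP[]; exact: f0.
Qed.

Lemma integ_itv f a b : continuous f -> 0 <= a -> a <= b ->
  \int[mu]_(s in `[a, b]) f s = integ f b - integ f a.
Proof.
move=> cf a0 ab; have b0 := le_trans a0 ab.
by rewrite !integE// !max_l// (primb_itv (c := -1))// (le_trans _ a0)// lerN10.
Qed.

Lemma integ_le f a b : continuous f -> (forall s, 0 <= s -> 0 <= f s) ->
  0 <= a -> a <= b -> integ f a <= integ f b.
Proof.
move=> cf f0 a0 ab; rewrite -subr_ge0 -integ_itv//; apply: Rintegral_ge0 => s.
by rewrite /= in_itv /= => /andP[as_ _]; apply: f0; exact: le_trans as_.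
Qed.

Lemma cont_cst c : continuous (fun _ : R => c).
Proof. by move=> x; exact: cvg_cst. Qed.

Lemma cont_id : continuous (fun x : R => x).
Proof. by move=> x; exact: cvg_id. Qed.

Lemma contM f g : continuous f -> continuous g -> continuous (fun x => f x * g x).
Proof. by move=> cf cg x; apply: cvgM; [exact: cf|exact: cg]. Qed.

Lemma contZ c f : continuous f -> continuous (fun x => c * f x).
Proof. by move=> cf; apply: contM => //; exact: cont_cst. Qed.

Lemma contD f g : continuous f -> continuous g -> continuous (fun x => f x + g x).
Proof. by move=> cf cg x; apply: cvgD; [exact: cf|exact: cg]. Qed.

Lemma contB f g : continuous f -> continuous g -> continuous (fun x => f x - g x).
Proof. by move=> cf cg x; apply: cvgB; [exact: cf|exact: cg]. Qed.

Lemma cont_comp f g : continuous f -> continuous g -> continuous (fun x => g (f x)).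
Proof. by move=> cf cg x; apply: (continuous_comp (cf x)); exact: cg. Qed.

Lemma contX2 f : continuous f -> continuous (fun x => f x ^+ 2).
Proof. by move=> cf; exact: contM. Qed.

Lemma cont_bnd f a b : continuous f -> exists2 M, 0 <= M & forall x, a <= x -> x <= b -> `|f x| <= M.
Proof.
move=> cf; have [ab|ba] := leP a b; last first.
  by exists 0 => // x ax xb; have := le_trans ax xb; rewrite leNgt ba.
have [|c _ cM] := @EVT_max R (fun x => `|f x|) a b ab.
  by apply: continuous_subspaceT => x; apply: continuous_comp; [exact: cf|exact: norm_continuous].
by exists `|f c| => // x ax xb; apply: cM; rewrite in_itv /= ax.
Qed.

End Calculus.

(** * Convolutions *)

Section Convolution.
Context {R : realType}.
Variables (g h h' : R -> R).
Hypothesis cg : continuous g.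
Hypothesis dh : forall u : R, der h u (h' u).
Hypothesis ch' : continuous h'.
Local Notation mu := (@lebesgue_measure R).

Definition conv (g h : R -> R) (t : R) := integ (fun s => g s * h (t - s)) t.

Let ch : continuous h. Proof. by move=> u; exact: der_cont (dh u). Qed.

(* [h] minus its first-order expansion at 0, cut off to the right half-line: this
   is of class C^1, so the upper limit of the convolution can be frozen. *)
Let k (u : R) : R := if 0 <= u then h u - h 0 - h' 0 * u else 0.
Let k' (u : R) : R := h' (Num.max u 0) - h' 0.

Let ck' : continuous k'.
Proof.
apply: contB; last exact: cont_cst.
apply: (cont_comp (f := fun u => Num.max u 0)) ch'.
by move=> x; apply: continuous_max; [exact: cvg_id|exact: cvg_cst].
Qed.

Let dk (u : R) : der k u (k' u).
Proof.
pose c : R := - (`|u| + 1).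
have c0 : c < 0 by rewrite oppr_lt0 ltr_wpDl.
have cu : c < u by rewrite ltrNl (le_lt_trans (ler_norm _))// normrN ltrDl.
have E0 (v : R) : c < v -> v <= 0 -> primb c k' v = 0.
  move=> cv v0; have := primb_itv ck' (ltW cv) v0.
  rewrite Rintegral_eq0 ?primb0; first by move=> /eqP; rewrite eq_sym sub0r oppr_eq0 => /eqP.
  by move=> s; rewrite /= in_itv /= => /andP[_ s0]; rewrite /k' max_r// subrr.
have E1 (v : R) : 0 <= v -> primb c k' v = h v - h 0 - h' 0 * v.
  move=> v0; pose D w := primb c k' w - (h w - h 0 - h' 0 * w).
  have dD (w : R) : 0 <= w -> der D w 0.
    move=> w0; rewrite /D; apply: der_eq.
      apply: derB; first exact: der_primb ck' (lt_le_trans c0 w0).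
      apply: derB; last exact: derZ _ (derI _).
      exact: derB (dh w) (derC _ _).
    by rewrite /k' max_l//; ring.
  have cD : {within `[0, v], continuous D}.
    by apply: cont_within => w; rewrite /= in_itv /= => /andP[w0 _]; exact: der_cont (dD w w0).
  have D0 : D 0 = 0 by rewrite /D primb0; ring.
  apply/eqP; rewrite -subr_eq0 -/(D v) -D0 eq_le; apply/andP; split.
    by apply: (@der_le0_ge _ _ (fun=> 0)) => // x x0 _; split=> //; apply: dD; exact: ltW.
  by apply: (@der_ge0_le _ _ (fun=> 0)) => // x x0 _; split=> //; apply: dD; exact: ltW.
apply: der_near (der_primb ck' cu).
near=> v; rewrite /k; case: ifPn => v0; first exact: E1.
apply: E0; last by rewrite ltW// ltNge.
by near: v; exact: lt_nbhsr.
Unshelve. all: by end_near. Qed.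

Let ck : continuous k. Proof. by move=> u; exact: der_cont (dk u). Qed.

Let frozen (T t : R) : R := \int[mu]_(y in `[0, T]) (g y * k (t - y)).

Let cont_shift (f : R -> R) (t : R) : continuous f -> continuous (fun y => g y * f (t - y)).
Proof.
move=> cf; apply: contM cg _; apply: (cont_comp (f := fun y => t - y)) cf.
exact: contB (@cont_cst _ _) (@cont_id _).
Qed.

Let dfrozen (T t : R) : - T < t < T ->
  der (frozen T) t (\int[mu]_(y in `[0, T]) (g y * k' (t - y))).
Proof.
move=> tT; have mI : measurable `[0 : R, T]%classic by [].
have [Mg Mg0 gM] := cont_bnd 0 T cg.
have [Mk Mk0 kM] := cont_bnd (- (2 * T)) T ck'.
have d1 (x y : R) : der (fun x => g y * k (x - y)) x (g y * k' (x - y)).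
  apply: derZ; apply: der_eq.
    apply: (@der_comp _ x (fun x => x - y) k); last exact: dk.
    exact: derB (derI _) (derC _ _).
  by rewrite subr0 mulr1.
have intf x : `](- T), T[%classic x -> mu.-integrable `[0, T] (EFin \o (fun y => g y * k (x - y))).
  by move=> _; apply: continuous_itv_integrable; exact: cont_shift.
have intG : mu.-integrable `[0, T] (EFin \o (fun=> Mg * Mk)).
  by apply: continuous_itv_integrable; exact: cont_cst.
have G_ub x y : `](- T), T[%classic x -> `[0, T]%classic y ->
    `|partial1of2 (fun x y => g y * k (x - y)) x y| <= Mg * Mk.
  rewrite /= !in_itv /= => /andP[x1 x2] /andP[y1 y2].
  rewrite /partial1of2 derive1E; have [_ ->] := d1 x y.
  by rewrite normrM ler_pM// ?gM// kM//; lra.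
have It : `](- T), T[%classic t by rewrite /= in_itv.
have dbl x y : `](- T), T[%classic x -> `[0, T]%classic y ->
    derivable ((fun x y => g y * k (x - y)) ^~ y) x 1.
  by move=> _ _; have [] := d1 x y.
have G0 (y : R) : 0 <= Mg * Mk by exact: mulr_ge0.
apply: DeriveDef.
  exact: (@derivable_under_integral _ _ _ mu _ _ mI _ _ _ It intf dbl _ G0 intG G_ub).
rewrite -derive1E.
rewrite (@differentiation_under_integral _ _ _ mu _ _ mI _ _ _ It intf dbl _ G0 intG G_ub).
apply: eq_Rintegral => y _; rewrite /partial1of2 derive1E.
by have [_ ->] := d1 t y.
Qed.

Let split_frozen (T t : R) (q : R -> R) : continuous q -> (forall u, u <= 0 -> q u = 0) ->
  t <= T -> 0 <= T -> \int[mu]_(y in `[0, T]) (g y * q (t - y)) = conv g q t.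
Proof.
move=> cq q0 tT T0; rewrite /conv.
have [t0|t0] := ltP t 0.
  rewrite integ_lt0// Rintegral_eq0// => s; rewrite /= in_itv /= => /andP[s0 _].
  by rewrite q0 ?mulr0//; lra.
rewrite -/(integ _ _); apply/eqP; rewrite -subr_eq0 -integ_itv//; last exact: cont_shift.
apply/eqP; apply: Rintegral_eq0 => s; rewrite /= in_itv /= => /andP[s0 _].
by rewrite q0 ?mulr0//; lra.
Qed.

Let gid (y : R) : R := g y * y.

Let conv_frozen (T t : R) : 0 <= T -> t <= T -> conv g h t =
  frozen T t + (h 0 * integ g t + h' 0 * (t * integ g t - integ gid t)).
Proof.
move=> T0 tT; rewrite /frozen split_frozen//; last first.
  move=> u u0; rewrite /k; case: ifPn => // u0'.
  have -> : u = 0 by lra.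
  by ring.
rewrite /conv -!integZ//.
have cgid : continuous gid by exact: contM cg (@cont_id _).
rewrite -integB//; last exact: contM (@cont_cst _ _) cg.
rewrite -integZ//; last by apply: contB => //; exact: contM (@cont_cst _ _) cg.
rewrite -integD//; [|exact: contM (@cont_cst _ _) cg|]; last first.
  by apply: contM (@cont_cst _ _) _; apply: contB => //; exact: contM (@cont_cst _ _) cg.
rewrite -integD//; [|exact: cont_shift|]; last first.
  apply: contD; first exact: contM (@cont_cst _ _) cg.
  by apply: contM (@cont_cst _ _) _; apply: contB => //; exact: contM (@cont_cst _ _) cg.
apply: eq_integ => s s0 st; rewrite /k /gid ifT; last lra.
by ring.
Qed.

(** The integrand and the upper limit both depend on t.  Up to its value and slope
    at 0, [h] can be replaced by a C^1 function vanishing on the left, for which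
    the upper limit may be any T >= t; then differentiation under the integral
    sign applies. *)
Lemma der_conv (t : R) : 0 < t ->
  der (conv g h) t (g t * h 0 + conv g h' t).
Proof.
move=> t0; pose T := t + 1; have tT : - T < t < T by rewrite /T; lra.
have cgid : continuous gid by exact: contM cg (@cont_id _).
apply: (@der_near _ _ (fun t => frozen T t + (h 0 * integ g t + h' 0 * (t * integ g t - integ gid t)))).
  near=> s; rewrite -conv_frozen//; first by rewrite /T; lra.
  by near: s; apply: near_le; rewrite /T; lra.
apply: der_eq.
  apply: derD; first exact: dfrozen tT.
  apply: derD; first by apply: derZ; exact: der_integ.
  apply: derZ; apply: derB; last exact: der_integ.
  apply: derM; [exact: derI|exact: der_integ].
rewrite split_frozen//; [|by move=> u u0; rewrite /k' max_r// subrr|lra|lra].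
have -> : conv g k' t = conv g h' t - h' 0 * integ g t.
  rewrite /conv -integZ// -integB//; [|exact: cont_shift|exact: contM (@cont_cst _ _) cg].
  by apply: eq_integ => s s0 st; rewrite /k' max_l; [ring|lra].
by rewrite /gid; ring.
Unshelve. all: by end_near. Qed.

Lemma conv_continuous : continuous (conv g h).
Proof.
move=> t; pose T := `|t| + 1.
have tT : - T < t < T.
  by rewrite -ltr_norml /T ltrDl.
have T0 : 0 <= T by rewrite /T addr_ge0.
have cgid : continuous gid by exact: contM cg (@cont_id _).
have := dfrozen tT => /der_cont cF.
have c2 : {for t, continuous (fun t => frozen T t + (h 0 * integ g t + h' 0 * (t * integ g t - integ gid t)))}.
  apply: (cvgD cF); move: t {tT T T0 cF}.
  apply: contD; first exact: contM (@cont_cst _ _) (integ_continuous cg).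
  apply: contM (@cont_cst _ _) _; apply: contB; last exact: integ_continuous.
  exact: contM (@cont_id _) (integ_continuous cg).
rewrite /prop_for /continuous_at (conv_frozen T0); last lra.
apply: cvg_trans c2; apply: near_eq_cvg; near=> s.
rewrite (conv_frozen T0)//; near: s; apply: near_le; lra.
Unshelve. all: by end_near. Qed.

End Convolution.

(** * The memory functionals of one mode *)

Section MemoryKernel.
Context {R : realType}.
Variables (g g' om : R -> R).
Hypothesis cg : continuous g.
Hypothesis com : continuous om.
Hypothesis g_ge0 : forall t : R, 0 <= t -> 0 <= g t.
Hypothesis om_ge0 : forall t : R, 0 <= t -> 0 <= om t.
Hypothesis dg : forall t : R, 0 < t -> der g t (g' t).
Hypothesis g'_le : forall t : R, 0 < t -> g' t <= - om t.

(** Integration by parts against -dg.  Derivatives in the upper bound t are compared,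
    because g' is given at each point but is not known to be integrable. *)
Lemma kernel_ibp (q q' : R -> R) (t : R) : 0 <= t ->
  (forall s, der q s (q' s)) -> continuous q' ->
  (forall s, 0 <= s -> s <= t -> 0 <= q s) ->
  integ (fun s => om s * q s) t <= g 0 * q 0 - g t * q t + integ (fun s => g s * q' s) t.
Proof.
move=> t0 dq cq' q0.
have cq : continuous q by move=> s; exact: der_cont (dq s).
have c1 : continuous (fun s => g s * q' s) by exact: contM.
have c2 : continuous (fun s => om s * q s) by exact: contM.
pose F s := integ (fun s => g s * q' s) s - g s * q s - integ (fun s => om s * q s) s.
pose dF s := g s * q' s - (g' s * q s + g s * q' s) - om s * q s.
suff : F 0 <= F t by rewrite /F !integ0; lra.
apply: (@der_ge0_le _ F dF) => //.
  apply: continuous_subspaceT; apply: contB; last exact: integ_continuous.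
  by apply: contB; [exact: integ_continuous|exact: contM].
move=> s s0 st; split.
  apply: derB; last exact: der_integ.
  by apply: derB; [exact: der_integ|apply: derM; [exact: dg|exact: dq]].
have := g'_le s0; have := q0 _ (ltW s0) (ltW st); rewrite /dF; nra.
Qed.

Variables (b b' : R -> R).
Hypothesis db : forall t : R, der b t (b' t).
Hypothesis cb' : continuous b'.

Let cb : continuous b. Proof. by move=> s; exact: der_cont (db s). Qed.

(** With r(s) = b(t) - b(t - s): the integrals over [0,t] of g r and g r^2, and
    the derivatives of the convolutions of g with b and b^2. *)
Definition mem1 t := integ g t * b t - conv g b t.
Definition mem2 t :=
  integ g t * b t ^+ 2 - 2 * b t * conv g b t + conv g (fun s => b s ^+ 2) t.
Definition dconv1 t := g t * b 0 + conv g b' t.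
Definition dconv2 t := g t * b 0 ^+ 2 + conv g (fun s => 2 * b s * b' s) t.

(** The integrals of r and r^2 against the measure -dg. *)
Definition dis1 t := dconv1 t - g t * b t.
Definition dis2 t := 2 * b t * dconv1 t - dconv2 t - g t * b t ^+ 2.

Let csh (f : R -> R) (t : R) : continuous f -> continuous (fun y => f (t - y)).
Proof.
move=> cf; apply: (cont_comp (f := fun y => t - y)) cf.
exact: contB (@cont_cst _ _) (@cont_id _).
Qed.

Let cgs (f : R -> R) (t : R) : continuous f -> continuous (fun y => g y * f (t - y)).
Proof. by move=> cf; apply: contM cg _; exact: csh. Qed.

Lemma der_conv1 (t : R) : 0 < t -> der (conv g b) t (dconv1 t).
Proof. by move=> t0; exact: der_conv. Qed.

Lemma der_conv2 (t : R) : 0 < t -> der (conv g (fun s => b s ^+ 2)) t (dconv2 t).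
Proof.
move=> t0; apply: (der_conv cg (h := fun s => b s ^+ 2) (h' := fun s => 2 * b s * b' s)) => //.
  by move=> u; exact: derX2.
by apply: contM => //; apply: contM => //; exact: cont_cst.
Qed.

(** A quadratic polynomial in [lam], nonnegative for every [lam]: the
    Cauchy-Schwarz inequality [mem1_sqr_le] comes from its minimum. *)
Lemma mem2E_shift (lam t : R) :
  integ (fun s => g s * (b t - b (t - s) - lam) ^+ 2) t =
  mem2 t - 2 * lam * mem1 t + lam ^+ 2 * integ g t.
Proof.
have c2 : continuous (fun s => b s ^+ 2) by exact: contX2.
have -> : integ (fun s => g s * (b t - b (t - s) - lam) ^+ 2) t =
  integ (fun s => (b t - lam) ^+ 2 * g s - (2 * (b t - lam)) * (g s * b (t - s))
                 + g s * b (t - s) ^+ 2) t.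
  by apply: eq_integ => s _ _; ring.
have c3 : continuous (fun s => (b t - lam) ^+ 2 * g s) by apply: contM => //; exact: cont_cst.
have c4 : continuous (fun s => 2 * (b t - lam) * (g s * b (t - s))).
  by apply: contM; [exact: cont_cst|exact: cgs].
have c5 := @cgs _ t c2.
rewrite integD//; last exact: contB.
rewrite integB//.
rewrite !integZ//; last exact: cgs.
by rewrite /mem2 /mem1 -/(conv g b t) -/(conv g (fun s => b s ^+ 2) t); ring.
Qed.

Lemma mem2E t : mem2 t = integ (fun s => g s * (b t - b (t - s)) ^+ 2) t.
Proof.
have := mem2E_shift 0 t; rewrite expr0n /= !(mul0r, mulr0, subr0, addr0) => <-.
by apply: eq_integ => s _ _; rewrite subr0.
Qed.

Lemma mem1_sqr_le (t K : R) : 0 < K -> integ g t <= K -> mem1 t ^+ 2 <= K * mem2 t.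
Proof.
move=> K0 gK.
have : 0 <= mem2 t - 2 * (mem1 t / K) * mem1 t + (mem1 t / K) ^+ 2 * integ g t.
  rewrite -mem2E_shift; apply: integ_ge0 => s s0 _; apply: mulr_ge0; last exact: sqr_ge0.
  exact: g_ge0.
set z := mem1 t / K => H; have -> : mem1 t = K * z by rewrite /z mulrC divfK// gt_eqF.
have zE : mem1 t = K * z by rewrite /z mulrC divfK// gt_eqF.
rewrite zE in H; have := sqr_ge0 z => z2.
have : z ^+ 2 * integ g t <= z ^+ 2 * K by exact: ler_wpM2l.
move=> H2; have -> : (K * z) ^+ 2 = K * (K * z ^+ 2) by ring.
by apply: ler_wpM2l; [exact: ltW|lra].
Qed.

(** As [mem2E_shift], for the measure -dg: only a lower bound is available, by
    [kernel_ibp] applied to q(s) = (b(t) - b(t-s) - lam)^2. *)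
Lemma dis2_shift (lam t : R) : 0 <= t ->
  integ (fun s => om s * (b t - b (t - s) - lam) ^+ 2) t <=
  dis2 t - 2 * lam * dis1 t + lam ^+ 2 * (g 0 - g t).
Proof.
move=> t0.
have dq s : der (fun s => (b t - b (t - s) - lam) ^+ 2) s
    (2 * (b t - b (t - s) - lam) * b' (t - s)).
  apply: derX2; apply: der_eq.
    apply: derB (derC _ _); apply: derB (derC _ _) _.
    by apply: (der_comp (f := fun s => t - s)) (db _); exact: derB (derC _ _) (derI _).
  by ring.
have c2 : continuous (fun s => 2 * b s * b' s).
  by apply: contM => //; apply: contM => //; exact: cont_cst.
have cq' : continuous (fun s => 2 * (b t - b (t - s) - lam) * b' (t - s)).
  apply: contM; last exact: csh.
  apply: contM; first exact: cont_cst.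
  apply: contB; last exact: cont_cst.
  by apply: contB; [exact: cont_cst|exact: csh].
apply: le_trans (kernel_ibp t0 dq cq' _) _; first by move=> *; exact: sqr_ge0.
rewrite subr0 !subrr.
have -> : integ (fun s => g s * (2 * (b t - b (t - s) - lam) * b' (t - s))) t =
  integ (fun s => (2 * (b t - lam)) * (g s * b' (t - s)) - g s * (2 * b (t - s) * b' (t - s))) t.
  by apply: eq_integ => s _ _; ring.
have c3 : continuous (fun s => 2 * (b t - lam) * (g s * b' (t - s))).
  by apply: contM; [exact: cont_cst|exact: cgs].
have c4 := @cgs _ t c2.
rewrite integB//.
rewrite integZ; last exact: cgs.
rewrite -/(conv g b' t) -/(conv g (fun s => 2 * b s * b' s) t) /dis2 /dis1 /dconv1 /dconv2.
by rewrite le_eqVlt; apply/orP; left; apply/eqP; ring.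
Qed.

Lemma le_dis2 t : 0 <= t ->
  integ (fun s => om s * (b t - b (t - s)) ^+ 2) t <= dis2 t.
Proof.
move=> /(dis2_shift 0); rewrite expr0n /= !(mul0r, mulr0, subr0, addr0).
by under [X in X <= _ -> _]eq_integ => s _ _ do rewrite subr0.
Qed.

Lemma dis2_ge0 t : 0 <= t -> 0 <= dis2 t.
Proof.
move=> t0; apply: le_trans (le_dis2 t0); apply: integ_ge0 => s s0 _.
by apply: mulr_ge0; [exact: om_ge0|exact: sqr_ge0].
Qed.

Lemma dis1_sqr_le (t : R) : 0 <= t -> 0 < g 0 -> dis1 t ^+ 2 <= g 0 * dis2 t.
Proof.
move=> t0 g0; set z := dis1 t / g 0.
have zE : dis1 t = g 0 * z by rewrite /z mulrC divfK// gt_eqF.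
have : 0 <= dis2 t - 2 * z * dis1 t + z ^+ 2 * (g 0 - g t).
  apply: le_trans (dis2_shift z t0); apply: integ_ge0 => s s0 _.
  by apply: mulr_ge0; [exact: om_ge0|exact: sqr_ge0].
rewrite zE => H; have : 0 <= z ^+ 2 * g t by rewrite mulr_ge0 ?sqr_ge0// g_ge0.
move=> H2; have -> : (g 0 * z) ^+ 2 = g 0 * (g 0 * z ^+ 2) by ring.
apply: ler_wpM2l; first exact: ltW.
lra.
Qed.

End MemoryKernel.

(** * Multiplier estimates at a fixed time *)

Section MultiplierAlgebra.
Context {R : realType}.
Variables (rho1 rho2 k k2 kap g0 mu1 : R).
Hypothesis rho1_gt0 : 0 < rho1.
Hypothesis rho2_gt0 : 0 < rho2.
Hypothesis k_gt0 : 0 < k.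
Hypothesis k2_gt0 : 0 < k2.
Hypothesis kap_gt0 : 0 < kap.
Hypothesis g0_gt0 : 0 < g0.
Hypothesis mu1_gt0 : 0 < mu1.
Hypothesis speed : rho2 = rho1 * k2 / k.

Lemma young (e x y : R) : 0 < e -> x * y <= e * x ^+ 2 + (4 * e)^-1 * y ^+ 2.
Proof.
move=> e0; have e4 : 0 < 4 * e by lra.
rewrite -subr_ge0.
have -> : e * x ^+ 2 + (4 * e)^-1 * y ^+ 2 - x * y = (4 * e)^-1 * (2 * e * x - y) ^+ 2.
  by field; rewrite gt_eqF.
by rewrite mulr_ge0 ?sqr_ge0// invr_ge0 ltW.
Qed.

(* One mode at one instant: displacements a b c, velocities p q u, frequency mu;
   G and gt stand for the integral of g over [0,t] and for g(t), and m1 m2 d1 d2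
   for [mem1], [mem2], [dis1] and [dis2]. *)
Variables (l mu a b c p q u G gt m1 m2 d1 d2 : R).
Hypothesis l_gt0 : 0 < l.
Hypothesis l_le : l <= mu1 / 4.
Hypothesis mu_ge : mu1 <= mu.
Hypothesis G_ge0 : 0 <= G.
Hypothesis G_le : kap <= k2 - G.
Hypothesis gt_ge0 : 0 <= gt.
Hypothesis gt_le : gt <= g0.
Hypothesis m1_le : m1 ^+ 2 <= k2 * m2.
Hypothesis d1_le : d1 ^+ 2 <= g0 * d2.
Hypothesis d2_ge0 : 0 <= d2.

Definition shr := mu * a + b + l * c.
Definition axl := - mu * c - l * a.
Let S := shr.
Let N := axl.
Let z := mu * b.
Let W := mu ^+ 2 * m2.
Let D := 2^-1 * mu ^+ 2 * (gt * b ^+ 2 + d2).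

Definition nrj := 2^-1 * (rho1 * p ^+ 2 + rho2 * q ^+ 2 + rho1 * u ^+ 2
  + (k2 - G) * z ^+ 2 + k * axl ^+ 2 + k * shr ^+ 2 + W).

(** The energy without its coefficients. *)
Definition quad := p ^+ 2 + q ^+ 2 + u ^+ 2 + z ^+ 2 + axl ^+ 2 + shr ^+ 2 + W.

Let mu_gt0 : 0 < mu. Proof. exact: lt_le_trans mu_ge. Qed.

Let m2_ge0 : 0 <= m2.
Proof. by have := le_trans (sqr_ge0 _) m1_le; rewrite pmulr_rge0. Qed.

Let W_ge0 : 0 <= W. Proof. by rewrite mulr_ge0// sqr_ge0. Qed.

Let low (x : R) : mu1 ^+ 2 * x ^+ 2 <= (mu * x) ^+ 2.
Proof. by rewrite exprMn ler_wpM2r ?sqr_ge0// lerXn2r// nnegrE ltW. Qed.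

Let low' (x : R) : x ^+ 2 <= mu1 ^- 2 * (mu * x) ^+ 2.
Proof. by rewrite ler_pdivlMl ?exprn_gt0// low. Qed.

Let r_le : (mu * m1) ^+ 2 <= k2 * W.
Proof.
rewrite /W exprMn [X in _ <= X]mulrCA; apply: ler_wpM2l m1_le; exact: sqr_ge0.
Qed.

Let D_ge : 2^-1 * mu ^+ 2 * d2 <= D.
Proof.
rewrite /D; apply: ler_wpM2l; first by rewrite mulr_ge0 ?sqr_ge0.
by rewrite lerDr mulr_ge0 ?sqr_ge0.
Qed.

Let D_ge' : 2^-1 * mu ^+ 2 * (gt * b ^+ 2) <= D.
Proof. rewrite /D; apply: ler_wpM2l; first by rewrite mulr_ge0 ?sqr_ge0.
by rewrite lerDl. Qed.

Let e_le : (mu * d1) ^+ 2 <= 2 * g0 * D.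
Proof.
have -> : 2 * g0 * D = g0 * (2 * D) by ring.
apply: (@le_trans _ _ (g0 * (mu ^+ 2 * d2))).
  rewrite exprMn [X in _ <= X]mulrCA; apply: ler_wpM2l d1_le; exact: sqr_ge0.
by apply: ler_wpM2l; [exact: ltW|move: D_ge; lra].
Qed.

Let f_le : (mu * (gt * b)) ^+ 2 <= 2 * g0 * D.
Proof.
have -> : 2 * g0 * D = g0 * (2 * D) by ring.
have -> : (mu * (gt * b)) ^+ 2 = gt * (mu ^+ 2 * (gt * b ^+ 2)) by ring.
apply: (@le_trans _ _ (g0 * (mu ^+ 2 * (gt * b ^+ 2)))).
  apply: ler_wpM2r gt_le; apply: mulr_ge0; first exact: sqr_ge0.
  by apply: mulr_ge0 => //; exact: sqr_ge0.
by apply: ler_wpM2l; [exact: ltW|move: D_ge'; lra].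
Qed.

(** [dFi] is the derivative of the functional [Fi] below along the equations.
    Each one produces a square with a good sign: [dF1] gives q (through the memory
    kernel, as G > 0), [dF2] the shear, [dF5] the strain z = mu b, and the pair
    [- dF3 + 2 l dF4] gives p, u and the axial force.  In [dF2] the terms in
    mu p q have cancelled, by the equality of the speeds. *)
Definition dF1 := (mu ^+ 2 * (k2 - G) * b + k * shr + mu ^+ 2 * m1) * m1
  - rho2 * q * (G * q - d1).
Definition dF2 := - k * shr ^+ 2 + rho2 * q ^+ 2 + l * rho2 * (q * u)
  - l * mu * ((k2 - G) * b + m1) * axl + rho1 / k * mu * (gt * b + d1) * p.
Definition dF3 := l * k * axl ^+ 2 - l * k * shr ^+ 2 - l * rho1 * p ^+ 2
  + rho1 * (q * u) + l * rho1 * u ^+ 2.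
Definition dF4 := - rho1 * p ^+ 2 + a * (k * mu * shr - l * k * axl).
Definition dF5 := rho2 * q ^+ 2 - mu ^+ 2 * (k2 - G) * b ^+ 2 - k * shr * b
  - mu ^+ 2 * b * m1.

Lemma dF5_le : dF5 <= - (kap / 2) * z ^+ 2 + rho2 * q ^+ 2
  + (kap * mu1 ^+ 2)^-1 * k ^+ 2 * shr ^+ 2 + kap^-1 * k2 * W.
Proof.
have e1 : 0 < kap * mu1 ^+ 2 / 4 by rewrite divr_gt0// mulr_gt0// exprn_gt0.
have e2 : 0 < kap / 4 by rewrite divr_gt0.
have h1 := young (- b) (k * shr) e1.
have h2 := young (- z) (mu * m1) e2.
have h3 : kap * (mu1 ^+ 2 * b ^+ 2) <= kap * z ^+ 2 by apply: ler_wpM2l (low b); exact: ltW.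
have h4 : kap * z ^+ 2 <= (k2 - G) * z ^+ 2 by rewrite ler_wpM2r// sqr_ge0.
have h5 : kap^-1 * (mu * m1) ^+ 2 <= kap^-1 * (k2 * W).
  by rewrite ler_wpM2l// invr_ge0 ltW.
have E1 : 4 * (kap * mu1 ^+ 2 / 4) = kap * mu1 ^+ 2 by field.
have E2 : 4 * (kap / 4) = kap by field.
rewrite E1 in h1; rewrite E2 in h2.
by rewrite /dF5; move: h1 h2 h3 h4 h5; rewrite /z; lra.
Qed.

Lemma dF2_le (e d : R) : 0 < e -> 0 < d ->
  dF2 <= - k * shr ^+ 2 + (rho2 + l * ((4 * e)^-1 * rho2 ^+ 2)) * q ^+ 2
  + l * e * (u ^+ 2 + axl ^+ 2)
  + l * (2 * e)^-1 * k2 ^+ 2 * z ^+ 2 + l * (2 * e)^-1 * k2 * W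
  + d * p ^+ 2 + (4 * d)^-1 * (rho1 / k) ^+ 2 * (8 * g0 * D).
Proof.
move=> e0 d0.
have e20 : 0 < e / 2 by rewrite divr_gt0.
have h1 : l * _ <= l * _ := ler_wpM2l (ltW l_gt0) (young u (rho2 * q) e0).
have h2 : l * _ <= l * _ := ler_wpM2l (ltW l_gt0) (young (- axl) ((k2 - G) * z) e20).
have h3 : l * _ <= l * _ := ler_wpM2l (ltW l_gt0) (young (- axl) (mu * m1) e20).
have h4 := young p (rho1 / k * (mu * (gt * b) + mu * d1)) d0.
have h5 : (4 * d)^-1 * (rho1 / k) ^+ 2 * (mu * (gt * b) + mu * d1) ^+ 2 <=
    (4 * d)^-1 * (rho1 / k) ^+ 2 * (8 * g0 * D).
  apply: ler_wpM2l; first by rewrite mulr_ge0 ?sqr_ge0// invr_ge0 mulr_ge0// ltW.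
  have := sqr_ge0 (mu * (gt * b) - mu * d1); move: e_le f_le; lra.
have E2 : 4 * (e / 2) = 2 * e by field.
rewrite E2 in h2 h3.
have i0 : 0 <= l * (2 * e)^-1 by rewrite mulr_ge0// ?invr_ge0 ltW// mulr_gt0.
have h6 : l * (2 * e)^-1 * ((k2 - G) * z) ^+ 2 <= l * (2 * e)^-1 * (k2 ^+ 2 * z ^+ 2).
  rewrite exprMn; apply: ler_wpM2l => //; apply: ler_wpM2r; first exact: sqr_ge0.
  by apply: lerXn2r; rewrite ?nnegrE; move: kap_gt0 k2_gt0 G_le G_ge0; lra.
have h7 : l * (2 * e)^-1 * (mu * m1) ^+ 2 <= l * (2 * e)^-1 * (k2 * W) by exact: ler_wpM2l.
by rewrite /dF2; move: h1 h2 h3 h4 h5 h6 h7; rewrite /z; lra.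
Qed.

(* N^2 and (S - b)^2 are the squares of mu c + l a and mu a + l c; as l <= mu / 4 they
   control a and c. *)
Let xy_le : 2 * (l * a) ^+ 2 + (l * c) ^+ 2 / 8 <= (S ^+ 2 + b ^+ 2) / 2 + N ^+ 2 / 8.
Proof.
have lmu : 16 * l ^+ 2 <= mu ^+ 2.
  have -> : 16 * l ^+ 2 = (4 * l) ^+ 2 by ring.
  by apply: lerXn2r; rewrite ?nnegrE; move: l_gt0 l_le mu_ge mu1_gt0; lra.
have h1 : 16 * (l * a) ^+ 2 <= (mu * a) ^+ 2.
  by rewrite !exprMn mulrA ler_wpM2r// sqr_ge0.
have h2 : 16 * (l * c) ^+ 2 <= (mu * c) ^+ 2.
  by rewrite !exprMn mulrA ler_wpM2r// sqr_ge0.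
have h3 : (mu * a) ^+ 2 <= 3 * (S ^+ 2 + b ^+ 2 + (l * c) ^+ 2).
  have -> : mu * a = S - b - l * c by rewrite /S /shr; ring.
  have := sqr_ge0 (S + b); have := sqr_ge0 (S + l * c); have := sqr_ge0 (b - l * c); lra.
have h4 : (mu * c) ^+ 2 <= 2 * (N ^+ 2 + (l * a) ^+ 2).
  have -> : mu * c = - N - l * a by rewrite /N /axl; ring.
  have := sqr_ge0 (N - l * a); lra.
have := sqr_ge0 S; have := sqr_ge0 N; have := sqr_ge0 b; lra.
Qed.

(** The coefficient rho1 / l of q^2 blows up as l tends to 0; it is harmless because
    the weight of [dF1] is chosen last. *)
Lemma dF34_le : - dF3 + 2 * l * dF4 <= - (l * rho1) * p ^+ 2
  - 3 / 4 * (l * rho1) * u ^+ 2 - l * k / 2 * axl ^+ 2 + 9 * (l * k) * shr ^+ 2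
  + 2 * (l * k) * (mu1 ^- 2 * z ^+ 2) + rho1 / l * q ^+ 2.
Proof.
have i4 : 0 < l / 4 by rewrite divr_gt0.
have h1 : rho1 * _ <= rho1 * _ := ler_wpM2l (ltW rho1_gt0) (young (- u) q i4).
have E1 : 4 * (l / 4) = l by field.
rewrite E1 in h1.
have lk : 0 <= l * k by rewrite mulr_ge0 ?ltW.
have h2 : l * k * (2 * (l * a) ^+ 2 + (l * c) ^+ 2 / 8) <= l * k * ((S ^+ 2 + b ^+ 2) / 2 + N ^+ 2 / 8).
  exact: ler_wpM2l.
have h3 : l * k * (- S * b) <= l * k * (2^-1 * S ^+ 2 + 2^-1 * b ^+ 2).
  apply: ler_wpM2l => //; have := sqr_ge0 (S + b); lra.
have h4 : l * k * (- S * (l * c)) <= l * k * (2 * S ^+ 2 + (l * c) ^+ 2 / 8).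
  apply: ler_wpM2l => //; have := sqr_ge0 (4 * S + l * c); lra.
have h5 : l * k * (- N * (l * a)) <= l * k * (N ^+ 2 / 8 + 2 * (l * a) ^+ 2).
  apply: ler_wpM2l => //; have := sqr_ge0 (N + 4 * (l * a)); lra.
have h6 : l * k * b ^+ 2 <= l * k * (mu1 ^- 2 * z ^+ 2) by apply: ler_wpM2l (low' b).
have E2 : a * (k * mu * shr - l * k * axl) = k * S * (S - b - l * c) - k * N * (l * a).
  by rewrite /S /N /shr; ring.
have h7 : 0 <= l * k * S ^+ 2 by rewrite mulr_ge0 ?sqr_ge0.
rewrite /dF3 /dF4 E2; rewrite -!/S -!/N -/S -/N.
by move: h1 h2 h3 h4 h5 h6 h7; rewrite -/S -/N; lra.
Qed.

Lemma dF1_le (g1 d : R) : 0 < g1 -> g1 <= G -> 0 < d ->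
  dF1 <= - (rho2 * g1 / 2) * q ^+ 2 + d * (z ^+ 2 + shr ^+ 2)
   + (1 + (4 * d)^-1 * k2 ^+ 2 + (4 * d)^-1 * k ^+ 2 * mu1 ^- 2) * (k2 * W)
   + rho2 * (2 * g1)^-1 * (mu1 ^- 2 * (2 * g0 * D)).
Proof.
move=> g10 gG d0.
have h1 := young z ((k2 - G) * (mu * m1)) d0.
have h2 := young shr (k * m1) d0.
have g2 : 0 < g1 / 2 by rewrite divr_gt0.
have h3 : rho2 * _ <= rho2 * _ := ler_wpM2l (ltW rho2_gt0) (young q d1 g2).
have E1 : 4 * (g1 / 2) = 2 * g1 by field.
rewrite E1 in h3.
have h4 : rho2 * (2 * g1)^-1 * d1 ^+ 2 <= rho2 * (2 * g1)^-1 * (mu1 ^- 2 * (2 * g0 * D)).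
  apply: ler_wpM2l; first by rewrite mulr_ge0 ?invr_ge0 ?mulr_ge0 ?ltW.
  apply: le_trans (low' d1) _; apply: ler_wpM2l e_le.
  by rewrite invr_ge0 sqr_ge0.
have i0 : 0 <= (4 * d)^-1 by rewrite invr_ge0 mulr_ge0 ?ltW.
have h5 : (4 * d)^-1 * ((k2 - G) * (mu * m1)) ^+ 2 <= (4 * d)^-1 * (k2 ^+ 2 * (k2 * W)).
  apply: ler_wpM2l => //; rewrite exprMn; apply: ler_pM => //; try exact: sqr_ge0.
  by apply: lerXn2r; rewrite ?nnegrE; move: kap_gt0 k2_gt0 G_le G_ge0; lra.
have h6 : (4 * d)^-1 * k ^+ 2 * m1 ^+ 2 <= (4 * d)^-1 * k ^+ 2 * (mu1 ^- 2 * (k2 * W)).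
  apply: ler_wpM2l; first by rewrite mulr_ge0 ?sqr_ge0.
  apply: le_trans (low' m1) _; apply: ler_wpM2l r_le.
  by rewrite invr_ge0 sqr_ge0.
have h7 : rho2 * g1 * q ^+ 2 <= rho2 * G * q ^+ 2.
  by rewrite ler_wpM2r ?sqr_ge0// ler_wpM2l// ltW.
by rewrite /dF1; move: h1 h2 h3 h4 h5 h6 h7 r_le; rewrite /z; lra.
Qed.

(** [F1] tests the equation of b with its memory, [F2] with the shear, [F5] with b;
    [F4] tests the equation of a with a, and [F3] couples the equations of a and c. *)
Definition F1 := - rho2 * q * m1.
Definition F2 := rho2 * q * shr - rho1 / k * mu * ((k2 - G) * b + m1) * p.
Definition F3 := rho1 * (p * axl + u * shr).
Definition F4 := - rho1 * a * p.
Definition F5 := rho2 * b * q.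

Let ab (x y : R) : `|x * y| <= x ^+ 2 + y ^+ 2.
Proof.
rewrite ler_norml; have := sqr_ge0 (x + y); have := sqr_ge0 (x - y).
have := sqr_ge0 x; have := sqr_ge0 y; lra.
Qed.

Let q_ge0 : [/\ 0 <= p ^+ 2, 0 <= q ^+ 2, 0 <= u ^+ 2, 0 <= z ^+ 2 &
  [/\ 0 <= axl ^+ 2, 0 <= shr ^+ 2 & 0 <= W]].
Proof. by split; try exact: sqr_ge0; split; try exact: sqr_ge0. Qed.

Lemma F1_le : `|F1| <= rho2 * (1 + mu1 ^- 2 * k2) * quad.
Proof.
rewrite /F1 -mulrA mulNr normrN normrM gtr0_norm// -mulrA; apply: ler_wpM2l; first exact: ltW.
apply: le_trans (ab _ _) _.
have : m1 ^+ 2 <= mu1 ^- 2 * k2 * W.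
  apply: le_trans (low' m1) _; rewrite -mulrA; apply: ler_wpM2l r_le.
  by rewrite invr_ge0 sqr_ge0.
have : mu1 ^- 2 * k2 * W <= mu1 ^- 2 * k2 * quad.
  apply: ler_wpM2l; first by rewrite mulr_ge0 ?invr_ge0 ?sqr_ge0// ltW.
  by rewrite /quad; case: q_ge0 => ? ? ? ? [? ? ?]; lra.
rewrite mulrDl mul1r; have : q ^+ 2 <= quad.
  by rewrite /quad; case: q_ge0 => ? ? ? ? [? ? ?]; lra.
lra.
Qed.

Lemma F2_le : `|F2| <= (rho2 + rho1 / k * (2 + k2 ^+ 2 + k2)) * quad.
Proof.
have rk : 0 < rho1 / k by rewrite divr_gt0.
rewrite mulrDl; apply: le_trans (ler_normB _ _) _; apply: lerD.
  rewrite -mulrA normrM gtr0_norm//; apply: ler_wpM2l; first exact: ltW.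
  apply: le_trans (ab _ _) _.
  by rewrite /quad; case: q_ge0 => ? ? ? ? [? ? ?]; lra.
have -> : rho1 / k * mu * ((k2 - G) * b + m1) * p =
  rho1 / k * (((k2 - G) * z) * p + (mu * m1) * p) by rewrite /z; ring.
rewrite normrM gtr0_norm// -[X in _ <= X]mulrA; apply: ler_wpM2l; first exact: ltW.
apply: le_trans (ler_normD _ _) _; apply: le_trans (lerD (ab _ _) (ab _ _)) _.
have h6 : ((k2 - G) * z) ^+ 2 <= (k2 ^+ 2 * quad).
  rewrite exprMn; apply: ler_pM; try exact: sqr_ge0.
    by apply: lerXn2r; rewrite ?nnegrE; move: kap_gt0 k2_gt0 G_le G_ge0; lra.
  by rewrite /quad; case: q_ge0 => ? ? ? ? [? ? ?]; lra.
have h7 : k2 * W <= k2 * quad.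
  apply: ler_wpM2l; first exact: ltW.
  by rewrite /quad; case: q_ge0 => ? ? ? ? [? ? ?]; lra.
have : p ^+ 2 <= quad by rewrite /quad; case: q_ge0 => ? ? ? ? [? ? ?]; lra.
by move: r_le h6 h7; lra.
Qed.

Lemma F3_le : `|F3| <= rho1 * quad.
Proof.
rewrite /F3 normrM gtr0_norm//; apply: ler_wpM2l; first exact: ltW.
apply: le_trans (ler_normD _ _) _; apply: le_trans (lerD (ab _ _) (ab _ _)) _.
by rewrite /quad; case: q_ge0 => ? ? ? ? [? ? ?]; lra.
Qed.

Let b_le : b ^+ 2 <= mu1 ^- 2 * quad.
Proof.
apply: le_trans (low' b) _; apply: ler_wpM2l; first by rewrite invr_ge0 sqr_ge0.
rewrite -/z /quad; case: q_ge0 => ? ? ? ? [? ? ?]; lra.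
Qed.

Lemma F4_le : `|F4| <= rho1 * (1 + mu1 ^- 2 * (27 + 15 * mu1 ^- 2)) * quad.
Proof.
rewrite /F4 -mulrA mulNr normrN normrM gtr0_norm// -mulrA; apply: ler_wpM2l; first exact: ltW.
apply: le_trans (ab _ _) _.
have i0 : 0 <= mu1 ^- 2 by rewrite invr_ge0 sqr_ge0.
have h3 : (mu * a) ^+ 2 <= 3 * (S ^+ 2 + b ^+ 2 + (l * c) ^+ 2).
  have -> : mu * a = S - b - l * c by rewrite /S /shr; ring.
  have := sqr_ge0 (S + b); have := sqr_ge0 (S + l * c); have := sqr_ge0 (b - l * c); lra.
have h4 : (mu * a) ^+ 2 <= (27 + 15 * mu1 ^- 2) * quad.
  have : S ^+ 2 + N ^+ 2 <= quad.
    by rewrite /S /N /quad; case: q_ge0 => ? ? ? ? [? ? ?]; lra.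
  have := sqr_ge0 (l * a); have := sqr_ge0 N; have := sqr_ge0 S.
  move: h3 xy_le b_le; lra.
have h5 := low' a.
have h6 : mu1 ^- 2 * (mu * a) ^+ 2 <= mu1 ^- 2 * ((27 + 15 * mu1 ^- 2) * quad) by exact: ler_wpM2l.
have : p ^+ 2 <= quad by rewrite /quad; case: q_ge0 => ? ? ? ? [? ? ?]; lra.
lra.
Qed.

Lemma F5_le : `|F5| <= rho2 * (1 + mu1 ^- 2) * quad.
Proof.
rewrite /F5 -mulrA normrM gtr0_norm// -mulrA; apply: ler_wpM2l; first exact: ltW.
apply: le_trans (ab _ _) _.
have : q ^+ 2 <= quad by rewrite /quad; case: q_ge0 => ? ? ? ? [? ? ?]; lra.
move: b_le; lra.
Qed.

End MultiplierAlgebra.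

(** * The weights of the multipliers *)

Section Weights.
Context {R : realType}.
Variables (rho1 rho2 k k2 kap g0 mu1 : R).
Hypothesis rho1_gt0 : 0 < rho1.
Hypothesis rho2_gt0 : 0 < rho2.
Hypothesis k_gt0 : 0 < k.
Hypothesis k2_gt0 : 0 < k2.
Hypothesis kap_gt0 : 0 < kap.
Hypothesis g0_gt0 : 0 < g0.
Hypothesis mu1_gt0 : 0 < mu1.
Hypothesis speed : rho2 = rho1 * k2 / k.

(** The linear bookkeeping of the weights: one inequality per square to be
    absorbed.  The order of choice is n2 (for z), n1 (for the shear), then the
    small parameters e and d, then l, and finally n3 (for q) with d'. *)
Lemma combine_multipliers (X34 X2 X5 X1 P Q U Z N S W D l n1 n2 n3 eta : R)
    (a1 a2 a3 a4 z1 z2 q1 q2 e d d' b3 b4 c1 c2 e1 e2 q3 : R) :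
  0 <= l -> 0 <= n1 -> 0 <= n2 -> 0 <= n3 ->
  0 <= P -> 0 <= Q -> 0 <= U -> 0 <= Z -> 0 <= N -> 0 <= S ->
  X34 <= - a1 * P - a2 * U - a3 * N + a4 * S + z1 * Z + q1 * Q ->
  X2 <= - k * S + q2 * Q + l * e * (U + N) + z2 * Z + b3 * W + d * P + b4 * D ->
  X5 <= - (kap / 2) * Z + rho2 * Q + c1 * S + c2 * W ->
  X1 <= - q3 * Q + d' * (Z + S) + e1 * W + e2 * D ->
  - a1 + l * (n1 * d) <= - eta ->
  - a2 + l * (l * (n1 * e)) <= - eta ->
  - a3 + l * (l * (n1 * e)) <= - eta ->
  a4 - l * (n1 * k) + l * (n2 * c1) + n3 * d' <= - eta ->
  z1 + l * (n1 * z2) - l * (n2 * kap / 2) + n3 * d' <= - eta ->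
  q1 + l * (n1 * q2) + l * (n2 * rho2) - n3 * q3 <= - eta ->
  X34 + l * n1 * X2 + l * n2 * X5 + n3 * X1 <= - eta * (P + Q + U + Z + N + S)
   + (l * n1 * b3 + l * n2 * c2 + n3 * e1) * W + (l * n1 * b4 + n3 * e2) * D.
Proof.
move=> l0 n10 n20 n30 P0 Q0 U0 Z0 N0 S0 h34 h2 h5 h1 cP cU cN cS cZ cQ.
have i2 := ler_wpM2l (mulr_ge0 l0 n10) h2.
have i5 := ler_wpM2l (mulr_ge0 l0 n20) h5.
have i1 := ler_wpM2l n30 h1.
have iP := ler_wpM2r P0 cP; have iU := ler_wpM2r U0 cU; have iN := ler_wpM2r N0 cN.
have iS := ler_wpM2r S0 cS; have iZ := ler_wpM2r Z0 cZ; have iQ := ler_wpM2r Q0 cQ.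
move: h34 i2 i5 i1 iP iU iN iS iZ iQ; clear; lra.
Qed.

(** The constraints that link the kernel values of a mode at one instant. *)
Record mode_state (mu b G gt m1 m2 d1 d2 : R) : Prop := ModeState {
  ms_mu : mu1 <= mu;
  ms_G : 0 <= G;
  ms_kap : kap <= k2 - G;
  ms_gt : 0 <= gt;
  ms_g0 : gt <= g0;
  ms_m1 : m1 ^+ 2 <= k2 * m2;
  ms_d1 : d1 ^+ 2 <= g0 * d2;
  ms_d2 : 0 <= d2 }.

Definition multiplier (l n1 n2 n3 mu a b c p q u G m1 : R) :=
  - F3 rho1 l mu a b c p u + 2 * l * F4 rho1 a p
  + l * n1 * F2 rho1 rho2 k k2 l mu a b c p q G m1 + l * n2 * F5 rho2 b q
  + n3 * F1 rho2 q m1.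

Definition dmultiplier (l n1 n2 n3 mu a b c p q u G gt m1 d1 : R) :=
  - dF3 rho1 k l mu a b c p q u + 2 * l * dF4 rho1 k l mu a b c p
  + l * n1 * dF2 rho1 rho2 k k2 l mu a b c p q u G gt m1 d1
  + l * n2 * dF5 rho2 k k2 l mu a b c q G m1
  + n3 * dF1 rho2 k k2 l mu a b c q G m1 d1.

Lemma quad_equiv : exists E0 E1 : R, [/\ 0 < E0, 0 < E1 &
  forall l mu a b c p q u G gt m1 m2 d1 d2, mode_state mu b G gt m1 m2 d1 d2 ->
  E0 * quad l mu a b c p q u m2 <= nrj rho1 rho2 k k2 l mu a b c p q u G m2 <=
  E1 * quad l mu a b c p q u m2].
Proof.
exists (2^-1 * Num.min (Num.min rho1 rho2) (Num.min kap (Num.min k 1))), (rho1 + rho2 + k2 + k + 1).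
split; first by rewrite mulr_gt0 ?invr_gt0// !lt_min rho1_gt0 rho2_gt0 kap_gt0 k_gt0 ltr01.
  by pos.
move=> l mu a b c p q u G gt m1 m2 d1 d2 [hmu hG hkap hgt hg0 hm1 hd1 hd2].
have m20 : 0 <= m2 by have := le_trans (sqr_ge0 _) hm1; rewrite pmulr_rge0.
set E0 := Num.min _ _.
have [E01 E02 E03 E04] : [/\ E0 <= rho1, E0 <= rho2, E0 <= kap & E0 <= k].
  by rewrite /E0; split; rewrite !ge_min lexx ?orbT.
have E05 : E0 <= 1 by rewrite /E0 !ge_min lexx ?orbT.
clearbody E0.
have W0 : 0 <= mu ^+ 2 * m2 by pos.
have S0 := sqr_ge0 (shr l mu a b c); have N0 := sqr_ge0 (axl l mu a c).
have P0 := sqr_ge0 p; have Q0 := sqr_ge0 q; have U0 := sqr_ge0 u.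
have z0 := sqr_ge0 (mu * b).
apply/andP; split; rewrite /nrj /quad.
  have i1 := ler_wpM2r P0 E01; have i2 := ler_wpM2r Q0 E02; have i3 := ler_wpM2r U0 E01.
  have i4 := ler_wpM2r z0 (le_trans E03 hkap); have i5 := ler_wpM2r N0 E04.
  have i6 := ler_wpM2r S0 E04; have i7 := ler_wpM2r W0 E05.
  by move: i1 i2 i3 i4 i5 i6 i7; lra.
have [j1 j2 j3 j4] : [/\ 2^-1 * rho1 <= rho1 + rho2 + k2 + k + 1, 2^-1 * rho2 <= rho1 + rho2 + k2 + k + 1,
   2^-1 * (k2 - G) <= rho1 + rho2 + k2 + k + 1 & 2^-1 * k <= rho1 + rho2 + k2 + k + 1].
  by move: rho1_gt0 rho2_gt0 k2_gt0 k_gt0 hG; move=> *; split; lra.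
have j5 : 2^-1 <= rho1 + rho2 + k2 + k + 1 by move: rho1_gt0 rho2_gt0 k2_gt0 k_gt0; lra.
have i1 := ler_wpM2r P0 j1; have i2 := ler_wpM2r Q0 j2; have i3 := ler_wpM2r U0 j1.
have i4 := ler_wpM2r z0 j3; have i5 := ler_wpM2r N0 j4.
have i6 := ler_wpM2r S0 j4; have i7 := ler_wpM2r W0 j5.
by move: i1 i2 i3 i4 i5 i6 i7; lra.
Qed.

Lemma multiplier_bound l n1 n2 n3 : 0 < l -> l <= mu1 / 4 -> 0 <= n1 -> 0 <= n2 -> 0 <= n3 ->
  exists2 C : R, 0 <= C & forall mu a b c p q u G gt m1 m2 d1 d2, mode_state mu b G gt m1 m2 d1 d2 ->
  `|multiplier l n1 n2 n3 mu a b c p q u G m1| <= C * quad l mu a b c p q u m2.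
Proof.
move=> l_gt0 ll4 n10 n20 n30.
exists (rho1 + 2 * l * (rho1 * (1 + mu1 ^- 2 * (27 + 15 * mu1 ^- 2)))
  + l * n1 * (rho2 + rho1 / k * (2 + k2 ^+ 2 + k2)) + l * n2 * (rho2 * (1 + mu1 ^- 2))
  + n3 * (rho2 * (1 + mu1 ^- 2 * k2))); first by pos.
move=> mu a b c p q u G gt m1 m2 d1 d2 [hmu hG hkap hgt hg0 hm1 hd1 hd2].
have h1 := F1_le rho2_gt0 k2_gt0 mu1_gt0 l a b c p q u hmu hm1.
have h2 := F2_le rho1_gt0 rho2_gt0 k_gt0 k2_gt0 kap_gt0 l mu a b c p q u hG hkap hm1.
have h3 := F3_le rho1_gt0 k2_gt0 l mu a b c p q u hm1.
have h4 := F4_le rho1_gt0 k2_gt0 mu1_gt0 a b c p q u l_gt0 ll4 hmu hm1.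
have h5 := F5_le rho2_gt0 k2_gt0 mu1_gt0 l a b c p q u hmu hm1.
have lZ (x y z w : R) : 0 <= x -> `|y| <= z * w -> `|x * y| <= x * z * w.
  by move=> x0 yz; rewrite normrM ger0_norm// -mulrA; exact: ler_wpM2l.
rewrite /multiplier !(mulrDl _ _ (quad _ _ _ _ _ _ _ _ _)).
apply: le_trans (ler_normD _ _) _; apply: lerD; last by apply: lZ h1.
apply: le_trans (ler_normD _ _) _; apply: lerD; last by apply: lZ h5; pos.
apply: le_trans (ler_normD _ _) _; apply: lerD; last by apply: lZ h2; pos.
apply: le_trans (ler_normD _ _) _; apply: lerD; last by apply: lZ h4; pos.
by rewrite normrN.
Qed.

(** The threshold for l comes from the term n1 l^2 z^2 / e of [dF2], which has to be
    absorbed by the damping of order l that [dF5] gives to z. *)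
Lemma multiplier_decrease : exists2 l0 : R, 0 < l0 <= mu1 / 4 & forall l, 0 < l -> l < l0 ->
  forall g1, 0 < g1 -> exists n1 n2 n3 eta w dd : R,
  [/\ [/\ 0 < n1, 0 < n2, 0 < n3 & 0 < eta], 0 <= w, 0 <= dd &
  forall mu a b c p q u G gt m1 m2 d1 d2, mode_state mu b G gt m1 m2 d1 d2 -> g1 <= G ->
  dmultiplier l n1 n2 n3 mu a b c p q u G gt m1 d1 <=
  - eta * quad l mu a b c p q u m2 + w * (mu ^+ 2 * m2)
  + dd * (2^-1 * mu ^+ 2 * (gt * b ^+ 2 + d2))].
Proof.
have [C51 hC51 C51_ge0] : exists2 C, (kap * mu1 ^+ 2)^-1 * k ^+ 2 = C & 0 <= C.
  by eexists; [reflexivity|pos].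
have [K hK K_gt0] : exists2 K, k * mu1 ^- 2 = K & 0 < K by eexists; [reflexivity|pos].
have [n2 n20 hn2] : exists2 n2, 0 < n2 & n2 * kap / 2 = 2 * K + 3.
  exists (2 / kap * (2 * K + 3)); first by pos.
  by field; rewrite gt_eqF.
have [n1 n10 hn1] : exists2 n1, 0 < n1 & n1 * k = 11 * k + n2 * C51.
  exists (11 + n2 * C51 / k); last by field; rewrite gt_eqF.
  by rewrite ltr_wpDr//; pos.
have [c0 c00 [c0r c0k]] : exists2 c0, 0 < c0 & c0 <= rho1 / 4 /\ c0 <= k / 4.
  exists (Num.min rho1 k / 4); first by rewrite divr_gt0// lt_min rho1_gt0.
  by split; rewrite ler_pM2r ?invr_gt0// ge_min lexx ?orbT.
have [e e0 he] : exists2 e, 0 < e & n1 * e = c0.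
  by exists (c0 / n1); [pos|field; rewrite gt_eqF].
have [d d0 hd] : exists2 d, 0 < d & n1 * d = rho1 / 2.
  by exists (rho1 / (2 * n1)); [pos|field; rewrite gt_eqF].
have [l1 l10 hl1] : exists2 l1, 0 < l1 & forall l, l < l1 -> n1 * (l * (2 * e)^-1 * k2 ^+ 2) <= 1.
  exists (2 * e / (n1 * k2 ^+ 2)); first by pos.
  move=> l; rewrite ltr_pdivlMr; last by pos.
  move=> /ltW h.
  have -> : n1 * (l * (2 * e)^-1 * k2 ^+ 2) = l * (n1 * k2 ^+ 2) / (2 * e) by ring.
  by rewrite ler_pdivrMr ?mul1r//; pos.
exists (Num.min 1 (Num.min (mu1 / 4) l1)).
  by rewrite !lt_min ltr01 l10 divr_gt0//= ge_min ge_min lexx orbT.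
move=> l l_gt0; rewrite !lt_min => /and3P[/ltW l_lt1 /ltW l_lt4 /hl1 l_ltl1] g1 g10.
have [q2 hq2 q20] : exists2 q2, rho2 + l * ((4 * e)^-1 * rho2 ^+ 2) = q2 & 0 <= q2.
  by eexists; [reflexivity|pos].
have [n3 n30 hn3] : exists2 n3, 0 < n3 &
    n3 * (rho2 * g1 / 2) = rho1 / l + l * (n1 * q2) + l * (n2 * rho2) + 1.
  exists (2 * (rho1 / l + l * (n1 * q2) + l * (n2 * rho2) + 1) / (rho2 * g1)).
    apply: divr_gt0; last by pos.
    by apply: mulr_gt0 => //; apply: ltr_wpDl => //; pos.
  by field; rewrite !gt_eqF.
have [kk kk0 [kk1 kkk]] : exists2 kk, 0 < kk & kk <= 1 /\ kk <= k.
  by exists (Num.min 1 k); [rewrite lt_min ltr01|rewrite !ge_min !lexx !orbT].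
have [d' d'0 hd'] : exists2 d', 0 < d' & n3 * d' = l * kk.
  by exists (l * kk / n3); [pos|field; rewrite gt_eqF].
have [eta eta0 [eta1 eta2 eta3 eta4]] : exists2 eta, 0 < eta &
    [/\ eta <= l * rho1 / 2, eta <= l * k / 4, eta <= l & eta <= 1].
  exists (Num.min (Num.min (l * rho1 / 2) (l * k / 4)) (Num.min l 1)).
    by rewrite !lt_min ltr01 l_gt0 !andbT; apply/andP; split; pos.
  by split; rewrite !ge_min lexx ?orbT.
exists n1, n2, n3, eta, (l * n1 * (l * (2 * e)^-1 * k2) + l * n2 * (kap^-1 * k2)
  + n3 * ((1 + (4 * d')^-1 * k2 ^+ 2 + (4 * d')^-1 * k ^+ 2 * mu1 ^- 2) * k2) + eta).
exists (l * n1 * ((4 * d)^-1 * (rho1 / k) ^+ 2 * (8 * g0))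
  + n3 * (rho2 * (2 * g1)^-1 * (mu1 ^- 2 * (2 * g0)))).
split; [by []|by pos|by pos|].
move=> mu a b c p q u G gt m1 m2 d1 d2 [hmu hG hkap hgt hg0 hm1 hd1 hd2] gG.
have h1 := dF1_le k rho2_gt0 k2_gt0 kap_gt0 g0_gt0 mu1_gt0 l a b c q hmu hG hkap hgt hm1 hd1 g10 gG d'0.
have h2 := dF2_le rho1 rho2 k k2_gt0 kap_gt0 g0_gt0 mu a b c p q u l_gt0 hG hkap hgt hg0 hm1 hd1 hd2 e0 d0.
have h34 := dF34_le rho1_gt0 k_gt0 mu1_gt0 a b c p q u l_gt0 l_lt4 hmu.
have h5 := dF5_le rho2 k kap_gt0 mu1_gt0 l a b c q hmu hkap hm1.
have S0 := sqr_ge0 (shr l mu a b c); have N0 := sqr_ge0 (axl l mu a c).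
have P0 := sqr_ge0 p; have Q0 := sqr_ge0 q; have U0 := sqr_ge0 u.
have z0 := sqr_ge0 (mu * b).
have := @combine_multipliers _ _ _ _ _ _ _ _ _ _ (mu ^+ 2 * m2)
  (2^-1 * mu ^+ 2 * (gt * b ^+ 2 + d2)) l n1 n2 n3 eta
  (l * rho1) (3 / 4 * (l * rho1)) (l * k / 2) (9 * (l * k)) (2 * (l * K))
  (l * (2 * e)^-1 * k2 ^+ 2) (rho1 / l) q2 e d d'
  (l * (2 * e)^-1 * k2) ((4 * d)^-1 * (rho1 / k) ^+ 2 * (8 * g0)) C51 (kap^-1 * k2)
  ((1 + (4 * d')^-1 * k2 ^+ 2 + (4 * d')^-1 * k ^+ 2 * mu1 ^- 2) * k2)
  (rho2 * (2 * g1)^-1 * (mu1 ^- 2 * (2 * g0))) (rho2 * g1 / 2)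
  (ltW l_gt0) (ltW n10) (ltW n20) (ltW n30) P0 Q0 U0 z0 N0 S0.
rewrite hd he hn1 hn2 hn3 hd'.
move=> /(_ (- dF3 rho1 k l mu a b c p q u + 2 * l * dF4 rho1 k l mu a b c p)
  (dF2 rho1 rho2 k k2 l mu a b c p q u G gt m1 d1) (dF5 rho2 k k2 l mu a b c q G m1)
  (dF1 rho2 k k2 l mu a b c q G m1 d1)) H.
have lk : l * kk <= l * k by apply: ler_wpM2l => //; exact: ltW.
have lk1 : l * kk <= l by rewrite -[leRHS]mulr1; apply: ler_wpM2l => //; exact: ltW.
have lc : l * (l * c0) <= l * c0.
  by rewrite -[leRHS]mul1r; apply: ler_wpM2r => //; rewrite mulr_ge0 ?ltW.
have lcr : l * c0 <= l * (rho1 / 4) by apply: ler_wpM2l => //; exact: ltW.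
have lck : l * c0 <= l * (k / 4) by apply: ler_wpM2l => //; exact: ltW.
have ll1 : l * (n1 * (l * (2 * e)^-1 * k2 ^+ 2)) <= l * 1 by apply: ler_wpM2l => //; exact: ltW.
have lk0 : 0 < l * k by pos.
have lr0 : 0 < l * rho1 by pos.
have leq (x y z : R) : x <= y -> y = z -> x <= z by move=> xy <-.
rewrite /dmultiplier /quad; apply: le_trans (H _ _ _ _ _ _ _ _ _ _) _.
- by apply: leq h34 _; rewrite -hK; ring.
- by apply: leq h2 _; rewrite -hq2; ring.
- by apply: leq h5 _; rewrite hC51; ring.
- by apply: leq h1 _; ring.
all: clear h1 h2 h34 h5 H hm1 hd1 hd2 hG hkap hgt hg0 hmu gG.
- by move: eta1; lra.
- by move: eta1 lc lcr lr0; lra.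
- by move: eta2 lc lck lk0; lra.
- by move: eta2 lk lk0; lra.
- by move: eta3 lk1 ll1; lra.
- by move: eta4; lra.
by move: (shr _ _ _ _ _) (axl _ _ _ _) => S' N'; lra.
Qed.

Lemma multiplier_weights : exists2 l0 : R, 0 < l0 & forall l, 0 < l -> l < l0 ->
  forall g1, 0 < g1 -> exists n1 n2 n3 n4 m M : R, [/\ 0 < n4, 0 < m, 0 < M &
  forall mu a b c p q u G gt m1 m2 d1 d2, mode_state mu b G gt m1 m2 d1 d2 ->
  let H := multiplier l n1 n2 n3 mu a b c p q u G m1 in
  let dH := dmultiplier l n1 n2 n3 mu a b c p q u G gt m1 d1 in
  let E := nrj rho1 rho2 k k2 l mu a b c p q u G m2 in
  let W := mu ^+ 2 * m2 in
  let D := 2^-1 * mu ^+ 2 * (gt * b ^+ 2 + d2) in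
  `|H| <= n4 * E /\ (g1 <= G -> dH <= - m * E + M * W + n4 * D)].
Proof.
have [l0 /andP[l00 l04] Hl] := multiplier_decrease; exists l0 => // l l_gt0 l_lt g1 g10.
have [n1 [n2 [n3 [eta [w [dd [[n10 n20 n30 eta0] w0 dd0 Hd]]]]]]] := Hl l l_gt0 l_lt g1 g10.
have l4 := ltW (lt_le_trans l_lt l04).
have [C C0 HC] := multiplier_bound l_gt0 l4 (ltW n10) (ltW n20) (ltW n30).
have [E0 [E1 [E00 E10 HE]]] := quad_equiv.
exists n1, n2, n3, (C / E0 + dd + 1), (eta / E1), (w + 1); split.
- by apply: ltr_wpDl => //; pos.
- by pos.
- by rewrite ltr_wpDl.
move=> mu a b c p q u G gt m1 m2 d1 d2 st H dH E W D.
have /andP[E_ge E_le] := HE l mu a b c p q u G gt m1 m2 d1 d2 st.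
have m20 : 0 <= m2 by have := le_trans (sqr_ge0 _) (ms_m1 st); rewrite pmulr_rge0.
have W0 : 0 <= W by rewrite /W; pos.
have D0 : 0 <= D by rewrite /D; case: st => *; pos.
have qd0 : 0 <= quad l mu a b c p q u m2 by rewrite /quad; pos.
have Epos : 0 <= E by apply: le_trans E_ge; pos.
split.
  apply: le_trans (HC _ _ _ _ _ _ _ _ _ _ _ _ _ st) _.
  apply: (@le_trans _ _ (C / E0 * E)).
    by rewrite -mulrA; apply: ler_wpM2l => //; rewrite ler_pdivlMl.
  by apply: ler_wpM2r => //; move: dd0; lra.
move=> gG; apply: le_trans (Hd _ _ _ _ _ _ _ _ _ _ _ _ _ st gG) _.
apply: lerD; last first.
  apply: ler_wpM2r => //; have : 0 <= C / E0 by pos.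
  lra.
apply: lerD; last by apply: ler_wpM2r => //; rewrite lerDl.
rewrite !mulNr lerN2 -mulrA; apply: ler_wpM2l; first exact: ltW.
by rewrite ler_pdivrMl.
Qed.

End Weights.

(** * Time derivatives along one mode *)

Section ModeCalculus.
Context {R : realType}.
Variables (rho1 rho2 k k2 l mu : R).
Hypothesis rho1_neq0 : rho1 != 0.
Hypothesis rho2_neq0 : rho2 != 0.
Hypothesis k_neq0 : k != 0.
Hypothesis speed : rho2 = rho1 * k2 / k.
Variables (g a a' a2 b b' b2 c c' c2 : R -> R).
Hypothesis cg : continuous g.
Hypothesis da : forall t : R, der a t (a' t).
Hypothesis db : forall t : R, der b t (b' t).
Hypothesis dc : forall t : R, der c t (c' t).
Hypothesis cb' : continuous b'.
Hypothesis da' : forall t : R, 0 < t -> der a' t (a2 t).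
Hypothesis db' : forall t : R, 0 < t -> der b' t (b2 t).
Hypothesis dc' : forall t : R, 0 < t -> der c' t (c2 t).

Let S t := shr l mu (a t) (b t) (c t).
Let N t := axl l mu (a t) (c t).

Hypothesis eq_a : forall t : R, 0 < t -> rho1 * a2 t = - k * mu * S t + l * k * N t.
Hypothesis eq_b : forall t : R, 0 < t ->
  rho2 * b2 t = - k2 * mu ^+ 2 * b t - k * S t + mu ^+ 2 * conv g b t.
Hypothesis eq_c : forall t : R, 0 < t -> rho1 * c2 t = k * mu * N t - l * k * S t.

Definition mode_nrj t := nrj rho1 rho2 k k2 l mu (a t) (b t) (c t) (a' t) (b' t) (c' t)
  (integ g t) (mem2 g b t).

Definition mode_dis t := 2^-1 * mu ^+ 2 * (g t * b t ^+ 2 + dis2 g b b' t).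

Let dS (t : R) : der S t (shr l mu (a' t) (b' t) (c' t)).
Proof. by apply: derD (derZ _ (dc t)); apply: derD (derZ _ (da t)) (db t). Qed.

Let dN (t : R) : der N t (axl l mu (a' t) (c' t)).
Proof. exact: derB (derZ _ (dc t)) (derZ _ (da t)). Qed.

Let dm1 (t : R) : 0 < t -> der (mem1 g b) t (integ g t * b' t - dis1 g b b' t).
Proof.
move=> t0; apply: der_eq.
  apply: derB (der_conv1 cg db cb' t0).
  by apply: derM (db t); exact: der_integ.
by rewrite /dis1; ring.
Qed.

Let dm2 (t : R) : 0 < t ->
  der (mem2 g b) t (2 * b' t * mem1 g b t - dis2 g b b' t).
Proof.
move=> t0; apply: der_eq.
  apply: derD (der_conv2 cg db cb' t0); apply: derB.
    by apply: derM; [exact: der_integ|exact: derX2].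
  by apply: derM; [apply: derZ; exact: db|exact: (der_conv1 cg db cb' t0)].
by rewrite /dis2 /mem1; ring.
Qed.

(** The cross terms of the memory, of the form b' [mem1], cancel against the
    convolution in the equation of b. *)
Lemma der_mode_nrj (t : R) : 0 < t -> der mode_nrj t (- mode_dis t).
Proof.
move=> t0; apply: der_eq.
  rewrite /mode_nrj /nrj; apply: derZ; apply: derD; last by apply: derZ; exact: dm2.
  apply: derD; last by apply: derZ; exact: derX2 (dS t).
  apply: derD; last by apply: derZ; exact: derX2 (dN t).
  apply: derD; last first.
    apply: derM; first by apply: derB (derC _ _) _; exact: der_integ.
    by apply: derX2; exact: derZ (db t).
  apply: derD; last by apply: derZ; apply: derX2; exact: dc'.
  apply: derD; first by apply: derZ; apply: derX2; exact: da'.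
  by apply: derZ; apply: derX2; exact: db'.
have ea := eq_a t0; have eb := eq_b t0; have ec := eq_c t0.
have -> : a2 t = rho1^-1 * (rho1 * a2 t) by rewrite mulKf.
have -> : b2 t = rho2^-1 * (rho2 * b2 t) by rewrite mulKf.
have -> : c2 t = rho1^-1 * (rho1 * c2 t) by rewrite mulKf.
rewrite ea eb ec /mode_dis /S /N /shr /axl /mem1.
by field; rewrite rho1_neq0.
Qed.

Lemma der_multiplier (n1 n2 n3 t : R) : 0 < t ->
  der (fun t => multiplier rho1 rho2 k k2 l n1 n2 n3 mu (a t) (b t) (c t)
    (a' t) (b' t) (c' t) (integ g t) (mem1 g b t)) t
   (dmultiplier rho1 rho2 k k2 l n1 n2 n3 mu (a t) (b t) (c t)
    (a' t) (b' t) (c' t) (integ g t) (g t) (mem1 g b t) (dis1 g b b' t)).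
Proof.
move=> t0; have ea := eq_a t0; have eb := eq_b t0; have ec := eq_c t0.
have Ea : a2 t = rho1^-1 * (rho1 * a2 t) by rewrite mulKf.
have Eb : b2 t = rho2^-1 * (rho2 * b2 t) by rewrite mulKf.
have Ec : c2 t = rho1^-1 * (rho1 * c2 t) by rewrite mulKf.
have d1 := dm1 t0.
have k2_neq0 : k2 != 0 by apply: contra_neq rho2_neq0 => k20; rewrite speed k20 mulr0 mul0r.
rewrite /multiplier /dmultiplier; apply: derD; last first.
  apply: derZ; rewrite /F1; apply: der_eq.
    by apply: derM d1; apply: derZ; exact: db'.
  rewrite Eb eb /dF1 /S /mem1 /shr.
  by field.
apply: derD; last first.
  apply: derZ; rewrite /F5; apply: der_eq.
    by apply: derM; [apply: derZ; exact: db|exact: db'].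
  rewrite Eb eb /dF5 /S /mem1 /shr.
  by field.
apply: derD; last first.
  apply: derZ; rewrite /F2; apply: der_eq.
    apply: derB.
      by apply: derM (dS t); apply: derZ; exact: db'.
    apply: derM; last exact: da'.
    apply: derM; first exact: derC.
    apply: derD d1; apply: derM (db t); apply: derB (derC _ _) _; exact: der_integ.
  rewrite Eb eb Ea ea /dF2 /S /N /mem1 /shr /axl /dis1 speed.
  by field; rewrite rho1_neq0 k_neq0 k2_neq0.
apply: derD; last first.
  apply: derZ; rewrite /F4; apply: der_eq.
    by apply: derM; [apply: derZ; exact: da|exact: da'].
  rewrite Ea ea /dF4 /S /N /shr /axl.
  by field.
apply: derN; rewrite /F3; apply: der_eq.
  apply: derZ; apply: derD.
    by apply: derM (dN t); exact: da'.
  by apply: derM (dS t); exact: dc'.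
rewrite Ea ea Ec ec /dF3 /S /N /shr /axl.
by field.
Qed.

Lemma mode_nrj_continuous : continuous a' -> continuous c' -> continuous mode_nrj.
Proof.
move=> ca' cc'.
have ca : continuous a by move=> t; exact: der_cont (da t).
have cb : continuous b by move=> t; exact: der_cont (db t).
have cc : continuous c by move=> t; exact: der_cont (dc t).
have ci := integ_continuous cg.
have cv1 := conv_continuous cg db cb'.
have cv2 : continuous (conv g (fun s => b s ^+ 2)).
  apply: (conv_continuous cg (h' := fun s => 2 * b s * b' s)).
    by move=> u; exact: derX2.
  by apply: contM => //; exact: contZ.
have cS : continuous S by rewrite /S /shr; apply: (contD _ (contZ cc)); exact: contD (contZ ca) cb.
have cN : continuous N by rewrite /N /axl; exact: contB (contZ cc) (contZ ca).
rewrite /mode_nrj /nrj; apply: contZ; apply: contD; last first.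
  apply: contZ; apply: (contD _ cv2); apply: contB; first exact: contM ci (contX2 cb).
  exact: contM (contZ cb) cv1.
apply: contD; last exact: contZ (contX2 cS).
apply: contD; last exact: contZ (contX2 cN).
apply: contD; last first.
  by apply: (contM _ (contX2 (contZ cb))); apply: (contB _ ci); exact: cont_cst.
apply: contD; last exact: contZ (contX2 cc').
apply: contD; first exact: contZ (contX2 ca').
exact: contZ (contX2 cb').
Qed.

End ModeCalculus.

(** * Decay rates from differential inequalities *)

Section Decay.
Context {R : realType}.
Local Notation mu := (@lebesgue_measure R).

Lemma der_powR (f : R -> R) (x a r : R) : der f x a -> 0 < f x ->
  der (fun y => f y `^ r) x (r * f x `^ (r - 1) * a).
Proof.
move=> fa fx.
have h : der (fun y : R => y `^ r) (f x) (r * f x `^ (r - 1)) := is_derive1_powR r fx.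
exact: (der_comp fa h).
Qed.

Lemma powR_continuous (f : R -> R) (r : R) : continuous f -> (forall x, 0 < f x) ->
  continuous (fun x => f x `^ r).
Proof.
move=> cf f0 x; have h : {for f x, continuous (fun y : R => y `^ r)}.
  exact: (der_cont (is_derive1_powR r (f0 x) : der (fun y : R => y `^ r) _ _)).
exact: (continuous_comp (cf x) h).
Qed.

Lemma le_powR (r x y : R) : 0 <= r -> 0 <= x -> x <= y -> x `^ r <= y `^ r.
Proof. by move=> r0 x0 xy; apply: ge0_ler_powR; rewrite ?nnegrE// (le_trans x0). Qed.

Lemma der_expR (f : R -> R) (x a : R) : der f x a ->
  der (fun y => expR (f y)) x (expR (f x) * a).
Proof. by move=> fa; exact: (der_comp fa (is_derive_expR (f x) : der expR (f x) _)). Qed.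

Variables (t0 x0 K m M : R) (xi xi' E dE F dF W : R -> R).
Hypothesis t0_gt0 : 0 < t0.
Hypothesis K_gt0 : 0 < K.
Hypothesis m_gt0 : 0 < m.
Hypothesis M_gt0 : 0 < M.
Hypothesis cxi : continuous xi.
Hypothesis xi_gt0 : forall t, 0 < xi t.
Hypothesis xi_le : forall t, xi t <= x0.
Hypothesis dxi : forall t : R, 0 < t -> der xi t (xi' t).
Hypothesis xi'_le0 : forall t : R, 0 < t -> xi' t <= 0.
Hypothesis E_ge0 : forall t : R, 0 < t -> 0 <= E t.
Hypothesis dE_le0 : forall t : R, 0 < t -> dE t <= 0.
Hypothesis F_ge0 : forall t : R, 0 < t -> 0 <= F t.
Hypothesis F_le : forall t : R, 0 < t -> F t <= K * E t.
Hypothesis derE : forall t : R, 0 < t -> der E t (dE t).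
Hypothesis derF : forall t : R, 0 < t -> der F t (dF t).
Hypothesis dF_le : forall t : R, t0 <= t -> dF t <= - m * E t + M * W t.

Let x0_gt0 : 0 < x0. Proof. exact: lt_le_trans (xi_gt0 0) (xi_le 0). Qed.

Let pt t : t0 <= t -> 0 < t. Proof. exact: lt_le_trans. Qed.

Lemma E_decr s t : 0 < s -> s <= t -> E t <= E s.
Proof.
move=> s0 st; apply: (@der_le0_ge _ E dE) => //.
  apply: cont_within => x; rewrite /= in_itv /= => /andP[sx _].
  exact: der_cont (derE (lt_le_trans s0 sx)).
move=> x sx _; have x_gt0 := lt_trans s0 sx; split; [exact: derE|exact: dE_le0].
Qed.

(** The functional xi F + 2 M E decreases at a rate proportional to xi times itself:
    xi M W is compensated by the derivative of 2 M E, and xi' F <= 0. *)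
Lemma exp_decay : (forall t : R, t0 <= t -> xi t * W t <= - 2 * dE t) ->
  forall t, t0 <= t -> E t <= (x0 * K + 2 * M) / (2 * M) * E t0 *
    expR (- (m / (x0 * K + 2 * M)) * \int[mu]_(s in `[t0, t]) xi s).
Proof.
move=> HW t t0t; rewrite integ_itv//; last exact: ltW.
set K' := x0 * K + 2 * M; have K'0 : 0 < K' by rewrite addr_gt0 ?mulr_gt0.
set lam := m / K'.
pose L s := xi s * F s + 2 * M * E s.
have L_le s : t0 <= s -> L s <= K' * E s.
  move=> /pt s0; rewrite /L /K' [X in _ <= X]mulrDl lerD2r -[X in _ <= X]mulrA; apply: ler_pM => //; first exact: ltW.
  - exact: F_ge0.
  - exact: F_le.
pose Y s := L s * expR (lam * (integ xi s - integ xi t0)).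
have dL s : t0 <= s -> der L s (xi' s * F s + xi s * dF s + 2 * M * dE s).
  move=> /pt s0; apply: derD; last exact: derZ (derE s0).
  by apply: derM; [exact: dxi|exact: derF].
have dY s : t0 <= s -> der Y s ((xi' s * F s + xi s * dF s + 2 * M * dE s + lam * xi s * L s)
    * expR (lam * (integ xi s - integ xi t0))).
  move=> ts; apply: der_eq.
    apply: derM (dL s ts) _; apply: der_expR; apply: derZ; apply: derB (derC _ _).
    exact: der_integ (pt ts).
  by rewrite /=; ring.
have dY_le s : t0 <= s -> xi' s * F s + xi s * dF s + 2 * M * dE s + lam * xi s * L s <= 0.
  move=> ts; have s0 := pt ts.
  have h1 : xi' s * F s <= 0 by apply: mulr_le0_ge0; [exact: xi'_le0|exact: F_ge0].
  have h2 : xi s * dF s <= xi s * (- m * E s + M * W s).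
    by apply: ler_wpM2l (dF_le ts); exact: ltW.
  have h3 : M * (xi s * W s) <= M * (- 2 * dE s) by apply: ler_wpM2l (HW _ ts); exact: ltW.
  have h4 : lam * xi s * L s <= lam * xi s * (K' * E s).
    by apply: ler_wpM2l (L_le _ ts); rewrite mulr_ge0 ?divr_ge0 ?ltW.
  have h5 : lam * xi s * (K' * E s) = m * xi s * E s.
    by rewrite /lam; field; rewrite gt_eqF.
  by rewrite h5 in h4; lra.
have Yt : Y t <= Y t0.
  apply: (@der_le0_ge _ Y (fun s => (xi' s * F s + xi s * dF s + 2 * M * dE s + lam * xi s * L s)
    * expR (lam * (integ xi s - integ xi t0)))) => //.
    by apply: cont_within => x; rewrite /= in_itv /= => /andP[sx _]; exact: der_cont (dY _ sx).
  move=> x /ltW t0x _; split; first exact: dY.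
  by apply: mulr_le0_ge0; [exact: dY_le|exact: expR_ge0].
have L_ge : 2 * M * E t <= L t.
  by rewrite /L lerDr mulr_ge0 ?F_ge0 ?pt// ltW.
have : 2 * M * E t <= K' * E t0 * expR (- lam * (integ xi t - integ xi t0)).
  apply: le_trans L_ge _.
  rewrite -(ler_pM2r (expR_gt0 (lam * (integ xi t - integ xi t0)))).
  rewrite -[X in _ <= X]mulrA -expRD mulNr addNr expR0 mulr1; apply: le_trans Yt _.
  by rewrite /Y subrr mulr0 expR0 mulr1; exact: L_le.
have -> : K' / (2 * M) * E t0 * expR (- lam * (integ xi t - integ xi t0)) =
  (K' * E t0 * expR (- lam * (integ xi t - integ xi t0))) / (2 * M) by ring.
rewrite ler_pdivlMr; last by pos.
by rewrite mulrC.
Qed.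


Variables (al Kw e0 : R).
Hypothesis al_gt0 : 0 < al.
Hypothesis Kw_gt0 : 0 < Kw.
Hypothesis e0_gt0 : 0 < e0.

Let c1 := 2 * M * (2 * M * Kw / m) `^ al.
Let K3 := x0 * (x0 * e0) `^ al * K + c1.
Let c2 := Num.min ((K3 * e0) `^ (- al)) (al * (m / 2 * (K3 `^ (al + 1))^-1)).

(** A bound [e0] of E t0 enters instead of E t0, so that the constant serves all families
    of modes. *)
Definition poly_cst := c2 `^ (- al^-1) / c1.

Let c1_gt0 : 0 < c1.
Proof. by rewrite /c1; pos. Qed.

Let K3_gt0 : 0 < K3.
Proof. by rewrite /K3; pos. Qed.

Let c2_gt0 : 0 < c2.
Proof. by rewrite lt_min; apply/andP; split; pos. Qed.

Lemma poly_cst_gt0 : 0 < poly_cst.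
Proof. by rewrite /poly_cst; pos. Qed.

Hypothesis E_le : E t0 <= e0.
Hypothesis HW : forall t lam : R, t0 <= t -> 0 < lam ->
  xi t * W t <= lam * (- 2 * dE t) + Kw * lam `^ (- al^-1).

Let cxip : continuous (fun s => xi s `^ (al + 1)).
Proof. exact: powR_continuous. Qed.

(* lam is such that the remainder Kw lam^(-1/al) takes half of the damping m xi E. *)
Let dF_opt s : t0 <= s -> 0 < E s ->
  (xi s * E s) `^ al * (xi s * dF s) <= - (m / 2) * (xi s * E s) `^ (al + 1) - c1 * dE s.
Proof.
move=> ts Es; set y := xi s * E s; have y0 : 0 < y by rewrite mulr_gt0.
pose lam := (2 * M * Kw / m) `^ al * y `^ (- al).
have q0 : 0 < 2 * M * Kw / m by pos.
have lam0 : 0 < lam by rewrite mulr_gt0 ?powR_gt0.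
have lamE : lam `^ (- al^-1) = m / (2 * M * Kw) * y.
  have e1 : al * - al^-1 = -1 by rewrite mulrN divff ?gt_eqF.
  have e2 : - al * - al^-1 = 1 by rewrite mulrNN divff ?gt_eqF.
  by rewrite /lam powRM ?powR_ge0// -!powRrM e1 e2 powRr1 ?ltW// powR_inv1 ?ltW// invf_div.
have h1 : xi s * dF s <= xi s * (- m * E s + M * W s).
  by apply: ler_wpM2l (dF_le ts); exact: ltW.
have h2 : M * (xi s * W s) <= M * (lam * (- 2 * dE s) + Kw * lam `^ (- al^-1)).
  by apply: ler_wpM2l (HW ts lam0); exact: ltW.
have h3 : M * (Kw * lam `^ (- al^-1)) = m / 2 * y.
  by rewrite lamE; field; rewrite !gt_eqF.
have h4 : xi s * dF s <= - (m / 2) * y - 2 * M * lam * dE s.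
  by rewrite [X in _ <= X]mulrDr h3 in h2; move: h1 h2; rewrite /y; lra.
have ya : 0 <= y `^ al by exact: powR_ge0.
apply: le_trans (ler_wpM2l ya h4) _.
have yl : y `^ al * lam = (2 * M * Kw / m) `^ al.
  by rewrite /lam mulrCA powRN mulfV ?mulr1// gt_eqF// powR_gt0.
have yy : y `^ (al + 1) = y `^ al * y.
  by rewrite powRD ?(gt_eqF y0) ?implybT// powRr1// ltW.
rewrite yy /c1 -yl le_eqVlt; apply/orP; left; apply/eqP; ring.
Qed.

(** The functional y = (xi E)^al xi F + c1 E lies between c1 E and a multiple of E, and
    y' <= - c xi^(al+1) y^(al+1), which is integrated by differentiating y^(-al). *)
Lemma poly_decay t : t0 <= t -> E t <=
  poly_cst * (1 / (1 + \int[mu]_(s in `[t0, t]) (xi s `^ (al + 1)))) `^ (1 / al).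
Proof.
move=> t0t; rewrite integ_itv//; last exact: ltW.
set J := integ _ t - integ _ t0.
have J0 : 0 <= J.
  rewrite subr_ge0; apply: integ_le => //; last exact: ltW.
  by move=> s _; exact: powR_ge0.
have C0 := poly_cst_gt0.
have [Et|Et] := ltP 0 (E t); last first.
  by apply: le_trans Et _; rewrite mulr_ge0 ?powR_ge0// ltW.
have Es s : t0 <= s -> s <= t -> 0 < E s.
  by move=> ts st; apply: lt_le_trans Et _; exact: E_decr (pt ts) st.
have Ee s : t0 <= s -> E s <= e0.
  by move=> ts; apply: le_trans E_le; exact: E_decr.
pose Z s := (xi s * E s) `^ al.
pose dZ s := al * (xi s * E s) `^ (al - 1) * (xi' s * E s + xi s * dE s).
pose L s := xi s * (Z s * F s) + c1 * E s.
pose dL s := xi' s * (Z s * F s) + xi s * (dZ s * F s + Z s * dF s) + c1 * dE s.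
have dZP s : t0 <= s -> s <= t -> der Z s (dZ s) /\ dZ s <= 0.
  move=> ts st; have s0 := pt ts; have e1 := Es s ts st; split.
    by apply: der_powR; [apply: derM; [exact: dxi|exact: derE]|rewrite mulr_gt0].
  rewrite /dZ; apply: mulr_ge0_le0; first by rewrite mulr_ge0 ?powR_ge0// ltW.
  rewrite -(addr0 0); apply: lerD.
    by apply: mulr_le0_ge0; [exact: xi'_le0|exact: ltW].
  by apply: mulr_ge0_le0; [exact: ltW|exact: dE_le0].
have dLP s : t0 <= s -> s <= t -> der L s (dL s).
  move=> ts st; have s0 := pt ts; have [dz _] := dZP s ts st.
  apply: derD; last exact: derZ (derE s0).
  by apply: derM; [exact: dxi|apply: derM; [exact: dz|exact: derF]].
have L_ge s : t0 <= s -> s <= t -> c1 * E s <= L s.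
  move=> ts st; rewrite /L lerDr mulr_ge0 ?(ltW (xi_gt0 s))// mulr_ge0 ?powR_ge0//; exact: F_ge0 (pt ts).
have L_gt0 s : t0 <= s -> s <= t -> 0 < L s.
  by move=> ts st; apply: lt_le_trans (L_ge s ts st); rewrite mulr_gt0// Es.
have L_le s : t0 <= s -> s <= t -> L s <= K3 * E s.
  move=> ts st; have s0 := pt ts; rewrite /L /K3 [X in _ <= X]mulrDl lerD2r -!mulrA.
  apply: ler_pM; [exact: ltW|by rewrite mulr_ge0 ?powR_ge0// F_ge0|exact: xi_le|].
  apply: ler_pM; [exact: powR_ge0|exact: F_ge0| |exact: F_le].
  apply: le_powR; [exact: ltW|by apply: mulr_ge0; apply: ltW; [exact: xi_gt0|exact: Es]|].
  by apply: ler_pM; [exact: ltW|rewrite ltW// Es|exact: xi_le|exact: Ee].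
pose c := m / 2 * (K3 `^ (al + 1))^-1.
have c0 : 0 < c by rewrite mulr_gt0 ?divr_gt0// invr_gt0 powR_gt0.
have dL_le s : t0 <= s -> s <= t -> dL s <= - c * (xi s `^ (al + 1) * L s `^ (al + 1)).
  move=> ts st; have s0 := pt ts; have [_ dz0] := dZP s ts st; have e1 := Es s ts st.
  have h1 : xi' s * (Z s * F s) <= 0.
    by apply: mulr_le0_ge0; [exact: xi'_le0|rewrite mulr_ge0 ?powR_ge0// F_ge0].
  have h2 : xi s * (dZ s * F s) <= 0.
    apply: mulr_ge0_le0; first exact: ltW.
    by apply: mulr_le0_ge0 => //; exact: F_ge0.
  have h3 := dF_opt ts e1; rewrite -/(Z s) in h3.
  have h4 : c * (xi s `^ (al + 1) * L s `^ (al + 1)) <= m / 2 * (xi s * E s) `^ (al + 1).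
    rewrite /c -!mulrA; apply: ler_wpM2l; first exact: ltW.
    apply: ler_wpM2l; first by rewrite invr_ge0.
    rewrite (powRM _ (ltW (xi_gt0 s)) (ltW e1)) mulrCA; apply: ler_wpM2l; first exact: powR_ge0.
    rewrite ler_pdivrMl ?powR_gt0// -powRM; [|exact: ltW|exact: ltW].
    apply: le_powR; [by rewrite addr_ge0// ltW|exact/ltW/L_gt0|exact: L_le].
  by rewrite /dL; lra.
pose Q s := L s `^ (- al) - al * c * integ (fun s => xi s `^ (al + 1)) s.
pose dQ s := - al * L s `^ (- al - 1) * dL s - al * c * xi s `^ (al + 1).
have dQP s : t0 <= s -> s <= t -> der Q s (dQ s) /\ 0 <= dQ s.
  move=> ts st; have s0 := pt ts; have l0 := L_gt0 s ts st; split.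
    apply: derB; first exact: der_powR (dLP s ts st) l0.
    by apply: derZ; exact: der_integ.
  have h := dL_le s ts st.
  have h5 : al * L s `^ (- al - 1) * (c * (xi s `^ (al + 1) * L s `^ (al + 1))) <=
     al * L s `^ (- al - 1) * (- dL s).
    by apply: ler_wpM2l; [rewrite mulr_ge0 ?powR_ge0// ltW|lra].
  have h6 : L s `^ (- al - 1) * L s `^ (al + 1) = 1.
    by rewrite -opprD powRN mulVf// gt_eqF// powR_gt0.
  have h7 : al * L s `^ (- al - 1) * (c * (xi s `^ (al + 1) * L s `^ (al + 1))) =
     al * c * xi s `^ (al + 1) * (L s `^ (- al - 1) * L s `^ (al + 1)) by ring.
  by rewrite h7 h6 mulr1 in h5; rewrite /dQ; lra.
have Qle : Q t0 <= Q t.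
  apply: (@der_ge0_le _ Q dQ) => //.
    apply: cont_within => x; rewrite /= in_itv /= => /andP[tx xt].
    exact: der_cont (dQP x tx xt).1.
  by move=> x /ltW tx /ltW xt; exact: dQP.
have L0t : t0 <= t0 by [].
have h1 : (K3 * e0) `^ (- al) <= L t0 `^ (- al).
  rewrite !powRN lef_pV2 ?posrE ?powR_gt0 ?mulr_gt0 ?L_gt0//.
  apply: le_powR; [exact: ltW|exact/ltW/L_gt0|].
  apply: le_trans (L_le _ L0t t0t) _; apply: ler_wpM2l; first exact: ltW.
  exact: E_le.
have h2 : c2 * (1 + J) <= L t `^ (- al).
  have h3 : c2 <= (K3 * e0) `^ (- al) by rewrite ge_min lexx.
  have h4 : c2 * J <= al * c * J by apply: ler_wpM2r => //; rewrite ge_min lexx orbT.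
  by move: Qle; rewrite /Q; have -> : J = integ (fun s => xi s `^ (al + 1)) t - integ (fun s => xi s `^ (al + 1)) t0 by []; move: h4; rewrite /J; lra.
have h3 : L t <= (c2 * (1 + J)) `^ (- al^-1).
  have -> : L t = (L t `^ (- al)) `^ (- al^-1).
    by rewrite -powRrM mulrNN divff ?gt_eqF// powRr1// ltW// L_gt0.
  rewrite !(powRN _ al^-1) lef_pV2 ?posrE ?powR_gt0 ?L_gt0 ?mulr_gt0 ?ltr_wpDr//.
  apply: le_powR; [by rewrite invr_ge0 ltW| |exact: h2].
  by apply: mulr_ge0; [exact: ltW|exact: addr_ge0].
have J1 : 0 < 1 + J by rewrite ltr_wpDr.
rewrite /poly_cst (mulrAC _ c1^-1) ler_pdivlMr// mulrC.
apply: le_trans (L_ge _ t0t (lexx _)) _; apply: le_trans h3 _.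
rewrite powRM; [|exact: ltW|exact: ltW].
by rewrite !mul1r -[(1 + J)^-1]powR_inv1 ?(ltW J1)// -powRrM mulN1r.
Qed.

End Decay.

(** * Integrability of the relaxation function *)

Section KernelDecay.
Context {R : realType}.

Lemma powR_continuous_ge0 (f : R -> R) (r : R) : continuous f ->
  (forall x, 0 <= f x) -> 1 <= r -> continuous (fun x => f x `^ r).
Proof.
move=> cf f0 r1 x; have [fx|fx] := ltP 0 (f x).
  have h : {for f x, continuous (fun y : R => y `^ r)}.
    exact: (der_cont (is_derive1_powR r fx : der (fun y : R => y `^ r) _ _)).
  exact: (continuous_comp (cf x) h).
have fx0 : f x = 0 by apply/eqP; rewrite eq_le fx f0.
have r0 : r != 0 by rewrite gt_eqF// (lt_le_trans ltr01).
rewrite /continuous_at fx0 powR0//.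
have c0 : f y @[y --> x] --> (0 : R) by rewrite -fx0; exact: cf.
apply: (@squeeze_cvgr _ _ _ _ (fun=> 0) f) => //; last exact: cvg_cst.
have : \forall y \near x, f y < 1.
  by apply: (cvgr_lt _ c0); exact: ltr01.
apply: filterS => y fy1; rewrite powR_ge0/=.
have [->|fy] := eqVneq (f y) 0; first by rewrite powR0.
by apply: ge1r_powR => //; rewrite lt_def fy f0 ltW.
Qed.

Lemma sqrt_comp_continuous (f : R -> R) : continuous f -> continuous (fun x => Num.sqrt (f x)).
Proof. by move=> cf; apply: (cont_comp cf); exact: sqrt_continuous. Qed.

Lemma powR_invl (x r : R) : 0 < x -> x^-1 `^ r = x `^ (- r).
Proof. by move=> x0; rewrite -powR_inv1 ?(ltW x0)// -powRrM mulN1r. Qed.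

Lemma integ_reflect (f : R -> R) (t : R) : continuous f -> 0 <= t ->
  integ (fun s => f (t - s)) t = integ f t.
Proof.
move=> cf t0.
have cr : continuous (fun s => f (t - s)).
  apply: (cont_comp (f := fun s => t - s)) cf.
  exact: contB (@cont_cst _ _) (@cont_id _).
pose D s := integ (fun s => f (t - s)) s + integ f (t - s).
have cD : {within `[0, t], continuous D}.
  apply: continuous_subspaceT; apply: contD; first exact: integ_continuous.
  apply: (cont_comp (f := fun s => t - s)); last exact: integ_continuous.
  exact: contB (@cont_cst _ _) (@cont_id _).
have dD s : 0 < s -> s < t -> der D s 0.
  move=> s0 st; apply: der_eq.
    apply: derD; first exact: der_integ.
    apply: (der_comp (f := fun s => t - s) (g := integ f)).
      exact: derB (derC _ _) (derI _).
    by apply: der_integ => //; rewrite subr_gt0.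
  by ring.
have -> : integ (fun s => f (t - s)) t = D t by rewrite /D subrr integ0 addr0.
have -> : integ f t = D 0 by rewrite /D subr0 integ0 add0r.
apply/eqP; rewrite eq_le; apply/andP; split.
  by apply: (@der_le0_ge _ D (fun=> 0)) => // s s0 st; split => //; exact: dD.
by apply: (@der_ge0_le _ D (fun=> 0)) => // s s0 st; split => //; exact: dD.
Qed.

Variables (g g' xi : R -> R) (p x0 : R).
Hypothesis cg : continuous g.
Hypothesis g_ge0 : forall t : R, 0 <= g t.
Hypothesis g_decr : forall s t : R, 0 <= s -> s <= t -> g t <= g s.
Hypothesis dg : forall t : R, 0 < t -> der g t (g' t).
Hypothesis cxi : continuous xi.
Hypothesis xi_gt0 : forall t : R, 0 < xi t.
Hypothesis xi_le : forall t : R, xi t <= x0.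
Hypothesis p_gt1 : 1 < p.
Hypothesis p_lt : p < 3 / 2.
Hypothesis g'_le : forall t : R, 0 < t -> g' t <= - xi t * g t `^ p.

Let x0_gt0 : 0 < x0. Proof. exact: lt_le_trans (xi_gt0 0) (xi_le 0). Qed.

Let cxg : continuous (fun s => xi s * Num.sqrt (g s)).
Proof. by apply: contM => //; exact: sqrt_comp_continuous. Qed.

Let gam := 3 / 2 - p.
Let gam0 : 0 < gam. Proof. by rewrite /gam subr_gt0. Qed.

(* As long as [g] is positive, [xi * sqrt g] is dominated by the derivative of
   [- g ^ (3/2 - p)]. *)
Let xi_sqrt_pos t : 0 <= t -> 0 < g t ->
  integ (fun s => xi s * Num.sqrt (g s)) t <= gam^-1 * g 0 `^ gam.
Proof.
move=> t0 gt; pose D s := integ (fun s => xi s * Num.sqrt (g s)) s + gam^-1 * g s `^ gam.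
have gs s : s <= t -> 0 <= s -> 0 < g s by move=> st s0; exact: lt_le_trans gt (g_decr s0 st).
suff : D t <= D 0.
  rewrite /D integ0 add0r; apply: le_trans; rewrite lerDl mulr_ge0 ?powR_ge0//.
  by rewrite invr_ge0 ltW.
apply: (@der_le0_ge _ D (fun s => xi s * Num.sqrt (g s) + g s `^ (gam - 1) * g' s)) => //.
  apply: cont_within => s; rewrite /= in_itv /= => /andP[s0 st].
  apply: (@cvgD _ _ _ (nbhs s)); first exact: integ_continuous.
  apply: (@cvgM _ _ (nbhs s)); first exact: cvg_cst.
  have h : {for g s, continuous (fun y : R => y `^ gam)}.
    exact: (der_cont (is_derive1_powR gam (gs s st s0) : der (fun y : R => y `^ gam) _ _)).
  exact: (continuous_comp (cg (x := s)) h).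
move=> s s0 st; have gs0 := gs s (ltW st) (ltW s0); split.
  apply: derD; first exact: der_integ.
  apply: der_eq; first by apply: derZ; apply: der_powR => //; exact: dg.
  by rewrite !mulrA mulVf ?mul1r// gt_eqF.
have h : g s `^ (gam - 1) * g' s <= g s `^ (gam - 1) * (- xi s * g s `^ p).
  by apply: ler_wpM2l; [exact: powR_ge0|exact: g'_le].
have e : g s `^ (gam - 1) * g s `^ p = Num.sqrt (g s).
  rewrite -powR12_sqrt; last exact: ltW.
  rewrite -powRD ?(gt_eqF gs0) ?implybT//; congr (_ `^ _); rewrite /gam.
  by field.
have e2 : xi s * Num.sqrt (g s) = - (g s `^ (gam - 1) * (- xi s * g s `^ p)).
  by rewrite mulNr mulrN opprK mulrCA e.
by rewrite /= e2; lra.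
Qed.

(** Uniform in [t], including when [g] vanishes in finite time: past the level
    [g = e] the integrand is at most [x0 * sqrt e]. *)
Lemma xi_sqrt_integ t : 0 <= t ->
  integ (fun s => xi s * Num.sqrt (g s)) t <= gam^-1 * g 0 `^ gam.
Proof.
move=> t0; have [gt|gt] := ltP 0 (g t); first exact: xi_sqrt_pos.
have gt0 : g t = 0 by apply/eqP; rewrite eq_le gt g_ge0.
have [g00|g00] := eqVneq (g 0) 0.
  rewrite (_ : integ _ _ = 0); first by rewrite mulr_ge0 ?powR_ge0// invr_ge0 ltW.
  apply: Rintegral_eq0 => s; rewrite /= in_itv /= => /andP[s0 _].
  have -> : g s = 0 by apply/eqP; rewrite eq_le g_ge0 -g00 g_decr.
  by rewrite sqrtr0 mulr0.
have g0 : 0 < g 0 by rewrite lt_def g00 g_ge0.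
apply/ler_addgt0Pr => e e0.
pose d := Num.min (g 0) ((e / (x0 * (t + 1))) ^+ 2).
have d0 : 0 < d.
  by rewrite lt_min g0 exprn_gt0// divr_gt0// mulr_gt0// ltr_wpDl.
have [|s] := @IVT R g 0 t d t0 (continuous_subspaceT cg).
  by rewrite gt0 (min_r (ltW g0)) (max_l (ltW g0)) (ltW d0) /d ge_min lexx.
rewrite in_itv /= => /andP[s0 st] gs.
have H1 : integ (fun s => xi s * Num.sqrt (g s)) s <= gam^-1 * g 0 `^ gam.
  by apply: xi_sqrt_pos => //; rewrite gs.
apply: le_trans (lerD H1 (_ : integ (fun s => xi s * Num.sqrt (g s)) t
   - integ (fun s => xi s * Num.sqrt (g s)) s <= e)); first by rewrite addrC subrK.
rewrite -integ_itv//.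
have sd : Num.sqrt d <= e / (x0 * (t + 1)).
  rewrite -[leRHS]ger0_norm; last by pos.
  by rewrite -sqrtr_sqr ler_sqrt ?sqr_ge0// ge_min lexx orbT.
apply: (@le_trans _ _ (\int[@lebesgue_measure R]_(r in `[s, t]) (x0 * Num.sqrt d))).
  apply: le_Rintegral => //; try exact: continuous_itv_integrable.
    exact: continuous_itv_integrable (@cont_cst _ _).
  move=> r; rewrite /= in_itv /= => /andP[sr rt].
  apply: ler_pM; [exact: ltW|exact: sqrtr_ge0|exact: xi_le|].
  by rewrite ler_sqrt ?(ltW d0)// -gs g_decr.
rewrite integ_itv//; last exact: cont_cst.
rewrite !integ_cst// -mulrBr.
apply: (@le_trans _ _ (x0 * (e / (x0 * (t + 1))) * (t + 1))).
  apply: ler_pM; [by rewrite mulr_ge0 ?sqrtr_ge0// ltW|by rewrite subr_ge0| |lra].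
  by apply: ler_wpM2l => //; exact: ltW.
rewrite le_eqVlt; apply/orP; left; apply/eqP; field.
by rewrite !gt_eqF// ltr_wpDl.
Qed.

(** Either lam y^(p-1) >= 1 and the first term suffices, or y is so small that its
    square root is at most the given power of 1 / lam. *)
Lemma young_sqrt (lam y : R) : 0 < lam -> 0 <= y ->
  y <= lam * y `^ p + lam `^ (- (2 * p - 2)^-1) * Num.sqrt y.
Proof.
move=> lam0; rewrite le_eqVlt => /predU1P[<-|y0].
  by rewrite addr_ge0 ?mulr_ge0 ?powR_ge0 ?sqrtr_ge0 ?(ltW lam0).
have p1 : 0 < p - 1 by rewrite subr_gt0.
have yp : y `^ p = y * y `^ (p - 1) by rewrite mulr_powRB1 ?ltW// (lt_trans ltr01).
have [h|h] := leP lam^-1 (y `^ (p - 1)).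
  apply: (@le_trans _ _ (lam * y `^ p)); last by rewrite lerDl mulr_ge0 ?powR_ge0 ?sqrtr_ge0.
  rewrite yp mulrCA -[leLHS]mulr1; apply: ler_wpM2l; first exact: ltW.
  by rewrite -ler_pdivrMl ?mulr1.
apply: (@le_trans _ _ (lam `^ (- (2 * p - 2)^-1) * Num.sqrt y)); last first.
  by rewrite lerDr mulr_ge0 ?powR_ge0 ?(ltW lam0).
rewrite -[leLHS]sqr_sqrtr; last exact: ltW.
apply: ler_wpM2r; first exact: sqrtr_ge0.
have -> : Num.sqrt y = (y `^ (p - 1)) `^ ((2 * p - 2)^-1).
  rewrite -powR12_sqrt; last exact: ltW.
  have q0 : 0 < 2 * p - 2 by lra.
  rewrite -powRrM; congr (_ `^ _).
  by field; rewrite gt_eqF.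
rewrite -powR_invl//.
apply: le_powR; [|exact: powR_ge0|exact: ltW].
by rewrite invr_ge0; lra.
Qed.

Lemma young_cst (lam y : R) : 0 < lam -> 0 <= y ->
  y <= lam * y `^ p + lam `^ (- (p - 1)^-1).
Proof.
move=> lam0; rewrite le_eqVlt => /predU1P[<-|y0].
  by rewrite addr_ge0 ?mulr_ge0 ?powR_ge0 ?(ltW lam0).
have p1 : 0 < p - 1 by rewrite subr_gt0.
have yp : y `^ p = y * y `^ (p - 1) by rewrite mulr_powRB1 ?ltW// (lt_trans ltr01).
have [h|h] := leP lam^-1 (y `^ (p - 1)).
  apply: (@le_trans _ _ (lam * y `^ p)); last by rewrite lerDl powR_ge0.
  rewrite yp mulrCA -[leLHS]mulr1; apply: ler_wpM2l; first exact: ltW.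
  by rewrite -ler_pdivrMl ?mulr1.
apply: (@le_trans _ _ (lam `^ (- (p - 1)^-1))); last first.
  by rewrite lerDr mulr_ge0 ?powR_ge0 ?(ltW lam0).
have -> : y = (y `^ (p - 1)) `^ ((p - 1)^-1).
  by rewrite -powRrM divff ?gt_eqF// powRr1// ltW.
rewrite -powR_invl//.
by apply: le_powR; [rewrite invr_ge0 ltW|exact: powR_ge0|exact: ltW].
Qed.

End KernelDecay.


(** * Finite families of modes *)

Section Modes.
Context {R : realType}.

Record mode := Mode { ma : R -> R; ma' : R -> R; mb : R -> R; mb' : R -> R;
  mc : R -> R; mc' : R -> R }.

(** The weak equations tested with the sine or cosine of frequency [mu]. *)
Definition is_mode (rho1 rho2 k k2 l mu : R) (g : R -> R) (z : mode) : Prop :=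
  [/\ forall t, [/\ der (ma z) t (ma' z t), der (mb z) t (mb' z t) & der (mc z) t (mc' z t)],
      [/\ continuous (ma' z), continuous (mb' z) & continuous (mc' z)] &
  exists a2 b2 c2 : R -> R, forall t, 0 < t ->
  let S := shr l mu (ma z t) (mb z t) (mc z t) in
  let N := axl l mu (ma z t) (mc z t) in
  [/\ [/\ der (ma' z) t (a2 t), der (mb' z) t (b2 t) & der (mc' z) t (c2 t)],
    rho1 * a2 t = - k * mu * S + l * k * N,
    rho2 * b2 t = - k2 * mu ^+ 2 * mb z t - k * S + mu ^+ 2 * conv g (mb z) t
  & rho1 * c2 t = k * mu * N - l * k * S]].

Definition nrjm rho1 rho2 k k2 l mu g z t :=
  mode_nrj rho1 rho2 k k2 l mu g (ma z) (ma' z) (mb z) (mb' z) (mc z) (mc' z) t.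

End Modes.
Arguments mode R : clear implicits.

Section SumOfModes.
Context {R : realType}.
Variables (rho1 rho2 k k2 kap mu1 : R) (g g' : R -> R).
Hypothesis rho1_gt0 : 0 < rho1.
Hypothesis rho2_gt0 : 0 < rho2.
Hypothesis k_gt0 : 0 < k.
Hypothesis k2_gt0 : 0 < k2.
Hypothesis kap_gt0 : 0 < kap.
Hypothesis mu1_gt0 : 0 < mu1.
Hypothesis speed : rho2 = rho1 * k2 / k.
Hypothesis cg : continuous g.
Hypothesis g_ge0 : forall t : R, 0 <= g t.
Hypothesis g_decr : forall s t : R, 0 <= s -> s <= t -> g t <= g s.
Hypothesis g0_gt0 : 0 < g 0.
Hypothesis dg : forall t : R, 0 < t -> der g t (g' t).
Hypothesis G_le : forall t : R, 0 <= t -> kap <= k2 - integ g t.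

Section FixedWeight.
(* xi g^p, or 0 where only the monotonicity of the energy matters *)
Variable om : R -> R.
Hypothesis com : continuous om.
Hypothesis om_ge0 : forall t : R, 0 <= om t.
Hypothesis g'_le : forall t : R, 0 < t -> g' t <= - om t.

(** The bounds on [mem1] and [dis1] are Cauchy-Schwarz inequalities for g and -dg. *)
Lemma mode_stateP l mu (z : mode R) t : mu1 <= mu -> is_mode rho1 rho2 k k2 l mu g z -> 0 <= t ->
  mode_state k2 kap (g 0) mu1 mu (mb z t) (integ g t) (g t) (mem1 g (mb z) t) (mem2 g (mb z) t)
    (dis1 g (mb z) (mb' z) t) (dis2 g (mb z) (mb' z) t).
Proof.
move=> hmu [dz [_ cb _] _] t0.
have db s : der (mb z) s (mb' z s) by have [] := dz s.
have gle : integ g t <= k2 by have := G_le t0; move: kap_gt0; lra.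
split => //.
- by apply: integ_ge0 => s _ _; exact: g_ge0.
- exact: G_le.
- exact: g_decr.
- exact: (mem1_sqr_le cg (fun s _ => g_ge0 s) db).
- exact: (dis1_sqr_le cg com (fun s _ => g_ge0 s) (fun s _ => om_ge0 s) dg g'_le db cb).
- exact: (dis2_ge0 cg com (fun s _ => om_ge0 s) dg g'_le db cb).
Qed.

Definition dism mu (z : mode R) t := mode_dis mu g (mb z) (mb' z) t.

Lemma der_nrjm l mu (z : mode R) (t : R) : is_mode rho1 rho2 k k2 l mu g z -> 0 < t ->
  der (nrjm rho1 rho2 k k2 l mu g z) t (- dism mu z t).
Proof.
move=> [dz [ca cb cc] [a2 [b2 [c2 H]]]] t0.
by apply: (@der_mode_nrj _ rho1 rho2 k k2 l mu _ _ g (ma z) (ma' z) a2 (mb z) (mb' z) b2 (mc z) (mc' z) c2 cg) => //;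
  rewrite ?gt_eqF// => s; try (by have [] := dz s); move=> s0; have [[]] := H s s0.
Qed.

Lemma nrjm_ge0 l mu (z : mode R) t : mu1 <= mu -> is_mode rho1 rho2 k k2 l mu g z -> 0 <= t ->
  mu ^+ 2 * mb z t ^+ 2 <= 2 / kap * nrjm rho1 rho2 k k2 l mu g z t /\
  0 <= nrjm rho1 rho2 k k2 l mu g z t.
Proof.
move=> hmu hz t0; have [_ _ hkap _ _ m1 _ _] := mode_stateP hmu hz t0.
have m2 : 0 <= mem2 g (mb z) t by have := le_trans (sqr_ge0 _) m1; rewrite pmulr_rge0.
have h : kap * (mu ^+ 2 * mb z t ^+ 2) <= 2 * nrjm rho1 rho2 k k2 l mu g z t.
  rewrite /nrjm /mode_nrj /nrj -exprMn.
  have := ler_wpM2r (sqr_ge0 (mu * mb z t)) hkap.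
  have : 0 <= rho1 * ma' z t ^+ 2 by pos.
  have : 0 <= rho2 * mb' z t ^+ 2 by pos.
  have : 0 <= rho1 * mc' z t ^+ 2 by pos.
  have : 0 <= k * axl l mu (ma z t) (mc z t) ^+ 2 by pos.
  have : 0 <= k * shr l mu (ma z t) (mb z t) (mc z t) ^+ 2 by pos.
  have : 0 <= mu ^+ 2 * mem2 g (mb z) t by pos.
  lra.
split; first by rewrite [leRHS]mulrAC ler_pdivlMr// mulrC.
have : 0 <= kap * (mu ^+ 2 * mb z t ^+ 2) by pos.
by move: h; lra.
Qed.

Lemma dism_ge0 l mu (z : mode R) t : mu1 <= mu -> is_mode rho1 rho2 k k2 l mu g z -> 0 < t ->
  2^-1 * mu ^+ 2 * dis2 g (mb z) (mb' z) t <= dism mu z t /\ 0 <= dism mu z t.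
Proof.
move=> hmu hz t0; have [_ _ _ _ _ _ _ d2] := mode_stateP hmu hz (ltW t0).
have : 0 <= 2^-1 * mu ^+ 2 * (g t * mb z t ^+ 2) by pos.
have : 0 <= 2^-1 * mu ^+ 2 * dis2 g (mb z) (mb' z) t by pos.
by rewrite /dism /mode_dis; split; lra.
Qed.

Lemma nrjm_continuous l mu (z : mode R) : is_mode rho1 rho2 k k2 l mu g z ->
  continuous (nrjm rho1 rho2 k k2 l mu g z).
Proof.
move=> [dz [ca cb cc] _].
by apply: mode_nrj_continuous => // s; have [] := dz s.
Qed.

Lemma nrjm_decr l mu (z : mode R) s t : mu1 <= mu -> is_mode rho1 rho2 k k2 l mu g z ->
  0 <= s -> s <= t -> nrjm rho1 rho2 k k2 l mu g z t <= nrjm rho1 rho2 k k2 l mu g z s.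
Proof.
move=> hmu hz s0 st.
apply: (@der_le0_ge _ (nrjm rho1 rho2 k k2 l mu g z) (fun t => - dism mu z t) _ _ st).
  by apply: continuous_subspaceT; exact: nrjm_continuous.
move=> x sx _; have x0 := le_lt_trans s0 sx; split; first exact: der_nrjm.
by rewrite oppr_le0; have [] := dism_ge0 hmu hz x0.
Qed.

Variables (n : nat) (l : R) (mu : 'I_n -> R) (z : 'I_n -> mode R).
Hypothesis mu_ge : forall i, mu1 <= mu i.
Hypothesis zP : forall i, is_mode rho1 rho2 k k2 l (mu i) g (z i).

Definition nrjs t := \sum_(i < n) nrjm rho1 rho2 k k2 l (mu i) g (z i) t.
Definition diss t := \sum_(i < n) dism (mu i) (z i) t.
Definition mems t := \sum_(i < n) (mu i ^+ 2 * mem2 g (mb (z i)) t).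
(** The squares whose integrals in s against g and -dg are the memory energy and,
    up to a factor and a boundary term, the dissipation of the family. *)
Definition rho t s := \sum_(i < n) (mu i ^+ 2 * (mb (z i) t - mb (z i) (t - s)) ^+ 2).

Let cb i : continuous (mb (z i)).
Proof. by move=> s; have [dz _ _] := zP i; have [_ h _] := dz s; exact: der_cont h. Qed.

Lemma cont_sum (m : nat) (f : 'I_m -> R -> R) : (forall i, continuous (f i)) ->
  continuous (fun s => \sum_(i < m) f i s).
Proof.
move=> cf; elim: m f cf => [|m IH] f cf.
  by under eq_fun do rewrite big_ord0; exact: cont_cst.
under eq_fun do rewrite big_ord_recr.
by apply: contD => //; apply: IH.
Qed.

Lemma integ_sum (m : nat) (f : 'I_m -> R -> R) t : (forall i, continuous (f i)) ->
  integ (fun s => \sum_(i < m) f i s) t = \sum_(i < m) integ (f i) t.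
Proof.
move=> cf; elim: m f cf => [|m IH] f cf.
  rewrite big_ord0; apply: Rintegral_eq0 => s _; by rewrite big_ord0.
rewrite big_ord_recr /= -IH// -integD//; last exact: cont_sum.
by apply: eq_integ => s _ _; rewrite big_ord_recr.
Qed.

Lemma rho_continuous t : continuous (rho t).
Proof.
apply: cont_sum => i; apply: contZ; apply: contX2; apply: contB; first exact: cont_cst.
apply: (cont_comp (f := fun s => t - s)) (@cb i).
exact: contB (@cont_cst _ _) (@cont_id _).
Qed.

Lemma rho_ge0 t s : 0 <= rho t s.
Proof. by apply: sumr_ge0 => i _; pos. Qed.

Lemma memsE t : mems t = integ (fun s => g s * rho t s) t.
Proof.
have ci i : continuous (fun s => mu i ^+ 2 * (g s * (mb (z i) t - mb (z i) (t - s)) ^+ 2)).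
  apply: contZ; apply: contM => //; apply: contX2; apply: contB; first exact: cont_cst.
  apply: (cont_comp (f := fun s => t - s)) (@cb i).
  exact: contB (@cont_cst _ _) (@cont_id _).
rewrite /mems /rho.
have -> : integ (fun s => g s * \sum_(i < n) (mu i ^+ 2 * (mb (z i) t - mb (z i) (t - s)) ^+ 2)) t =
   integ (fun s => \sum_(i < n) (mu i ^+ 2 * (g s * (mb (z i) t - mb (z i) (t - s)) ^+ 2))) t.
  apply: eq_integ => s _ _; rewrite mulr_sumr; apply: eq_bigr => i _; ring.
rewrite integ_sum//; apply: eq_bigr => i _; rewrite (mem2E cg (b' := mb' (z i))); last first.
  by move=> s; have [dz _ _] := zP i; have [] := dz s.
rewrite integZ//; apply: contM => //; apply: contX2; apply: contB; first exact: cont_cst.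
apply: (cont_comp (f := fun s => t - s)) (@cb i).
exact: contB (@cont_cst _ _) (@cont_id _).
Qed.

Lemma om_rho_le t : 0 < t -> integ (fun s => om s * rho t s) t <= 2 * diss t.
Proof.
move=> t0.
have ci i : continuous (fun s => om s * (mb (z i) t - mb (z i) (t - s)) ^+ 2).
  apply: contM => //; apply: contX2; apply: contB; first exact: cont_cst.
  apply: (cont_comp (f := fun s => t - s)) (@cb i).
  exact: contB (@cont_cst _ _) (@cont_id _).
have -> : integ (fun s => om s * rho t s) t =
   integ (fun s => \sum_(i < n) (mu i ^+ 2 * (om s * (mb (z i) t - mb (z i) (t - s)) ^+ 2))) t.
  apply: eq_integ => s _ _; rewrite /rho mulr_sumr; apply: eq_bigr => i _; ring.
rewrite integ_sum; last by move=> i; exact: contZ.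
rewrite /diss mulr_sumr; apply: ler_sum => i _; rewrite integZ//.
have [h _] := dism_ge0 (mu_ge i) (zP i) t0.
apply: (@le_trans _ _ (mu i ^+ 2 * dis2 g (mb (z i)) (mb' (z i)) t)); last by move: h; lra.
apply: ler_wpM2l; first exact: sqr_ge0.
have [dz [_ cb' _] _] := zP i.
have db s : der (mb (z i)) s (mb' (z i) s) by have [] := dz s.
exact: (le_dis2 cg com dg g'_le db cb' (ltW t0)).
Qed.

Lemma der_nrjs (t : R) : 0 < t -> der nrjs t (- diss t).
Proof.
move=> t0; rewrite /diss -sumrN; apply: der_sum => i; exact: der_nrjm (zP i) t0.
Qed.

Lemma diss_ge0 t : 0 < t -> 0 <= diss t.
Proof. by move=> t0; apply: sumr_ge0 => i _; have [] := dism_ge0 (mu_ge i) (zP i) t0. Qed.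

Lemma nrjs_ge0 t : 0 <= t -> 0 <= nrjs t.
Proof. by move=> t0; apply: sumr_ge0 => i _; have [] := nrjm_ge0 (mu_ge i) (zP i) t0. Qed.

Lemma nrjs_decr s t : 0 <= s -> s <= t -> nrjs t <= nrjs s.
Proof. by move=> s0 st; apply: ler_sum => i _; exact: nrjm_decr. Qed.

Lemma nrjs_continuous : continuous nrjs.
Proof. by apply: cont_sum => i; exact: nrjm_continuous. Qed.

(** mu b is a part of the energy because k2 - integ g t stays above kap. *)
Lemma rho_le t s : 0 <= t -> 0 <= s -> s <= t -> rho t s <= 4 / kap * (nrjs t + nrjs (t - s)).
Proof.
move=> t0 s0 st; rewrite /rho /nrjs -big_split /= mulr_sumr; apply: ler_sum => i _.
have ts : 0 <= t - s by rewrite subr_ge0.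
have [h1 _] := nrjm_ge0 (mu_ge i) (zP i) t0.
have [h2 _] := nrjm_ge0 (mu_ge i) (zP i) ts.
have h3 : (mb (z i) t - mb (z i) (t - s)) ^+ 2 <= 2 * mb (z i) t ^+ 2 + 2 * mb (z i) (t - s) ^+ 2.
  have := sqr_ge0 (mb (z i) t + mb (z i) (t - s)); lra.
have := ler_wpM2l (sqr_ge0 (mu i)) h3.
move: h1 h2; rewrite (_ : 4 / kap = 2 * (2 / kap)); last by rewrite mulrA -natrM.
lra.
Qed.

End FixedWeight.
End SumOfModes.


(** * Uniform decay of finite families of modes *)

Section TimeDecay.
Context {R : realType}.
Variables (rho1 rho2 k k2 kap mu1 : R) (g g' : R -> R).
Hypothesis rho1_gt0 : 0 < rho1.
Hypothesis rho2_gt0 : 0 < rho2.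
Hypothesis k_gt0 : 0 < k.
Hypothesis k2_gt0 : 0 < k2.
Hypothesis kap_gt0 : 0 < kap.
Hypothesis mu1_gt0 : 0 < mu1.
Hypothesis speed : rho2 = rho1 * k2 / k.
Hypothesis cg : continuous g.
Hypothesis g_ge0 : forall t : R, 0 <= g t.
Hypothesis g_decr : forall s t : R, 0 <= s -> s <= t -> g t <= g s.
Hypothesis g0_gt0 : 0 < g 0.
Hypothesis dg : forall t : R, 0 < t -> der g t (g' t).
Hypothesis G_le : forall t : R, 0 <= t -> kap <= k2 - integ g t.
Local Notation mu := (@lebesgue_measure R).

Lemma integ_g_gt0 t : 0 < t -> 0 < integ g t.
Proof.
move=> t0; have h : \forall s \near (0 : R), 2^-1 * g 0 < g s.
  apply: (cvgr_gt (g 0) (@cg 0)).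
  by rewrite gtr_pMl// invf_lt1// ltr1n.
have [e /= e0 he] := h.
pose d := Num.min t (e / 2).
have d0 : 0 < d by rewrite lt_min t0 divr_gt0.
have dt : d <= t by rewrite ge_min lexx.
apply: lt_le_trans (integ_le cg (fun s _ => g_ge0 s) (ltW d0) dt).
apply: (@lt_le_trans _ _ (2^-1 * g 0 * d)); first by rewrite !mulr_gt0// invr_gt0.
rewrite -(integ_cst _ (ltW d0)).
apply: le_integ => //; first exact: cont_cst.
move=> s s0 sd; apply: ltW; apply: he => /=; rewrite sub0r normrN ger0_norm//.
apply: (le_lt_trans sd); rewrite /d gt_min; apply/orP; right.
by rewrite ltr_pdivrMr// ltr_pMr// ltr1n.
Qed.

(** The functional is F = sum of the multipliers + n4 times the energy.  Its derivative
    estimate starts at a time t0 > 0 only, because [multiplier_weights] needs a lower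
    bound for the integral of g over [0,t]. *)
Lemma lyapunov : exists2 l0 : R, 0 < l0 & forall l t0 : R, 0 < l -> l < l0 -> 0 < t0 ->
  exists K m M : R, [/\ 0 < K, 0 < m, 0 < M &
  forall om : R -> R, continuous om -> (forall t : R, 0 <= om t) ->
  (forall t : R, 0 < t -> g' t <= - om t) ->
  forall n (fr : 'I_n -> R) (z : 'I_n -> mode R), (forall i, mu1 <= fr i) ->
  (forall i, is_mode rho1 rho2 k k2 l (fr i) g (z i)) ->
  exists F dF : R -> R, forall t : R, 0 < t ->
  [/\ 0 <= F t, F t <= K * nrjs rho1 rho2 k k2 g l fr z t, der F t (dF t) &
   (t0 <= t -> dF t <= - m * nrjs rho1 rho2 k k2 g l fr z t + M * mems g fr z t)]].
Proof.
have [l0 l00 H] := multiplier_weights rho1_gt0 rho2_gt0 k_gt0 k2_gt0 kap_gt0 g0_gt0 mu1_gt0.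
exists l0 => // l t0 l_gt0 l_lt t0_gt0.
have [n1 [n2 [n3 [n4 [m [M [n40 m0 M0 {}H]]]]]]] := H l l_gt0 l_lt _ (integ_g_gt0 t0_gt0).
exists (2 * n4), m, M; split => //; first by pos.
move=> om com om0 g'_le n fr z hfr hz.
pose h i t := multiplier rho1 rho2 k k2 l n1 n2 n3 (fr i) (ma (z i) t) (mb (z i) t) (mc (z i) t)
    (ma' (z i) t) (mb' (z i) t) (mc' (z i) t) (integ g t) (mem1 g (mb (z i)) t).
pose dh i t := dmultiplier rho1 rho2 k k2 l n1 n2 n3 (fr i) (ma (z i) t) (mb (z i) t) (mc (z i) t)
    (ma' (z i) t) (mb' (z i) t) (mc' (z i) t) (integ g t) (g t) (mem1 g (mb (z i)) t)
    (dis1 g (mb (z i)) (mb' (z i)) t).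
exists (fun t => \sum_(i < n) (h i t + n4 * nrjm rho1 rho2 k k2 l (fr i) g (z i) t)).
exists (fun t => \sum_(i < n) (dh i t + n4 * - dism g (fr i) (z i) t)) => t t_gt0.
have st i : mode_state k2 kap (g 0) mu1 (fr i) (mb (z i) t) (integ g t) (g t) (mem1 g (mb (z i)) t)
    (mem2 g (mb (z i)) t) (dis1 g (mb (z i)) (mb' (z i)) t) (dis2 g (mb (z i)) (mb' (z i)) t).
  by exact: (mode_stateP k2_gt0 kap_gt0 cg g_ge0 g_decr g0_gt0 dg G_le com om0 g'_le (hfr i) (hz i) (ltW t_gt0)).
have Hi i := H _ (ma (z i) t) _ (mc (z i) t) (ma' (z i) t) (mb' (z i) t) (mc' (z i) t) _ _ _ _ _ _ (st i).
have abs i : - (n4 * nrjm rho1 rho2 k k2 l (fr i) g (z i) t) <= h i t <= n4 * nrjm rho1 rho2 k k2 l (fr i) g (z i) t.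
  by rewrite -ler_norml; have [] := Hi i.
split.
- by apply: sumr_ge0 => i _; have := abs i; lra.
- by rewrite /nrjs mulr_sumr; apply: ler_sum => i _; have := abs i; lra.
- apply: der_sum => i; apply: derD; last first.
    apply: derZ; exact: der_nrjm (hz i) t_gt0.
  have [dz [_ cb _] [a2 [b2 [c2 Hm]]]] := hz i.
  by apply: (@der_multiplier _ rho1 rho2 k k2 l (fr i) _ _ _ speed g (ma (z i)) (ma' (z i)) a2 (mb (z i)) (mb' (z i)) b2 (mc (z i)) (mc' (z i)) c2 cg) => //;
  rewrite ?gt_eqF// => s; try (by have [] := dz s); move=> s0; have [[]] := Hm s s0.
- move=> t0t; rewrite /nrjs /mems !mulr_sumr -big_split /=; apply: ler_sum => i _.
  have [_ Hd] := Hi i.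
  have gle : integ g t0 <= integ g t by apply: integ_le => //; exact: ltW.
  have := Hd gle; rewrite /dh /dism /mode_dis /nrjm /mode_nrj; lra.
Qed.

Let energy_of n (l : R) (fr : 'I_n -> R) z := nrjs rho1 rho2 k k2 g l fr z.

Definition family (l : R) n (fr : 'I_n -> R) (z : 'I_n -> mode R) : Prop :=
  (forall i, mu1 <= fr i) /\ (forall i, is_mode rho1 rho2 k k2 l (fr i) g (z i)).

Definition good_weight (xi xi' : R -> R) (x0 p : R) : Prop :=
  [/\ continuous xi, forall t : R, 0 < xi t, forall t : R, xi t <= x0,
      forall s t : R, 0 <= s -> s <= t -> xi t <= xi s &
  [/\ forall t : R, 0 < t -> der xi t (xi' t), forall t : R, 0 < t -> xi' t <= 0
    & forall t : R, 0 < t -> g' t <= - xi t * g t `^ p]].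

(** In the last claim, [rho_le] bounds the integral in s of [rho] by the energy
    integrated in time, since a nonincreasing energy satisfies t E(t) <= integral of E. *)
Lemma modes_decay : exists2 l0 : R, 0 < l0 & forall xi xi' x0 p, good_weight xi xi' x0 p ->
  1 <= p -> p < 3 / 2 -> forall l t0 : R, 0 < l -> l < l0 -> 0 < t0 ->
  [/\ p = 1 -> exists2 lam : R, 0 < lam & forall e0 : R, 0 < e0 -> exists2 C : R, 0 < C &
        forall n fr z, family l fr z -> @energy_of n l fr z 0 <= e0 -> forall t : R, t0 <= t ->
        energy_of l fr z t <= C * expR (- lam * \int[mu]_(s in `[t0, t]) xi s),
      1 < p -> forall e0 : R, 0 < e0 -> exists2 C : R, 0 < C &
        forall n fr z, family l fr z -> @energy_of n l fr z 0 <= e0 -> forall t : R, t0 <= t ->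
        energy_of l fr z t <= C * (1 / (1 + \int[mu]_(s in `[t0, t])
                        (xi s `^ (2 * p - 1)))) `^ (1 / (2 * p - 2))
    & 1 < p -> forall e0 B : R, 0 < e0 -> 0 < B -> exists2 C : R, 0 < C &
        forall n fr z, family l fr z -> @energy_of n l fr z 0 <= e0 ->
        (forall t : R, t0 <= t -> integ (energy_of l fr z) t <= B) -> forall t : R, t0 <= t ->
        energy_of l fr z t <= C * (1 / (1 + \int[mu]_(s in `[t0, t])
                        (xi s `^ p))) `^ (1 / (p - 1))].
Proof.
have [l0 l00 HL] := lyapunov; exists l0 => // xi xi' x0 p.
move=> [cxi xi_gt0 xi_le xi_decr [dxi xi'_le0 g'_le]] p_ge1 p_lt l t0 l_gt0 l_lt t0_gt0.
have [K [m [M [K0 m0 M0 {}HL]]]] := HL l t0 l_gt0 l_lt t0_gt0.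
have x0_gt0 : 0 < x0 by exact: lt_le_trans (xi_gt0 0) (xi_le 0).
pose om s := xi s * g s `^ p.
have com : continuous om by apply: contM => //; exact: powR_continuous_ge0.
have om0 (s : R) : 0 <= om s by rewrite mulr_ge0 ?powR_ge0// ltW.
have g'om (t : R) : 0 < t -> g' t <= - om t by rewrite /om -mulNr; exact: g'_le.
have ptt (t : R) : t0 <= t -> 0 < t by exact: lt_le_trans.
have nrj0 n (fr : 'I_n -> R) z : family l fr z -> forall t : R, 0 <= t -> 0 <= energy_of l fr z t.
  by move=> [hf hz] t t_gt0; apply: (nrjs_ge0 rho1_gt0 rho2_gt0 k_gt0 k2_gt0 kap_gt0 cg g_ge0 g_decr g0_gt0 dg G_le com om0 g'om hf hz).
have dis0 n (fr : 'I_n -> R) z : family l fr z -> forall t : R, 0 < t -> 0 <= diss g fr z t.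
  by move=> [hf hz] t t_gt0; apply: (diss_ge0 k2_gt0 kap_gt0 cg g_ge0 g_decr g0_gt0 dg G_le com om0 g'om hf hz).
have derE n (fr : 'I_n -> R) z : family l fr z -> forall t : R, 0 < t -> der (energy_of l fr z) t (- diss g fr z t).
  by move=> [hf hz] t t_gt0; apply: der_nrjs.
have decr n (fr : 'I_n -> R) z : family l fr z -> forall s t : R, 0 <= s -> s <= t -> energy_of l fr z t <= energy_of l fr z s.
  by move=> [hf hz] s t s0 st; apply: (nrjs_decr rho1_gt0 rho2_gt0 k2_gt0 kap_gt0 cg g_ge0 g_decr g0_gt0 dg G_le com om0 g'om hf hz).
have contE n (fr : 'I_n -> R) z : family l fr z -> continuous (energy_of l fr z).
  by move=> [hf hz]; exact: nrjs_continuous.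
have rhoP n (fr : 'I_n -> R) z : family l fr z -> forall t s : R, 0 <= t -> 0 <= s -> s <= t ->
    rho fr z t s <= 4 / kap * (energy_of l fr z t + energy_of l fr z (t - s)).
  by move=> [hf hz] t s t_ge0 s0 st; apply: (rho_le rho1_gt0 rho2_gt0 k_gt0 k2_gt0 kap_gt0 cg g_ge0 g_decr g0_gt0 dg G_le com om0 g'om hf hz).
have omrho n (fr : 'I_n -> R) z : family l fr z -> forall t : R, 0 < t ->
    integ (fun s => om s * rho fr z t s) t <= 2 * diss g fr z t.
  by move=> [hf hz] t t_gt0; apply: (om_rho_le k2_gt0 kap_gt0 cg g_ge0 g_decr g0_gt0 dg G_le com om0 g'om hf hz).
have crho n (fr : 'I_n -> R) z : family l fr z -> forall t, continuous (rho fr z t).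
  by move=> [hf hz] t; exact: rho_continuous hz t.
have memE n (fr : 'I_n -> R) z : family l fr z -> forall t, mems g fr z t = integ (fun s => g s * rho fr z t s) t.
  by move=> [hf hz] t; exact: memsE hz t.
have memsZ n (fr : 'I_n -> R) z : family l fr z -> forall (c t : R),
    c * mems g fr z t = integ (fun s => c * (g s * rho fr z t s)) t.
  by move=> hf c t; rewrite memE// integZ//; apply: contM => //; exact: crho.
have lexi (s t : R) : 0 <= s -> s <= t -> 0 <= g s -> xi t * g s <= xi s * g s.
  by move=> s0 st gs; apply: ler_wpM2r => //; exact: xi_decr.
have cor n (fr : 'I_n -> R) z : family l fr z -> forall t : R, continuous (fun s => om s * rho fr z t s).
  by move=> hf t; apply: contM => //; exact: crho.
have cgr n (fr : 'I_n -> R) z : family l fr z -> forall c t : R, continuous (fun s => c * (g s * rho fr z t s)).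
  by move=> hf c t; apply: contZ; apply: contM => //; exact: crho.
have lya n (fr : 'I_n -> R) z : family l fr z -> exists F dF : R -> R,
    [/\ forall t : R, 0 < t -> 0 <= F t, forall t : R, 0 < t -> F t <= K * energy_of l fr z t,
        forall t : R, 0 < t -> der F t (dF t) &
        forall t : R, t0 <= t -> dF t <= - m * energy_of l fr z t + M * mems g fr z t].
  move=> [hf hz]; have [F [dF H]] := HL om com om0 g'om n fr z hf hz.
  exists F, dF; split=> t t_gt0; last by have [_ _ _ h] := H t (ptt t t_gt0); exact: h.
  - by have [] := H t t_gt0.
  - by have [] := H t t_gt0.
  - by have [] := H t t_gt0.
have dE0 n (fr : 'I_n -> R) z : family l fr z -> forall s : R, 0 < s -> - diss g fr z s <= 0.
  by move=> hf s s0; rewrite oppr_le0; exact: dis0.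
(* Young's inequality in the form used by both polynomial claims; only the weight v of
   the remainder differs. *)
have absorb al Kw (v : R -> R) n (fr : 'I_n -> R) z : family l fr z -> continuous v ->
    (forall lam r : R, 0 < lam -> g r <= lam * g r `^ p + lam `^ (- al^-1) * v r) ->
    (forall s : R, t0 <= s -> integ (fun r => xi r * v r * rho fr z s r) s <= Kw) ->
    forall s lam : R, t0 <= s -> 0 < lam ->
    xi s * mems g fr z s <= lam * (- 2 * (- diss g fr z s)) + Kw * lam `^ (- al^-1).
  move=> hf cv young hv s lam ts lam0; have s0 := ptt s ts; rewrite mulrNN memsZ//.
  pose c := lam `^ (- al^-1).
  have cx : continuous (fun r => xi r * v r * rho fr z s r).
    by apply: contM; [exact: contM|exact: crho].
  have cc : continuous (fun r => c * (xi r * v r * rho fr z s r)) by exact: contZ.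
  have co : continuous (fun r => lam * (om r * rho fr z s r)) by apply: contZ; exact: cor.
  apply: (@le_trans _ _ (integ (fun r => lam * (om r * rho fr z s r) + c * (xi r * v r * rho fr z s r)) s)).
    apply: le_integ => [| |r r0 rs]; [exact: cgr|exact: contD|].
    have rr0 := rho_ge0 fr z s r.
    have h1 : xi s * (g r * rho fr z s r) <= xi r * g r * rho fr z s r.
      by rewrite mulrA; apply: ler_wpM2r => //; exact: lexi.
    have h2 : xi r * rho fr z s r * g r <= xi r * rho fr z s r * (lam * g r `^ p + c * v r).
      by apply: ler_wpM2l; [apply: mulr_ge0 => //; exact: ltW|exact: young].
    by rewrite /om; lra.
  rewrite integD// integZ; last exact: cor.
  rewrite integZ// [Kw * _]mulrC; apply: lerD.
    by apply: ler_wpM2l (omrho _ _ _ hf _ s0); exact: ltW.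
  by apply: ler_wpM2l; [exact: powR_ge0|exact: hv].
have poly al Kw e0 n (fr : 'I_n -> R) z : 0 < al -> 0 < Kw -> 0 < e0 -> family l fr z ->
    energy_of l fr z 0 <= e0 ->
    (forall s lam : R, t0 <= s -> 0 < lam -> xi s * mems g fr z s <=
      lam * (- 2 * (- diss g fr z s)) + Kw * lam `^ (- al^-1)) ->
    forall t, t0 <= t -> energy_of l fr z t <= poly_cst x0 K m M al Kw e0 *
      (1 / (1 + \int[mu]_(s in `[t0, t]) (xi s `^ (al + 1)))) `^ (1 / al).
  move=> al0 Kw0 e0_gt0 hf he HW t t0t; have [F [dF [F0 FK dF' dFle]]] := lya n fr z hf.
  have Et0 : energy_of l fr z t0 <= e0 by apply: le_trans he; apply: decr => //; exact: ltW.
  exact: (poly_decay t0_gt0 K0 m0 M0 cxi xi_gt0 xi_le dxi xi'_le0 (dE0 _ _ _ hf) F0 FK (derE _ _ _ hf)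
    dF' dFle al0 Kw0 e0_gt0 Et0 HW t0t).
split.
- move=> p1; exists (m / (x0 * K + 2 * M)); first by pos.
  move=> e0 e0_gt0; exists ((x0 * K + 2 * M) / (2 * M) * e0); first by pos.
  move=> n fr z hf he t t0t; have [F [dF [F0 FK dF' dFle]]] := lya n fr z hf.
  have HW (s : R) : t0 <= s -> xi s * mems g fr z s <= - 2 * (- diss g fr z s).
    move=> ts; have s0 := ptt s ts; rewrite mulrNN memsZ//; apply: le_trans (omrho _ _ _ hf _ s0).
    apply: le_integ => [| |r r0 rs]; [exact: cgr|exact: cor|].
    rewrite mulrA; apply: ler_wpM2r; first exact: rho_ge0.
    by rewrite /om p1 powRr1//; exact: lexi.
  apply: le_trans (exp_decay t0_gt0 K0 m0 M0 cxi xi_gt0 xi_le dxi xi'_le0 F0 FK (derE _ _ _ hf) dF' dFle HW t0t) _.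
  apply: ler_wpM2r; first exact: expR_ge0.
  apply: ler_wpM2l; first by pos.
  by apply: le_trans he; apply: decr => //; exact: ltW.
- move=> p_gt1 e0 e0_gt0.
  pose al := 2 * p - 2; have al0 : 0 < al by rewrite /al; lra.
  pose gam := 3 / 2 - p; have gam0 : 0 < gam by rewrite /gam subr_gt0.
  pose Rb := 8 / kap * e0; have Rb0 : 0 < Rb by rewrite /Rb; pos.
  pose Kw := Rb * (gam^-1 * g 0 `^ gam); have Kw0 : 0 < Kw by rewrite /Kw; pos.
  exists (poly_cst x0 K m M al Kw e0); first exact (poly_cst_gt0 K0 m0 M0 xi_gt0 xi_le al0 Kw0 e0_gt0).
  move=> n fr z hf he t t0t.
  have Ele (s : R) : 0 <= s -> energy_of l fr z s <= e0.
    by move=> s0; apply: le_trans he; exact: decr.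
  have rhob (s r : R) : 0 <= s -> 0 <= r -> r <= s -> rho fr z s r <= Rb.
    move=> s0 r0 rs; apply: le_trans (rhoP _ _ _ hf s r s0 r0 rs) _.
    apply: (@le_trans _ _ (4 / kap * (e0 + e0))).
      by apply: ler_wpM2l; [by pos|apply: lerD; apply: Ele => //; rewrite subr_ge0].
    by rewrite /Rb le_eqVlt; apply/orP; left; apply/eqP; ring.
  have := poly _ _ _ _ _ _ al0 Kw0 e0_gt0 hf he _ t t0t.
  have -> : al + 1 = 2 * p - 1 by rewrite /al; lra.
  apply; apply: (absorb _ _ (fun r => Num.sqrt (g r))) => //; first exact: sqrt_comp_continuous.
    by move=> lam r lam0; exact: young_sqrt.
  have cv : continuous (fun r => xi r * Num.sqrt (g r)).
    by apply: contM => //; exact: sqrt_comp_continuous.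
  move=> s ts; have s0 := ltW (ptt s ts).
  apply: (@le_trans _ _ (integ (fun r => Rb * (xi r * Num.sqrt (g r))) s)).
    apply: le_integ => [| |r r0 rs]; [by apply: contM => //; exact: crho|exact: contZ|].
    rewrite mulrC; apply: ler_wpM2r; last exact: rhob.
    by apply: mulr_ge0; [exact: ltW|exact: sqrtr_ge0].
  rewrite integZ//; apply: ler_wpM2l; first exact: ltW.
  exact: (xi_sqrt_integ cg g_ge0 g_decr dg cxi xi_gt0 xi_le p_lt g'_le s0).
- move=> p_gt1 e0 B e0_gt0 B0.
  pose al := p - 1; have al0 : 0 < al by rewrite /al subr_gt0.
  pose Rb := 8 / kap * B; have Rb0 : 0 < Rb by rewrite /Rb; pos.
  pose Kw := x0 * Rb; have Kw0 : 0 < Kw by rewrite /Kw; pos.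
  exists (poly_cst x0 K m M al Kw e0); first exact (poly_cst_gt0 K0 m0 M0 xi_gt0 xi_le al0 Kw0 e0_gt0).
  move=> n fr z hf he hB t t0t.
  have cE := contE _ _ _ hf.
  have rhoi (s : R) : t0 <= s -> integ (rho fr z s) s <= Rb.
    move=> ts; have s0 := ltW (ptt s ts).
    have csh : continuous (fun r => energy_of l fr z (s - r)).
      apply: (cont_comp (f := fun r => s - r)) cE.
      exact: contB (@cont_cst _ _) (@cont_id _).
    have cc : continuous (fun r => energy_of l fr z s + energy_of l fr z (s - r)).
      by apply: contD => //; exact: cont_cst.
    apply: (@le_trans _ _ (integ (fun r => 4 / kap * (energy_of l fr z s + energy_of l fr z (s - r))) s)).
      apply: le_integ => [| |r r0 rs]; [exact: crho|exact: contZ|exact: rhoP].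
    rewrite integZ// integD//; last exact: cont_cst.
    rewrite integ_reflect//.
    have h : integ (fun=> energy_of l fr z s) s <= integ (energy_of l fr z) s.
      by apply: le_integ => // [|r r0 rs]; [exact: cont_cst|exact: decr].
    apply: (@le_trans _ _ (4 / kap * (B + B))).
      by apply: ler_wpM2l; [by pos|apply: lerD; [apply: le_trans h _|]; exact: hB].
    by rewrite /Rb le_eqVlt; apply/orP; left; apply/eqP; ring.
  have := poly _ _ _ _ _ _ al0 Kw0 e0_gt0 hf he _ t t0t.
  have -> : al + 1 = p by rewrite /al subrK.
  apply; apply: (absorb _ _ (fun=> 1)) => //; first exact: cont_cst.
    by move=> lam r lam0; rewrite mulr1; exact: young_cst.
  move=> s ts; apply: (@le_trans _ _ (integ (fun r => x0 * rho fr z s r) s)).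
    apply: le_integ => [| |r r0 rs]; [|by apply: contZ; exact: crho|].
      by apply: contM; [apply: contM => //; exact: cont_cst|exact: crho].
    by rewrite mulr1; apply: ler_wpM2r => //; exact: rho_ge0.
  rewrite integZ; last exact: crho.
  by apply: ler_wpM2l; [exact: ltW|exact: rhoi].
Qed.

End TimeDecay.

(** * Square-integrable functions on an interval *)

Section SquareIntegrable.
Context {R : realType}.
Variable L : R.
Local Notation mu := (@lebesgue_measure R).
Local Notation dom := (dom L).
Implicit Types u v w : R -> R.

(** [inL2] without the extension by zero: the form on which the integration lemmas act. *)
Definition sqint v := measurable_fun dom v /\ mu.-integrable dom (EFin \o (fun x => v x ^+ 2)).

Lemma mdom : measurable dom. Proof. exact: measurable_itv. Qed.

Let md := mdom.

Lemma inL2_sqint v : inL2 L v -> sqint v.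
Proof.
move=> hv; have := Lfun2_integrable_sqr hv => h2.
have mv : measurable_fun dom v.
  move: hv; rewrite /inL2 inE => /andP[]; rewrite inE /= => hv _.
  by have := (measurable_restrictT v md).2 hv.
split => //; apply/integrable_mkcond; first exact: md.
apply: eq_integrable h2 => // x _ /=.
by rewrite /patch; case: ifPn => //= _; rewrite expr0n.
Qed.

Lemma sqint_inL2 v : sqint v -> inL2 L v.
Proof.
move=> [mv iv]; rewrite /inL2 inE; apply/andP; split.
  by rewrite inE /=; exact: (measurable_restrictT v md).1.
rewrite inE /= /finite_norm unlock /Lnorm; apply: poweR_lty.
have /integrableP[_] := iv.
apply: le_lt_trans; rewrite [leRHS]integral_mkcond /=.
rewrite le_eqVlt; apply/orP; left; apply/eqP; apply: eq_integral => x _.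
rewrite /patch /=; case: ifPn => _ /=; last by rewrite normr0 powR0// pnatr_eq0.
by rewrite powR_mulrn// normrX.
Qed.

Lemma integrable_addR (u v : R -> R) : mu.-integrable dom (EFin \o u) ->
  mu.-integrable dom (EFin \o v) -> mu.-integrable dom (EFin \o (fun x => u x + v x)).
Proof.
move=> iu iv; apply: (@eq_integrable _ _ R mu dom md ((EFin \o u) \+ (EFin \o v))%E) => //.
exact: integrableD.
Qed.

Lemma integrable_mulR c (v : R -> R) : mu.-integrable dom (EFin \o v) ->
  mu.-integrable dom (EFin \o (fun x => c * v x)).
Proof.
move=> iv; apply: (@eq_integrable _ _ R mu dom md (fun x => c%:E * (EFin \o v) x)%E) => //.
exact: integrableZl.
Qed.

Lemma sqint_mul u v : sqint u -> sqint v -> mu.-integrable dom (EFin \o (fun x => u x * v x)).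
Proof.
move=> [mu_ iu] [mv iv].
apply: (@le_integrable _ _ _ mu dom md _ (EFin \o (fun x => u x ^+ 2 + v x ^+ 2))).
- by apply/measurable_EFinP; exact: measurable_funM.
- move=> x _ /=; rewrite lee_fin [leRHS]ger0_norm ?addr_ge0 ?sqr_ge0// ler_norml.
  have := sqr_ge0 (u x + v x); have := sqr_ge0 (u x - v x).
  have := sqr_ge0 (u x); have := sqr_ge0 (v x); lra.
- exact: integrable_addR.
Qed.

Lemma sqintD u v : sqint u -> sqint v -> sqint (fun x => u x + v x).
Proof.
move=> hu hv; have [mu_ iu] := hu; have [mv iv] := hv; split; first exact: measurable_funD.
apply: (@le_integrable _ _ _ mu dom md _ (EFin \o (fun x => 2 * (u x ^+ 2 + v x ^+ 2)))).
- by apply/measurable_EFinP; apply: measurable_funX; exact: measurable_funD.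
- move=> x _ /=; rewrite lee_fin ger0_norm ?sqr_ge0// [leRHS]ger0_norm; last by pos.
  have := sqr_ge0 (u x - v x); lra.
- by apply: integrable_mulR; exact: integrable_addR.
Qed.

Lemma sqintZ c v : sqint v -> sqint (fun x => c * v x).
Proof.
move=> [mv iv]; split; first exact: measurable_funM.
have := integrable_mulR (c ^+ 2) iv; congr (_.-integrable _ _).
by apply/funext => x /=; rewrite exprMn.
Qed.

Lemma sqintN v : sqint v -> sqint (fun x => - v x).
Proof.
move=> hv; have := sqintZ (-1) hv; congr sqint.
by apply/funext => x; rewrite mulN1r.
Qed.

Lemma sqintB u v : sqint u -> sqint v -> sqint (fun x => u x - v x).
Proof. by move=> hu hv; apply: sqintD => //; exact: sqintN. Qed.

Lemma sqint_bounded v M : measurable_fun dom v -> (forall x, dom x -> `|v x| <= M) -> sqint v.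
Proof.
move=> mv vM; split => //.
apply: (@le_integrable _ _ _ mu dom md _ (EFin \o (fun=> M ^+ 2))).
- by apply/measurable_EFinP; exact: measurable_funX.
- move=> x dx /=; rewrite lee_fin !normrX; apply: lerXn2r; rewrite ?nnegrE//.
  by apply: le_trans (vM x dx) _; exact: ler_norm.
- apply: (integrableS _ _ _ (continuous_itv_integrable 0 L (@cont_cst _ (M ^+ 2)))) => //.
  by apply: subset_itvW.
Qed.

Lemma sqint_cont v : continuous v -> sqint v.
Proof.
move=> cv; have [M M0 hM] := cont_bnd 0 L cv.
apply: (@sqint_bounded v M).
  by apply: measurable_funTS; exact: continuous_measurable_fun.
by move=> x; rewrite /dom /= in_itv /= => /andP[x0 xL]; apply: hM; exact: ltW.
Qed.

Lemma sqint_sum (n : nat) (f : 'I_n -> R -> R) : (forall i, sqint (f i)) ->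
  sqint (fun x => \sum_(i < n) f i x).
Proof.
elim: n f => [|n IH] f hf.
  under eq_fun do rewrite big_ord0; apply: sqint_cont; exact: cont_cst.
under eq_fun do rewrite big_ord_recr; apply: sqintD => //.
exact: IH.
Qed.

Local Notation ip := (dotL2 L).

Lemma dotL2C u v : ip u v = ip v u.
Proof. by apply: eq_Rintegral => x _; rewrite mulrC. Qed.

Lemma dotL2Dl u v w : sqint u -> sqint v -> sqint w ->
  ip (fun x => u x + v x) w = ip u w + ip v w.
Proof.
move=> hu hv hw; rewrite /dotL2 -RintegralD//; try exact: sqint_mul.
by apply: eq_Rintegral => x _; rewrite mulrDl.
Qed.

Lemma dotL2Zl c v w : sqint v -> sqint w -> ip (fun x => c * v x) w = c * ip v w.
Proof.
move=> hv hw; rewrite /dotL2 -RintegralZl//; last exact: sqint_mul.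
by apply: eq_Rintegral => x _; rewrite mulrA.
Qed.

Lemma dotL2Nl v w : sqint v -> sqint w -> ip (fun x => - v x) w = - ip v w.
Proof.
move=> hv hw; rewrite -mulN1r -dotL2Zl//; apply: eq_Rintegral => x _.
by rewrite mulN1r.
Qed.

Lemma dotL2Bl u v w : sqint u -> sqint v -> sqint w ->
  ip (fun x => u x - v x) w = ip u w - ip v w.
Proof. by move=> hu hv hw; rewrite dotL2Dl ?dotL2Nl//; exact: sqintN. Qed.

Lemma dotL2Zr c v w : sqint v -> sqint w -> ip w (fun x => c * v x) = c * ip w v.
Proof. by move=> hv hw; rewrite dotL2C dotL2Zl// dotL2C. Qed.

Lemma dotL2Dr u v w : sqint u -> sqint v -> sqint w ->
  ip w (fun x => u x + v x) = ip w u + ip w v.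
Proof. by move=> hu hv hw; rewrite dotL2C dotL2Dl// (dotL2C u) (dotL2C v). Qed.

Lemma dotL2Br u v w : sqint u -> sqint v -> sqint w ->
  ip w (fun x => u x - v x) = ip w u - ip w v.
Proof. by move=> hu hv hw; rewrite dotL2C dotL2Bl// (dotL2C u) (dotL2C v). Qed.

Lemma dotL2_suml (n : nat) (f : 'I_n -> R -> R) w : (forall i, sqint (f i)) -> sqint w ->
  ip (fun x => \sum_(i < n) f i x) w = \sum_(i < n) ip (f i) w.
Proof.
move=> + hw; elim: n f => [|n IH] f hf.
  rewrite big_ord0 /dotL2; apply: Rintegral_eq0 => x _; by rewrite big_ord0 mul0r.
rewrite big_ord_recr /= -IH// -dotL2Dl//; last exact: sqint_sum.
by apply: eq_Rintegral => x _; rewrite big_ord_recr.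
Qed.

Lemma dotL2_ge0 v : 0 <= ip v v.
Proof. by apply: Rintegral_ge0 => x _; rewrite -expr2 sqr_ge0. Qed.

Lemma dotL2_sqrD u v : sqint u -> sqint v ->
  ip (fun x => u x + v x) (fun x => u x + v x) = ip u u + 2 * ip u v + ip v v.
Proof.
move=> hu hv; have huv := sqintD hu hv.
by rewrite dotL2Dl// !dotL2Dr// (dotL2C v u); ring.
Qed.

Lemma dotL2_sqrB u v : sqint u -> sqint v ->
  ip (fun x => u x - v x) (fun x => u x - v x) = ip u u - 2 * ip u v + ip v v.
Proof.
move=> hu hv; have huv := sqintB hu hv.
by rewrite dotL2Bl// !dotL2Br// (dotL2C v u); ring.
Qed.

Lemma cauchy_schwarz_sqr u v : sqint u -> sqint v -> ip u v ^+ 2 <= ip u u * ip v v.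
Proof.
move=> hu hv.
have H t : 0 <= ip u u - 2 * t * ip u v + t ^+ 2 * ip v v.
  have := dotL2_ge0 (fun x => u x - t * v x); rewrite dotL2_sqrB//; last exact: sqintZ.
  have htv : sqint (fun x => t * v x) by exact: sqintZ.
  by rewrite dotL2Zr// dotL2Zl// dotL2Zr//; lra.
have [v0|v0] := eqVneq (ip v v) 0.
  rewrite v0 mulr0; have [->|n0] := eqVneq (ip u v) 0; first by rewrite expr0n.
  have := H ((ip u u + 1) / (2 * ip u v)); rewrite v0 mulr0 addr0.
  have -> : 2 * ((ip u u + 1) / (2 * ip u v)) * ip u v = ip u u + 1 by field.
  by lra.
have v1 : 0 < ip v v by rewrite lt_def v0 dotL2_ge0.
have := H (ip u v / ip v v); rewrite -(ler_pM2r v1) mul0r.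
have -> : (ip u u - 2 * (ip u v / ip v v) * ip u v + (ip u v / ip v v) ^+ 2 * ip v v) * ip v v =
  ip u u * ip v v - ip u v ^+ 2 by field.
by rewrite subr_ge0.
Qed.

Lemma normL2_ge0 v : 0 <= normL2 L v.
Proof. by rewrite /normL2 fine_ge0// Lnorm_ge0. Qed.

Lemma normL2_sqr v : sqint v -> normL2 L v ^+ 2 = ip v v.
Proof.
move=> hv; rewrite /normL2 unlock /Lnorm -powR_mulrn ?fine_ge0 ?poweR_ge0//.
have [_ iv] := hv.
have -> : (\int[mu]_x (`|(v \_ dom) x|%:E `^ 2))%E = (ip v v)%:E.
  rewrite /dotL2 /Rintegral fineK; last first.
    by apply: integrable_fin_num => //; exact: sqint_mul.
  rewrite [RHS]integral_mkcond; apply: eq_integral => x _.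
  rewrite /patch /=; case: ifPn => _ /=; last by rewrite normr0 powR0// pnatr_eq0.
  by rewrite powR_mulrn// -normrX ger0_norm ?sqr_ge0.
by rewrite poweR_EFin /= -powRrM mulVf// powRr1// dotL2_ge0.
Qed.

Lemma cauchy_schwarz u v : sqint u -> sqint v -> `|ip u v| <= normL2 L u * normL2 L v.
Proof.
move=> hu hv; rewrite -(@ler_pXn2r _ 2)// ?nnegrE ?mulr_ge0 ?normL2_ge0//.
by rewrite exprMn !normL2_sqr// -normrX ger0_norm ?sqr_ge0// cauchy_schwarz_sqr.
Qed.

End SquareIntegrable.

(** * Orthogonal expansions *)

Section Parseval.
Context {R : realType}.
Variable L : R.
Local Notation ip := (dotL2 L).
Local Notation sqint := (sqint L).
Implicit Types f g : R -> R.

Variables (e : nat -> R -> R) (nrm : nat -> R).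
Hypothesis he : forall k, sqint (e k).
Hypothesis nrm_gt0 : forall k, 0 < nrm k.
Hypothesis ortho : forall j k, ip (e j) (e k) = (j == k)%:R * nrm k.

(** Square of the distance from [f] to the span of the first [N] vectors. *)
Definition remainder N f := ip f f - \sum_(k < N) (ip f (e k)) ^+ 2 / nrm k.

Lemma remainder_ge0 N f : sqint f -> 0 <= remainder N f.
Proof.
move=> hf; pose c k := ip f (e k) / nrm k.
pose P x := \sum_(k < N) c k * e k x.
have hP : sqint P by apply: sqint_sum => k; exact: sqintZ.
have fP : ip P f = \sum_(k < N) (ip f (e k)) ^+ 2 / nrm k.
  rewrite /P (dotL2_suml (f := fun k x => c k * e k x))//; last by move=> k; exact: sqintZ.
  apply: eq_bigr => k _; rewrite dotL2Zl// dotL2C /c; ring.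
have ePk j : (j < N)%N -> ip P (e j) = ip f (e j).
  move=> jN; rewrite /P (dotL2_suml (f := fun k x => c k * e k x))//; last by move=> k; exact: sqintZ.
  rewrite (bigD1 (Ordinal jN)) //= big1 ?addr0 => [|i ij].
    by rewrite dotL2Zl// ortho eqxx mul1r /c divfK// gt_eqF.
  rewrite dotL2Zl// ortho (_ : (i == j :> nat) = false) ?mul0r ?mulr0//.
  by apply/negbTE; apply: contraNneq ij => ij; apply/eqP/val_inj.
have PP : ip P P = \sum_(k < N) (ip f (e k)) ^+ 2 / nrm k.
  rewrite {1}/P (dotL2_suml (f := fun k x => c k * e k x))//; last by move=> k; exact: sqintZ.
  apply: eq_bigr => k _; rewrite dotL2Zl// dotL2C ePk// /c; ring.
have := dotL2_ge0 L (fun x => f x - P x); rewrite dotL2_sqrB// PP (dotL2C _ f) fP /remainder.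
lra.
Qed.

Lemma bessel N f : sqint f -> \sum_(k < N) (ip f (e k)) ^+ 2 / nrm k <= ip f f.
Proof. by move=> hf; rewrite -subr_ge0; exact: remainder_ge0. Qed.

Lemma remainder_le N f : remainder N f <= ip f f.
Proof.
rewrite gerBl; apply: sumr_ge0 => k _; apply: mulr_ge0; first exact: sqr_ge0.
by rewrite invr_ge0 ltW.
Qed.

Lemma remainderD N f g : sqint f -> sqint g ->
  remainder N (fun x => f x + g x) <= 2 * remainder N f + 2 * remainder N g.
Proof.
move=> hf hg; have := remainder_ge0 N (sqintB hf hg).
suff : remainder N (fun x => f x + g x) + remainder N (fun x => f x - g x) =
  2 * remainder N f + 2 * remainder N g by lra.
rewrite /remainder dotL2_sqrD// dotL2_sqrB//.
have -> : \sum_(k < N) ip (fun x => f x + g x) (e k) ^+ 2 / nrm k =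
   \sum_(k < N) (2 * (ip f (e k) ^+ 2 / nrm k) + 2 * (ip g (e k) ^+ 2 / nrm k)
     - ip (fun x => f x - g x) (e k) ^+ 2 / nrm k).
  by apply: eq_bigr => k _; rewrite dotL2Dl// dotL2Bl//; ring.
by rewrite sumrB big_split /= -!mulr_sumr; ring.
Qed.

Lemma remainderZ N c f : sqint f -> remainder N (fun x => c * f x) = c ^+ 2 * remainder N f.
Proof.
move=> hf; have hcf := sqintZ c hf; rewrite /remainder dotL2Zl// dotL2Zr// mulrBr mulr_sumr; congr (_ - _); first ring.
by apply: eq_bigr => k _; rewrite dotL2Zl//; ring.
Qed.

(** Validity of Parseval's identity for [f]. *)
Definition pars f := sqint f /\ forall eps, 0 < eps ->
  exists N0, forall N, (N0 <= N)%N -> remainder N f <= eps.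

Lemma parsD f g : pars f -> pars g -> pars (fun x => f x + g x).
Proof.
move=> [hf pf] [hg pg]; split; first exact: sqintD.
move=> eps e0; have e4 : 0 < eps / 4 by rewrite divr_gt0.
have [Nf Hf] := pf _ e4; have [Ng Hg] := pg _ e4.
exists (maxn Nf Ng) => N; rewrite geq_max => /andP[/Hf h1 /Hg h2].
by apply: le_trans (remainderD _ hf hg) _; lra.
Qed.

Lemma parsZ c f : pars f -> pars (fun x => c * f x).
Proof.
move=> [hf pf]; split; first exact: sqintZ.
move=> eps e0; have e4 : 0 < eps / (c ^+ 2 + 1) by rewrite divr_gt0// ltr_wpDl// sqr_ge0.
have [Nf Hf] := pf _ e4; exists Nf => N /Hf h; rewrite remainderZ//.
have h0 := remainder_ge0 N hf.
move: h; rewrite ler_pdivlMr; last by rewrite ltr_wpDl// sqr_ge0.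
lra.
Qed.

Lemma pars_e k : pars (e k).
Proof.
split => // eps e0; exists k.+1 => N kN; rewrite /remainder (bigD1 (Ordinal kN)) //= big1 ?addr0.
  by rewrite ortho eqxx mul1r expr2 mulfK ?gt_eqF// subrr ltW.
move=> i ik; rewrite ortho (_ : (k == i :> nat) = false) ?mul0r ?expr0n ?mul0r//.
by apply/negbTE; apply: contraNneq ik => ik; apply/eqP/val_inj.
Qed.

(** Density suffices: the remainder is dominated by the squared norm. *)
Lemma pars_approx f : sqint f ->
  (forall eps, 0 < eps -> exists2 g, pars g & ip (fun x => f x - g x) (fun x => f x - g x) <= eps) ->
  pars f.
Proof.
move=> hf H; split => // eps e0; have e4 : 0 < eps / 4 by rewrite divr_gt0.
have [g pg fg] := H _ e4; have [hg Hg] := pg; have [N0 HN] := Hg _ e4.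
exists N0 => N /HN hN.
have -> : f = (fun x => (f x - g x) + g x) by apply/funext => x; rewrite subrK.
apply: le_trans (remainderD _ (sqintB hf hg) hg) _.
have := remainder_le N (fun x => f x - g x); lra.
Qed.

End Parseval.

(** * Sines and cosines *)

Section TrigonometricSystem.
Context {R : realType}.
Variable L : R.
Hypothesis L_gt0 : 0 < L.
Local Notation mu := (@lebesgue_measure R).
Local Notation dom := (dom L).
Local Notation ip := (dotL2 L).

Let md := mdom L.

Lemma dom_integ (f : R -> R) : continuous f -> \int[mu]_(x in dom) f x = integ f L.
Proof.
move=> cf; rewrite /dom /integ Rintegral_itv_obnd_cbnd; last first.
  apply: (integrableS _ _ _ (continuous_itv_integrable 0 L cf)) => //.
  exact: subset_itvW.
apply/esym; rewrite -Rintegral_itv_bndo_bndc//.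
apply: (integrableS _ _ _ (continuous_itv_integrable 0 L cf)) => //.
by apply: subset_itvl; rewrite bnd_simp.
Qed.

Lemma integ_ftc (F f : R -> R) (t : R) : (forall x, der F x (f x)) -> continuous f -> 0 <= t ->
  integ f t = F t - F 0.
Proof.
move=> dF cf t0; pose D x := integ f x - F x.
have cD : {within `[0, t], continuous D}.
  apply: continuous_subspaceT; apply: contB; first exact: integ_continuous.
  by move=> x; exact: der_cont (dF x).
have dD x : 0 < x -> der D x 0.
  by move=> x0; apply: der_eq; [apply: derB; [exact: der_integ|exact: dF]|rewrite subrr].
suff : D t = D 0 by rewrite /D integ0; lra.
apply/eqP; rewrite eq_le; apply/andP; split.
  by apply: (@der_le0_ge _ D (fun=> 0)) => // s s0 st; split => //; exact: dD.
by apply: (@der_ge0_le _ D (fun=> 0)) => // s s0 st; split => //; exact: dD.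
Qed.

Lemma dom_ftc (F f : R -> R) : (forall x, der F x (f x)) -> continuous f ->
  \int[mu]_(x in dom) f x = F L - F 0.
Proof. by move=> dF cf; rewrite dom_integ// (integ_ftc dF)// ltW. Qed.

Definition freq (k : nat) : R := k%:R * (pi / L).
Definition cs k x := cos (freq k * x).
Definition sn k x := sin (freq k * x).

Lemma der_lin (a x : R) : der (fun y => a * y) x a.
Proof. by apply: der_eq; [apply: derZ; exact: derI|rewrite mulr1]. Qed.

Lemma der_cs k (x : R) : der (cs k) x (- freq k * sn k x).
Proof.
apply: der_eq; first exact: (der_comp (der_lin (freq k) x) (is_derive_cos _ : der cos _ _)).
by rewrite /sn; ring.
Qed.

Lemma der_sn k (x : R) : der (sn k) x (freq k * cs k x).
Proof.
apply: der_eq; first exact: (der_comp (der_lin (freq k) x) (is_derive_sin _ : der sin _ _)).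
by rewrite /cs; ring.
Qed.

Lemma cs_continuous k : continuous (cs k).
Proof. by move=> x; exact: der_cont (der_cs k x). Qed.

Lemma sn_continuous k : continuous (sn k).
Proof. by move=> x; exact: der_cont (der_sn k x). Qed.

Lemma sqint_cs k : sqint L (cs k). Proof. exact/sqint_cont/cs_continuous. Qed.
Lemma sqint_sn k : sqint L (sn k). Proof. exact/sqint_cont/sn_continuous. Qed.

Lemma sin_natpi k : sin (k%:R * pi) = 0 :> R.
Proof.
elim: k => [|k IH]; first by rewrite mul0r sin0.
by rewrite -addn1 natrD mulrDl mul1r sinDpi IH oppr0.
Qed.

Lemma freqL k : freq k * L = k%:R * pi.
Proof. by rewrite /freq; field; rewrite gt_eqF. Qed.

Lemma sn_L k : sn k L = 0. Proof. by rewrite /sn freqL sin_natpi. Qed.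
Lemma sn_0 k : sn k 0 = 0. Proof. by rewrite /sn mulr0 sin0. Qed.
Lemma cs0 x : cs 0 x = 1. Proof. by rewrite /cs /freq !mul0r cos0. Qed.

Lemma freq_gt0 k : (0 < k)%N -> 0 < freq k.
Proof. by move=> k0; rewrite mulr_gt0 ?ltr0n// divr_gt0 ?pi_gt0. Qed.

Lemma int_cs k : \int[mu]_(x in dom) cs k x = (k == 0%N)%:R * L.
Proof.
have [->|k0] := eqVneq k 0%N.
  rewrite (dom_ftc (F := fun x => x)) ?mul1r ?subr0//; last exact: cs_continuous.
  by move=> x; rewrite cs0; exact: derI.
rewrite (dom_ftc (F := fun x => (freq k)^-1 * sn k x)); last exact: cs_continuous.
  by rewrite sn_L sn_0 !mulr0 subrr mul0r.
move=> x; apply: der_eq; first by apply: derZ; exact: der_sn.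
by rewrite mulrA mulVf ?mul1r// gt_eqF// freq_gt0// lt0n.
Qed.

Lemma csM j k x : (k <= j)%N -> cs j x * cs k x = 2^-1 * cs (j - k) x + 2^-1 * cs (j + k) x.
Proof.
move=> kj; rewrite /cs /freq natrD natrB// !mulrDl !mulNr cosB cosD; lra.
Qed.

Lemma snM j k x : (k <= j)%N -> sn j x * sn k x = 2^-1 * cs (j - k) x - 2^-1 * cs (j + k) x.
Proof.
move=> kj; rewrite /cs /sn /freq natrD natrB// !mulrDl !mulNr cosB cosD; lra.
Qed.

Definition nrmc k : R := if k == 0%N then L else L / 2.

Lemma nrmc_gt0 k : 0 < nrmc k.
Proof. by rewrite /nrmc; case: ifP => // _; rewrite divr_gt0. Qed.

Lemma integrable_cs k : mu.-integrable dom (EFin \o cs k).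
Proof.
apply: (integrableS _ _ _ (continuous_itv_integrable 0 L (@cs_continuous k))) => //.
exact: subset_itvW.
Qed.

Lemma ortho_c j k : ip (cs j) (cs k) = (j == k)%:R * nrmc k.
Proof.
wlog kj : j k / (k <= j)%N.
  move=> H; have [kj|jk] := leqP k j; first exact: H.
  rewrite dotL2C H; last exact: ltnW.
  by rewrite eq_sym; case: eqVneq => [->|]//; rewrite !mul0r.
have -> : ip (cs j) (cs k) = 2^-1 * \int[mu]_(x in dom) cs (j - k) x + 2^-1 * \int[mu]_(x in dom) cs (j + k) x.
  rewrite -!RintegralZl//; try exact: integrable_cs.
  rewrite -RintegralD//; try (by apply: integrable_mulR; exact: integrable_cs).
  by apply: eq_Rintegral => x _; rewrite csM.
rewrite !int_cs subn_eq0 addn_eq0 /nrmc.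
have -> : (j <= k)%N = (j == k) by rewrite eq_sym eqn_leq kj.
case: eqVneq => [->|jk]; first by case: (k == 0%N); rewrite /=; field.
have -> : (j == 0%N) = false.
  by apply/negbTE; apply: contraNneq jk => j0; move: kj; rewrite j0 leqn0 eq_sym.
by rewrite /= !mul0r !mulr0 addr0.
Qed.

Lemma ortho_s j k : ip (sn j.+1) (sn k.+1) = (j == k)%:R * (L / 2).
Proof.
wlog kj : j k / (k <= j)%N.
  move=> H; have [kj|jk] := leqP k j; first exact: H.
  by rewrite dotL2C H; [rewrite eq_sym|exact: ltnW].
have -> : ip (sn j.+1) (sn k.+1) = 2^-1 * \int[mu]_(x in dom) cs (j.+1 - k.+1) x - 2^-1 * \int[mu]_(x in dom) cs (j.+1 + k.+1) x.
  rewrite -!RintegralZl//; try exact: integrable_cs.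
  rewrite -RintegralB//; try (by apply: integrable_mulR; exact: integrable_cs).
  by apply: eq_Rintegral => x _; rewrite snM.
rewrite !int_cs subn_eq0 addn_eq0 ltnS.
have -> : (j <= k)%N = (j == k) by rewrite eq_sym eqn_leq kj.
by rewrite /= mul0r mulr0 subr0; ring.
Qed.

(** Polynomials in cos(pi x / L), described inductively: products with sines or
    cosines are then expanded one factor at a time. *)
Inductive cpoly : (R -> R) -> Prop :=
| cpoly_cst c : cpoly (fun=> c)
| cpolyD f g : cpoly f -> cpoly g -> cpoly (fun x => f x + g x)
| cpolyM f : cpoly f -> cpoly (fun x => cs 1 x * f x).

Lemma cpolyZ c f : cpoly f -> cpoly (fun x => c * f x).
Proof.
elim=> [d|f1 g1 _ h1 _ h2|f1 _ h1]; first exact: cpoly_cst.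
  by have := cpolyD h1 h2; congr cpoly; apply/funext => x; rewrite mulrDr.
by have := cpolyM h1; congr cpoly; apply/funext => x; rewrite mulrCA.
Qed.

Lemma cpoly_continuous f : cpoly f -> continuous f.
Proof.
elim=> [d|f1 g1 _ h1 _ h2|f1 _ h1]; [exact: cont_cst|exact: contD|].
by apply: contM => //; exact: cs_continuous.
Qed.

Lemma cs1M k x : cs 1 x * cs k.+1 x = 2^-1 * cs k.+2 x + 2^-1 * cs k x.
Proof. by rewrite mulrC csM// addrC subn1 addn1. Qed.

Lemma cs1sn k x : cs 1 x * sn k.+1 x = 2^-1 * sn k.+2 x + 2^-1 * sn k x.
Proof.
have e2 : freq k.+2 * x = freq k.+1 * x + freq 1 * x.
  by rewrite /freq -[in LHS](addn1 k.+1) natrD; ring.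
have e0 : freq k * x = freq k.+1 * x - freq 1 * x.
  by rewrite /freq -[in RHS](addn1 k) natrD; ring.
by rewrite /cs /sn e2 e0 sinB sinD; lra.
Qed.

Lemma pars_cpoly_cs f : cpoly f -> forall k, pars L cs nrmc (fun x => f x * cs k x).
Proof.
elim=> [c|f1 g1 _ h1 _ h2|f1 _ h1] k.
- by apply: parsZ; [exact: sqint_cs|exact: nrmc_gt0|exact: ortho_c|apply: pars_e; [exact: sqint_cs|exact: nrmc_gt0|exact: ortho_c]].
- have := parsD sqint_cs nrmc_gt0 ortho_c (h1 k) (h2 k); congr pars.
  by apply/funext => x; rewrite mulrDl.
- case: k => [|k].
    by have := h1 1%N; congr pars; apply/funext => x; rewrite cs0 mulr1 mulrC.
  have := parsD sqint_cs nrmc_gt0 ortho_c (parsZ sqint_cs nrmc_gt0 ortho_c 2^-1 (h1 k.+2))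
    (parsZ sqint_cs nrmc_gt0 ortho_c 2^-1 (h1 k)); congr pars.
  apply/funext => x; rewrite mulrAC cs1M; ring.
Qed.

Let sn' k := sn k.+1.
Let nrms (k : nat) : R := L / 2.
Let sqint_sn' k : sqint L (sn' k). Proof. exact: sqint_sn. Qed.
Let nrms_gt0 k : 0 < nrms k. Proof. by rewrite /nrms divr_gt0. Qed.

Lemma pars_cpoly_sn f : cpoly f -> forall k, pars L sn' nrms (fun x => f x * sn k.+1 x).
Proof.
elim=> [c|f1 g1 _ h1 _ h2|f1 _ h1] k.
- apply: (parsZ sqint_sn' nrms_gt0 ortho_s c (f := sn' k)).
  exact: (pars_e sqint_sn' nrms_gt0 ortho_s).
- have := parsD sqint_sn' nrms_gt0 ortho_s (h1 k) (h2 k); congr pars.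
  by apply/funext => x; rewrite mulrDl.
- have h0 : pars L sn' nrms (fun x => f1 x * sn k x).
    case: k => [|k]; last exact: h1.
    have := parsZ sqint_sn' nrms_gt0 ortho_s 0 (h1 0%N); congr pars.
    by apply/funext => x; rewrite mul0r /sn /freq !mul0r sin0 mulr0.
  have := parsD sqint_sn' nrms_gt0 ortho_s (parsZ sqint_sn' nrms_gt0 ortho_s 2^-1 (h1 k.+1))
    (parsZ sqint_sn' nrms_gt0 ortho_s 2^-1 h0); congr pars.
  apply/funext => x; rewrite mulrAC cs1sn; ring.
Qed.

End TrigonometricSystem.

(** * Bernstein polynomials *)

Section Bernstein.
Context {R : realType}.

(** Bernstein polynomials by recursion on the degree: [bern n f y] is the mean of
    [f] under the binomial law of parameters n, y. *)
Fixpoint bern (n : nat) (f : nat -> R) (y : R) : R :=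
  if n is n'.+1 then (1 - y) * bern n' f y + y * bern n' (fun k => f k.+1) y else f 0%N.

Lemma bern_le n (f g : nat -> R) (y : R) : 0 <= y <= 1 -> (forall k, f k <= g k) -> bern n f y <= bern n g y.
Proof.
move=> /andP[y0 y1]; elim: n f g => [|n IH] f g fg; first exact: fg.
by apply: lerD; apply: ler_wpM2l; rewrite ?subr_ge0//; apply: IH => k; exact: fg.
Qed.

Lemma bern_affine n f a b y : bern n (fun k => a + b * f k) y = a + b * bern n f y.
Proof. by elim: n f => [//|n IH] f /=; rewrite !IH; ring. Qed.

Lemma bern_variance n c y :
  bern n (fun k => (k%:R - c) ^+ 2) y = n%:R * y * (1 - y) + (n%:R * y - c) ^+ 2.
Proof.
elim: n c => [|n IH] c /=; first by ring.
have -> : bern n (fun k => (k.+1%:R - c) ^+ 2) y = bern n (fun k => (k%:R - (c - 1)) ^+ 2) y.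
  by congr bern; apply/funext => k; rewrite -(addn1 k) natrD; congr (_ ^+ 2); ring.
by rewrite !IH -(addn1 n) natrD; ring.
Qed.

(** Chebyshev's inequality: |F z - F y| is at most e/2 + 2 M ((z - y) / d)^2, and the mean
    of the square is small by [bern_variance]. *)
Lemma bern_cvg (F : R -> R) (M y : R) : 0 <= y <= 1 -> (forall z, `|F z| <= M) ->
  {for y, continuous F} -> bern n.+1 (fun k => F (k%:R / n.+1%:R)) y @[n --> \oo] --> F y.
Proof.
move=> y01 FM cF; apply/cvgrPdist_le => e e0.
have M0 : 0 <= M := le_trans (normr_ge0 _) (FM 0).
have e2 : 0 < e / 2 by exact: divr_gt0.
have /cvgrPdist_le/(_ _ e2)[d /= d0 hd] := cF.
pose B := 2 * M / d ^+ 2.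
have B0 : 0 <= B by rewrite /B; pos.
near=> n.
have n0 : 0 < n.+1%:R :> R by rewrite ltr0n.
have nB : B <= e / 2 * n.+1%:R.
  have : 2 * B / e <= n%:R by near: n; exact: nbhs_infty_ger.
  rewrite ler_pdivrMr// => h; have : e * n%:R <= e * n.+1%:R by rewrite ler_pM2l// ler_nat.
  lra.
have key k : `|F (k%:R / n.+1%:R) - F y| <= e / 2 + B / n.+1%:R ^+ 2 * (k%:R - n.+1%:R * y) ^+ 2.
  have -> : B / n.+1%:R ^+ 2 * (k%:R - n.+1%:R * y) ^+ 2 = B * (k%:R / n.+1%:R - y) ^+ 2.
    by field; rewrite gt_eqF.
  have [h|h] := ltP `|k%:R / n.+1%:R - y| d.
    rewrite distrC; apply: le_trans (hd _ _) _; first by rewrite /= distrC.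
    by rewrite lerDl mulr_ge0// sqr_ge0.
  apply: (@le_trans _ _ (2 * M)).
    apply: le_trans (ler_normB _ _) _; have := FM (k%:R / n.+1%:R); have := FM y; lra.
  apply: (@le_trans _ _ (B * (k%:R / n.+1%:R - y) ^+ 2)); last by rewrite lerDr ltW.
  rewrite /B mulrAC ler_pdivlMr ?exprn_gt0//; apply: ler_wpM2l; first by rewrite mulr_ge0.
  by rewrite -[leRHS]ger0_norm ?sqr_ge0// normrX lerXn2r ?nnegrE// ltW.
have bound : e / 2 + B / n.+1%:R ^+ 2 * bern n.+1 (fun k => (k%:R - n.+1%:R * y) ^+ 2) y <= e.
  rewrite bern_variance subrr expr0n addr0.
  have -> : B / n.+1%:R ^+ 2 * (n.+1%:R * y * (1 - y)) = B / n.+1%:R * (y * (1 - y)).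
    by field; rewrite gt_eqF.
  have h1 : B / n.+1%:R <= e / 2 by rewrite ler_pdivrMr.
  have h2 : B / n.+1%:R * (y * (1 - y)) <= B / n.+1%:R * 1.
    apply: ler_wpM2l; first by rewrite divr_ge0.
    by move: y01 => /andP[y0 y1]; have := sqr_ge0 y; nra.
  rewrite [leRHS]splitr; apply: lerD => //; apply: le_trans h2 _.
  by rewrite mulr1.
set b := B / _ in key bound; set V := bern _ _ _ in bound.
have up : bern n.+1 (fun k => F (k%:R / n.+1%:R)) y <= F y + e / 2 + b * V.
  rewrite -bern_affine; apply: bern_le => // k.
  by have := key k; rewrite ler_norml => /andP[_]; rewrite lerBlDl addrA.
have dn : F y - e / 2 + (- b) * V <= bern n.+1 (fun k => F (k%:R / n.+1%:R)) y.
  rewrite -bern_affine; apply: bern_le => // k.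
  by have := key k; rewrite ler_norml => /andP[+ _]; rewrite lerBrDl opprD addrA mulNr.
set u := bern _ _ _ in up dn *.
have h1 : - e <= F y - u by move: up dn bound; lra.
have h2 : F y - u <= e by move: up dn bound; lra.
by rewrite ler_norml; apply/andP.
Unshelve. all: by end_near. Qed.

End Bernstein.

(** * Completeness of the sines and of the cosines *)

Section Density.
Context {R : realType}.
Variable L : R.
Hypothesis L_gt0 : 0 < L.
Local Notation mu := (@lebesgue_measure R).
Local Notation dom := (dom L).
Local Notation ip := (dotL2 L).
Let md := mdom L.

Lemma dct_small (u : nat -> R -> R) (B : R -> R) :
  (forall n, measurable_fun dom (u n)) -> mu.-integrable dom (EFin \o B) ->
  (forall n x, dom x -> `|u n x| <= B x) ->
  (forall x, dom x -> u n x @[n --> \oo] --> (0 : R)) ->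
  forall e : R, 0 < e -> exists n, \int[mu]_(x in dom) u n x <= e.
Proof.
move=> mu_ iB uB u0 e e0.
have := @dominated_convergence _ _ R mu dom md (fun n => EFin \o u n) (fun=> 0%E) (EFin \o B).
case.
- by move=> n; apply/measurable_EFinP; exact: mu_.
- exact: measurable_cst.
- apply: aeW => x dx; apply/fine_cvgP; split; first exact: nearW.
  exact: u0.
- exact: iB.
- by apply: aeW => x n dx; rewrite /= lee_fin; exact: uB.
move=> _ _; rewrite integral0 => /fine_cvgP[_ /=].
move=> /cvgrPdist_le /(_ _ e0)[N _ HN]; exists N.
have := HN N (leqnn N); rewrite /= sub0r normrN => h.
exact: le_trans (ler_norm _) h.
Qed.

Local Notation yy x := (2^-1 - 2^-1 * cs L 1 x).

Lemma cpoly_bern n (f : nat -> R) : cpoly L (fun x => bern n f (yy x)).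
Proof.
elim: n f => [|n IH] f /=; first exact: cpoly_cst.
have h1 := cpolyD (cpolyZ 2^-1 (IH f)) (cpolyZ 2^-1 (cpolyM (IH f))).
have h2 := cpolyD (cpolyZ 2^-1 (IH (fun k => f k.+1))) (cpolyZ (- 2^-1) (cpolyM (IH (fun k => f k.+1)))).
have := cpolyD h1 h2; congr cpoly; apply/funext => x.
by field.
Qed.

Lemma bern_bound n (f : nat -> R) (y M : R) : 0 <= y <= 1 -> (forall k, `|f k| <= M) -> `|bern n f y| <= M.
Proof.
move=> y01 fM; have c (a : R) : a = bern n (fun k => a + 0 * f k) y by rewrite bern_affine mul0r addr0.
rewrite ler_norml (c (- M)) {2}(c M); apply/andP; split; apply: bern_le => // k;
  by have := fM k; rewrite ler_norml mul0r addr0 => /andP[].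
Qed.

Lemma cs_bound k (x : R) : -1 <= cs L k x <= 1.
Proof. by rewrite /cs cos_geN1 cos_le1. Qed.

(** The substitution y = (1 - cos(pi x / L)) / 2 turns Bernstein polynomials into cosine
    polynomials; bounded pointwise convergence is enough in L^2. *)
Lemma cpoly_dense_cont (h : R -> R) (M : R) : continuous h -> (forall x, `|h x| <= M) -> forall e : R, 0 < e ->
  exists2 T, cpoly L T & ip (fun x => h x - T x) (fun x => h x - T x) <= e.
Proof.
move=> ch hM e e0.
have M0 : 0 <= M := le_trans (normr_ge0 _) (hM 0).
pose F y := h (L / pi * acos (1 - 2 * y)).
pose T n x := bern n.+1 (fun k => F (k%:R / n.+1%:R)) (yy x).
have yy01 x : 0 <= yy x <= 1 by have := cs_bound 1 x; lra.
have hT n : cpoly L (T n) by exact: cpoly_bern.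
have TM n x : `|T n x| <= M by apply: bern_bound => // k; exact: hM.
have FE x : dom x -> F (yy x) = h x.
  rewrite /dom /= in_itv /= => /andP[x0 xL]; rewrite /F.
  have -> : 1 - 2 * (2^-1 - 2^-1 * cs L 1 x) = cs L 1 x by field.
  rewrite /cs /freq mul1r cosK ?in_itv /=.
    have E (P : R) : 0 < P -> L / P * (P / L * x) = x by move=> P0; field; rewrite !gt_eqF.
    by rewrite E ?pi_gt0.
  apply/andP; split; first by rewrite mulr_ge0 ?divr_ge0 ?pi_ge0// ltW.
  by rewrite mulrAC ler_pdivrMr// ler_wpM2l ?pi_ge0// ltW.
have cF x : dom x -> {for yy x, continuous F}.
  rewrite /dom /= in_itv /= => /andP[x0 xL].
  have E : 1 - 2 * (2^-1 - 2^-1 * cs L 1 x) = cs L 1 x by field.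
  have c01 : -1 < cs L 1 x < 1.
    have /andP[c1 c2] := cs_bound 1 x.
    have s0 : 0 < sn L 1 x.
      rewrite /sn /freq mul1r; apply: sin_gt0_pi; rewrite !mulr_gt0 ?invr_gt0 ?pi_gt0//=.
      by rewrite mulrAC ltr_pdivrMr// ltr_pM2l ?pi_gt0.
    have := cos2Dsin2 (freq L 1 * x); rewrite -/(cs L 1 x) -/(sn L 1 x) => cs1.
    have : cs L 1 x ^+ 2 < 1 by have : 0 < sn L 1 x ^+ 2 by [exact: exprn_gt0]; lra.
    by move=> h1; rewrite !lt_neqAle c1 c2 !andbT; apply/andP; split; apply/eqP => c; move: h1;
      [rewrite -c sqrrN expr1n ltxx|rewrite c expr1n ltxx].
  have h1 : {for yy x, continuous (fun y : R => 1 - 2 * y)}.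
    by apply: contB; [exact: cont_cst|exact: contZ (@cont_id _)].
  have h2 : {for 1 - 2 * yy x, continuous (fun y : R => acos y)}.
    by rewrite E; exact: continuous_acos.
  have h3 := continuous_comp h1 h2.
  have h4 : {for acos (1 - 2 * yy x), continuous (fun y : R => h (L / pi * y))}.
    move: (acos _); apply: (cont_comp (f := fun y => L / pi * y)) ch.
    exact: contZ (@cont_id _).
  exact: (continuous_comp h3 h4).
have cT n := cpoly_continuous (hT n).
have [||||n hn] := @dct_small (fun n x => (h x - T n x) ^+ 2) (fun=> (2 * M) ^+ 2) _ _ _ _ e e0.
- move=> n; apply: measurable_funTS; apply: continuous_measurable_fun; apply: contX2.
  exact: contB.
- apply: (integrableS _ _ _ (continuous_itv_integrable 0 L (@cont_cst _ ((2 * M) ^+ 2)))) => //.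
  exact: subset_itvW.
- move=> n x _; rewrite normrX; apply: lerXn2r; rewrite ?nnegrE ?mulr_ge0//.
  apply: le_trans (ler_normB _ _) _; have := hM x; have := TM n x; lra.
- move=> x dx; have := @bern_cvg R F M (yy x) (yy01 x) (fun z => hM _) (cF x dx).
  rewrite FE// => hc.
  have : (h x - T n x) ^+ 2 @[n --> \oo] --> (h x - h x) ^+ 2.
    by apply: cvgM; apply: cvgB => //; exact: cvg_cst.
  by rewrite subrr expr0n.
exists (T n) => //; exact: hn.
Qed.


Lemma quarters (a b c e : R) : 0 <= a - 2 * b + c -> a <= e / 4 -> c <= e / 4 ->
  a + 2 * b + c <= e.
Proof. lra. Qed.

(** Continuous functions approximate q in L^1; truncated at M, they do so in L^2 because
    |q - h|^2 <= 2 M |q - h|. *)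
Lemma cpoly_dense_bounded (q : R -> R) (M : R) : measurable_fun dom q ->
  (forall x, dom x -> `|q x| <= M) -> forall e : R, 0 < e ->
  exists2 T, cpoly L T & ip (fun x => q x - T x) (fun x => q x - T x) <= e.
Proof.
move=> mq qM e e0.
have M0 : 0 <= M.
  have Ld : dom (L / 2) by rewrite /dom /= in_itv /= divr_gt0//= ltr_pdivrMr// ltr_pMr// ltr1n.
  exact: le_trans (normr_ge0 _) (qM _ Ld).
have hq := sqint_bounded mq qM.
have one : sqint L (fun=> 1) by apply: sqint_cont; exact: cont_cst.
have iq : mu.-integrable dom (EFin \o q).
  by have := sqint_mul hq one; congr (_.-integrable _ _); apply/funext => x /=; rewrite mulr1.
have dfin : (mu dom < +oo)%E.
  by rewrite /dom lebesgue_measure_itv /=; case: ifPn => // _; rewrite -EFinD ltry.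
have [h_ [ch ih]] := approximation_continuous_integrable md dfin iq.
have e1 : 0 < e / 4 / (2 * M + 1) by rewrite !divr_gt0// ltr_wpDl// mulr_ge0.
move=> /fine_cvgP[_ /cvgrPdist_le /(_ _ e1) [N _ HN]].
have {HN} := HN N (leqnn N); rewrite /= sub0r normrN => hN.
have {hN} : \int[mu]_(x in dom) `|q x - h_ N x| <= e / 4 / (2 * M + 1).
  by apply: le_trans hN; exact: ler_norm.
set g := h_ N => hN.
pose h x := Num.max (- M) (Num.min M (g x)).
have cg : continuous g by exact: ch.
have chh : continuous h.
  move=> x; apply: (@continuous_max _ _ (fun=> - M) (fun x => Num.min M (g x))); first exact: cvg_cst.
  by apply: (@continuous_min _ _ (fun=> M) g); [exact: cvg_cst|exact: cg].
have hM x : `|h x| <= M.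
  rewrite ler_norml /h le_max lexx /= ge_max ge_min lexx andbT /=.
  by move: M0; lra.
have qh x : dom x -> (q x - h x) ^+ 2 <= (2 * M) * `|q x - g x|.
  move=> dx; have qx := qM x dx.
  have h1 : `|q x - h x| <= `|q x - g x|.
    move: qx; rewrite /h ler_norml => /andP[q1 q2].
    have [g1|g1] := leP M (g x); last first.
      have [g2|g2] := leP (- M) (g x); first by [].
      by rewrite ger0_norm ?subr_ge0// ger0_norm; lra.
    rewrite max_r; last lra.
    by rewrite ler0_norm ?subr_le0// ler0_norm; lra.
  have h2 : `|q x - h x| <= 2 * M.
    by apply: le_trans (ler_normB _ _) _; have := hM x; lra.
  rewrite -real_normK ?num_real// expr2.
  by apply: ler_pM.
have hh : sqint L h by exact: sqint_cont.
have hg : sqint L g by exact: sqint_cont.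
have e4 : 0 < e / 4 by rewrite divr_gt0.
have [T hT TE] := cpoly_dense_cont chh hM e4; exists T => //.
have hTs : sqint L T by apply: sqint_cont; exact: (cpoly_continuous hT).
have E1 : ip (fun x => q x - h x) (fun x => q x - h x) <= e / 4.
  have ig : mu.-integrable dom (EFin \o (fun x => 2 * M * `|q x - g x|)).
    apply: integrable_mulR; have := sqint_mul (sqintB hq hg) one.
    move=> /integrable_abse; congr (_.-integrable _ _); apply/funext => x /=.
    by rewrite mulr1.
  apply: (@le_trans _ _ (\int[mu]_(x in dom) (2 * M * `|q x - g x|))).
    apply: le_Rintegral => //.
    exact: sqint_mul (sqintB hq hh) (sqintB hq hh).
  rewrite RintegralZl//; last first.
    have := sqint_mul (sqintB hq hg) one.
    move=> /integrable_abse; congr (_.-integrable _ _); apply/funext => x /=.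
    by rewrite mulr1.
  apply: (@le_trans _ _ ((2 * M + 1) * (e / 4 / (2 * M + 1)))).
    apply: ler_pM; [by pos|by apply: Rintegral_ge0 => x _; exact: normr_ge0|by rewrite lerDl|exact: hN].
  by rewrite mulrC divfK// gt_eqF// ltr_wpDl// mulr_ge0.
have hqh := sqintB hq hh; have hhT := sqintB hh hTs.
have -> : (fun x => q x - T x) = (fun x => (q x - h x) + (h x - T x)).
  by apply/funext => x; ring.
have := dotL2_ge0 L (fun x => (q x - h x) - (h x - T x)).
by rewrite (dotL2_sqrB hqh hhT) (dotL2_sqrD hqh hhT) => h0; exact: quarters h0 E1 TE.
Qed.

(** The truncation level may depend on the point: a constant one gives bounded functions,
    a multiple of sin(pi x / L) gives functions that stay bounded after division by it. *)
Lemma truncate_small (f : R -> R) (b : nat -> R -> R) : sqint L f ->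
  (forall n, measurable_fun dom (b n)) -> (forall x, dom x -> exists N, forall n, (N <= n)%N -> `|f x| <= b n x) ->
  forall e : R, 0 < e -> exists n,
  let fn x := if `|f x| <= b n x then f x else 0 in
  measurable_fun dom fn /\ ip (fun x => f x - fn x) (fun x => f x - fn x) <= e.
Proof.
move=> hf mb bf e e0; pose fn n x := if `|f x| <= b n x then f x else 0.
have [mf i_f] := hf.
have mfn n : measurable_fun dom (fn n).
  apply: measurable_fun_if => //.
  - apply: measurable_fun_ler => //.
    by apply: measurableT_comp => //.
  - by apply: measurable_funS mf => //; exact: subIsetl.
have [||||n hn] := @dct_small (fun n x => (f x - fn n x) ^+ 2) (fun x => f x ^+ 2) _ _ _ _ e e0.
- by move=> n; apply: measurable_funX; exact: measurable_funB.
- exact: i_f.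
- move=> n x _; rewrite ger0_norm ?sqr_ge0// /fn; case: ifP => _; last by rewrite subr0.
  by rewrite subrr expr0n sqr_ge0.
- move=> x dx; have [N HN] := bf x dx.
  apply: cvg_near_cst; exists N => // n /= Nn; rewrite /fn HN//.
  by rewrite subrr expr0n.
by exists n; split; [exact: mfn|exact: hn].
Qed.

Lemma cpoly_dense (f : R -> R) : sqint L f -> forall e : R, 0 < e ->
  exists2 T, cpoly L T & ip (fun x => f x - T x) (fun x => f x - T x) <= e.
Proof.
move=> hf e e0; have e4 : 0 < e / 4 by rewrite divr_gt0.
have [|x _|n] := @truncate_small f (fun n _ => n%:R) hf _ _ _ e4.
- by move=> n; exact: measurable_cst.
- exists (Num.bound `|f x|) => n Hn; apply: ltW; apply: lt_le_trans (archi_boundP (normr_ge0 _)) _.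
  by rewrite ler_nat.
set fn := fun x => _ => -[mfn hfn].
have fnb x : dom x -> `|fn x| <= n%:R by rewrite /fn; case: ifP => // _; rewrite normr0.
have [T hT TE] := cpoly_dense_bounded mfn fnb e4; exists T => //.
have hTs : sqint L T by apply: sqint_cont; exact: (cpoly_continuous hT).
have hfns := sqint_bounded mfn fnb.
have h1 := sqintB hf hfns; have h2 := sqintB hfns hTs.
have -> : (fun x => f x - T x) = (fun x => (f x - fn x) + (fn x - T x)).
  by apply/funext => x; ring.
have := dotL2_ge0 L (fun x => (f x - fn x) - (fn x - T x)).
by rewrite (dotL2_sqrB h1 h2) (dotL2_sqrD h1 h2) => h0; exact: quarters h0 hfn TE.
Qed.

Lemma parseval_cs (f : R -> R) : sqint L f -> pars L (cs L) (nrmc L) f.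
Proof.
move=> hf; apply: (pars_approx (sqint_cs L) (nrmc_gt0 L_gt0) (ortho_c L_gt0) hf) => e e0.
have [T hT TE] := cpoly_dense hf e0; exists T => //.
have := pars_cpoly_cs L_gt0 hT 0; congr pars; apply/funext => x.
by rewrite cs0 mulr1.
Qed.

Lemma sn1_gt0 x : dom x -> 0 < sn L 1 x <= 1.
Proof.
rewrite /dom /= in_itv /= => /andP[x0 xL]; rewrite /sn /freq mul1r sin_le1 andbT.
apply: sin_gt0_pi; rewrite !mulr_gt0 ?invr_gt0 ?pi_gt0//=.
by rewrite mulrAC ltr_pdivrMr// ltr_pM2l ?pi_gt0.
Qed.

(** Approximate f by a cosine polynomial times sin(pi x / L), after dividing f by
    this sine, which has no zero inside the interval. *)
Lemma parseval_sn (f : R -> R) : sqint L f -> pars L (fun k => sn L k.+1) (fun=> L / 2) f.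
Proof.
move=> hf.
have L2 (k : nat) : 0 < L / 2 by rewrite divr_gt0.
apply: (pars_approx (fun k => sqint_sn L k.+1) L2 (ortho_s L_gt0) hf) => e e0.
have e4 : 0 < e / 4 by rewrite divr_gt0.
have msn : measurable_fun dom (sn L 1).
  by apply: measurable_funTS; apply: continuous_measurable_fun; exact: sn_continuous.
have [|x dx|n] := @truncate_small f (fun n x => n%:R * sn L 1 x) hf _ _ _ e4.
- by move=> n; exact: measurable_funM.
- have /andP[s0 _] := sn1_gt0 dx.
  exists (Num.bound (`|f x| / sn L 1 x)) => n Hn.
  rewrite -ler_pdivrMr//; apply: ltW; apply: lt_le_trans (archi_boundP _) _.
    by rewrite divr_ge0// ltW.
  by rewrite ler_nat.
set fn := fun x => _ => -[mfn hfn].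
pose q x := fn x * (sn L 1 x)^-1.
have qb x : dom x -> `|q x| <= n%:R.
  move=> dx; have /andP[s0 _] := sn1_gt0 dx.
  rewrite /q normrM normfV (gtr0_norm s0) ler_pdivrMr// /fn.
  by case: ifP => // _; rewrite normr0 mulr_ge0// ltW.
have mq : measurable_fun dom q.
  apply: measurable_funM => //; apply: open_continuous_measurable_fun; first exact: interval_open.
  move=> x; rewrite inE => /sn1_gt0/andP[s0 _].
  by apply: cvgV; [rewrite gt_eqF|exact: sn_continuous].
have [T hT TE] := cpoly_dense_bounded mq qb e4.
have hTs : sqint L T by apply: sqint_cont; exact: (cpoly_continuous hT).
have hTsn : sqint L (fun x => T x * sn L 1 x).
  by apply: sqint_cont; apply: contM; [exact: (cpoly_continuous hT)|exact: sn_continuous].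
exists (fun x => T x * sn L 1 x); first exact: pars_cpoly_sn.
have hq := sqint_bounded mq qb.
have hfns : sqint L fn.
  apply: (sqint_bounded mfn (M := n%:R)) => x dx; have /andP[s0 s1] := sn1_gt0 dx.
  rewrite /fn; case: ifP => [h|_]; last by rewrite normr0.
  by apply: le_trans h _; rewrite -[leRHS]mulr1; apply: ler_wpM2l.
have h1 := sqintB hf hfns; have h2 := sqintB hfns hTsn.
have E2 : ip (fun x => fn x - T x * sn L 1 x) (fun x => fn x - T x * sn L 1 x) <= e / 4.
  apply: le_trans TE; apply: le_Rintegral => //; [exact: sqint_mul|by apply: sqint_mul; exact: sqintB|].
  move=> x dx; have /andP[s0 s1] := sn1_gt0 dx.
  have -> : fn x = q x * sn L 1 x by rewrite /q divfK// gt_eqF.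
  have -> : (q x * sn L 1 x - T x * sn L 1 x) * (q x * sn L 1 x - T x * sn L 1 x) =
    (q x - T x) ^+ 2 * sn L 1 x ^+ 2 by ring.
  rewrite -expr2 -[leRHS]mulr1; apply: ler_wpM2l; first exact: sqr_ge0.
  by rewrite exprn_ile1// ltW.
have -> : (fun x => f x - T x * sn L 1 x) = (fun x => (f x - fn x) + (fn x - T x * sn L 1 x)).
  by apply/funext => x; ring.
have := dotL2_ge0 L (fun x => (f x - fn x) - (fn x - T x * sn L 1 x)).
by rewrite (dotL2_sqrB h1 h2) (dotL2_sqrD h1 h2) => h0; exact: quarters h0 hfn E2.
Qed.

End Density.

(** * A smooth step *)

Section SmoothFunctions.
Context {R : realType}.

Lemma derV (f : R -> R) (x a : R) : der f x a -> f x != 0 ->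
  der (fun y => (f y)^-1) x (- (f x) ^- 2 * a).
Proof. by move=> fa fx; exact: (is_deriveV fx fa). Qed.

(** The functions through which the derivatives of exp(-1/x) are expressed, see [der_flat]. *)
Definition flat (n : nat) (x : R) : R := if 0 < x then expR (- x^-1) * (x^-1) ^+ n else 0.

Lemma flat_ge0 n x : 0 <= flat n x.
Proof.
by rewrite /flat; case: ifP => // x0; rewrite mulr_ge0 ?expR_ge0// exprn_ge0// invr_ge0 ltW.
Qed.

(** The exponential series gives exp(1/x) >= x^-(n+1) / (n+1)!. *)
Lemma flat_le n x : 0 <= x -> flat n x <= n.+1`!%:R * x.
Proof.
move=> x0; rewrite /flat; case: ifP => [xp|_]; last by rewrite mulr_ge0.
have f0 : 0 < n.+1`!%:R :> R by rewrite ltr0n fact_gt0.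
have x0' : 0 <= x^-1 by rewrite invr_ge0.
have h : x^-1 ^+ n.+1 / n.+1`!%:R <= expR x^-1.
  by apply: le_trans (expR_ge1Dxn n x0'); rewrite lerDr.
rewrite expRN mulrC ler_pdivrMr ?expR_gt0//.
apply: le_trans (ler_wpM2l _ h); last by rewrite mulr_ge0// ltW.
rewrite exprS [leRHS](_ : _ = (x * x^-1) * x^-1 ^+ n * (n.+1`!%:R * n.+1`!%:R^-1)); last by ring.
by rewrite !divff ?gt_eqF// mul1r mulr1.
Qed.

Lemma der_flat n (x : R) : der (flat n) x (flat n.+2 x - n%:R * flat n.+1 x).
Proof.
have [x0|x0|->] := ltgtP x 0.
- have -> : flat n.+2 x - n%:R * flat n.+1 x = 0.
    by rewrite /flat ltNge (ltW x0) /= mulr0 subrr.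
  apply: der_near (derC x 0); near=> y; rewrite /flat ifF//.
  by apply/negbTE; rewrite -leNgt; near: y; exact: near_le.
- have dinv : der (fun y : R => y^-1) x (- x^-1 ^+ 2).
    apply: der_eq; first by apply: (derV (derI x)); rewrite gt_eqF.
    by rewrite mulr1 exprVn.
  have dexp : der (fun y : R => expR (- y^-1)) x (expR (- x^-1) * x^-1 ^+ 2).
    apply: der_eq; first exact: (der_comp (derN dinv) (is_derive_expR _ : der expR _ _)).
    by rewrite opprK.
  have dpow m : der (fun y : R => (y^-1) ^+ m) x (- (m%:R * x^-1 ^+ m.+1)).
    elim: m => [|m IH]; first by rewrite mul0r oppr0; exact: derC.
    have -> : (fun y : R => y^-1 ^+ m.+1) = (fun y => y^-1 * y^-1 ^+ m) by apply/funext => y; rewrite exprS.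
    apply: der_eq; first exact: derM dinv IH.
    by rewrite -natr1 !exprS; ring.
  apply: (@der_near _ x (fun y => expR (- y^-1) * (y^-1) ^+ n)).
    near=> y; rewrite /flat ifT//; near: y; exact: lt_nbhsr.
  apply: der_eq; first exact: derM dexp (dpow n).
  by rewrite /flat x0 !exprS; ring.
- have -> : flat n.+2 0 - n%:R * flat n.+1 0 = 0 by rewrite /flat ltxx mulr0 subrr.
  suff h : h^-1 *: (flat n (h *: (1 : R) + 0) - flat n 0) @[h --> (0 : R)^'] --> (0 : R).
    by apply: DeriveDef; [apply/cvg_ex; exists 0|apply/cvg_lim].
  have -> : flat n 0 = 0 by rewrite /flat ltxx.
  apply: (@cvg_trans _ (flat n.+1 h @[h --> (0 : R)^'])).
    apply: near_eq_cvg; near=> h.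
    rewrite subr0 addr0 /GRing.scale /= mulr1 /flat; case: ifP => _; last by rewrite mulr0.
    by rewrite exprS; ring.
  apply/cvgr0Pnorm_le => e e0.
  pose c : R := n.+2`!%:R; have c0 : 0 < c by rewrite ltr0n fact_gt0.
  near=> h; rewrite ger0_norm ?flat_ge0//.
  have [hp|hn] := ltP 0 h; last by rewrite /flat ltNge hn ltW.
  apply: le_trans (flat_le _ (ltW hp)) _; rewrite -/c mulrC -ler_pdivlMr//.
  apply: le_trans (ler_norm _) _; near: h; apply: dnbhs0_le; exact: divr_gt0.
Unshelve. all: by end_near. Qed.

(** A family of functions closed under differentiation: hence smooth. *)
Inductive smooth : (R -> R) -> Prop :=
| smooth_cst c : smooth (fun=> c)
| smooth_flat n a b : smooth (fun x => flat n (a * x + b))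
| smooth_sin a : smooth (fun x => sin (a * x))
| smooth_cos a : smooth (fun x => cos (a * x))
| smoothD f g : smooth f -> smooth g -> smooth (fun x => f x + g x)
| smoothM f g : smooth f -> smooth g -> smooth (fun x => f x * g x)
| smoothV f : (forall x, f x != 0) -> smooth f -> smooth (fun x => (f x)^-1).

Lemma smooth_der f : smooth f -> exists2 f', smooth f' & forall x : R, der f x (f' x).
Proof.
have dlin (a b x : R) : der (fun y => a * y + b) x a.
  by apply: der_eq; [apply: derD (derZ _ (derI _)) (derC _ _)|rewrite mulr1 addr0].
have dlin0 (a x : R) : der (fun y => a * y) x a.
  by apply: der_eq; [apply: derZ (derI _)|rewrite mulr1].
elim=> {f}.
- by move=> c; exists (fun=> 0); [exact: smooth_cst|move=> x; exact: derC].
- move=> n a b; exists (fun x => (flat n.+2 (a * x + b) + - n%:R * flat n.+1 (a * x + b)) * a).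
    by do ?[exact: smooth_flat|exact: smooth_cst|apply: smoothM|apply: smoothD].
  move=> x; apply: der_eq; first exact: (der_comp (dlin a b x) (der_flat n _)).
  by rewrite mulNr.
- move=> a; exists (fun x => cos (a * x) * a).
    by apply: smoothM; [exact: smooth_cos|exact: smooth_cst].
  by move=> x; exact: (der_comp (dlin0 a x) (is_derive_sin _ : der sin _ _)).
- move=> a; exists (fun x => - a * sin (a * x)).
    by apply: smoothM; [exact: smooth_cst|exact: smooth_sin].
  move=> x; apply: der_eq; first exact: (der_comp (dlin0 a x) (is_derive_cos _ : der cos _ _)).
  by ring.
- move=> f g _ [f' sf df] _ [g' sg dg]; exists (fun x => f' x + g' x); first exact: smoothD.
  by move=> x; exact: derD.
- move=> f g sf0 [f' sf df] sg0 [g' sg dg]; exists (fun x => f' x * g x + f x * g' x).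
    by apply: smoothD; exact: smoothM.
  by move=> x; exact: derM.
- move=> f f0 sf0 [f' sf df]; exists (fun x => - 1 * ((f x)^-1 * (f x)^-1 * f' x)).
    by apply: smoothM; [exact: smooth_cst|apply: smoothM => //; apply: smoothM; exact: smoothV].
  move=> x; apply: der_eq; first exact: derV (df x) (f0 x).
  by field; exact: f0.
Qed.

Lemma der_derive1 (f f' : R -> R) : (forall x : R, der f x (f' x)) -> derive1 f = f'.
Proof. by move=> df; apply/funext => x; rewrite derive1E; have [_ ->] := df x. Qed.

Lemma smooth_derive1n f : smooth f -> forall n (x : R), derivable (derive1n n f) x 1.
Proof.
move=> sf n; have : smooth (derive1n n f).
  elim: n => [//|n IH]; rewrite derive1nS.
  by have [f' sf' /der_derive1 ->] := smooth_der IH.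
by move=> /smooth_der[f' _ df] x; have [] := df x.
Qed.

(** Smooth transition from 0 on ]-oo, 1] to 1 on [2, +oo[. *)
Definition step (x : R) := flat 0 (x - 1) * (flat 0 (x - 1) + flat 0 (2 - x))^-1.

Lemma flat0_gt0 x : 0 < x -> 0 < flat 0 x.
Proof. by move=> x0; rewrite /flat x0 expr0 mulr1 expR_gt0. Qed.

Lemma step_den x : 0 < flat 0 (x - 1) + flat 0 (2 - x).
Proof.
have [x1|x1] := ltP 1 x.
  by apply: ltr_wpDr; [exact: flat_ge0|apply: flat0_gt0; rewrite subr_gt0].
by apply: ltr_wpDl; [exact: flat_ge0|apply: flat0_gt0; lra].
Qed.

Lemma step0 x : x <= 1 -> step x = 0.
Proof. by move=> x1; rewrite /step /flat subr_gt0 ltNge x1 mul0r. Qed.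

Lemma step1 x : 2 <= x -> step x = 1.
Proof.
move=> x2; rewrite /step; have -> : flat 0 (2 - x) = 0 by rewrite /flat subr_gt0 ltNge x2.
by rewrite addr0 divff// gt_eqF// flat0_gt0//; lra.
Qed.

Lemma step01 x : 0 <= step x <= 1.
Proof.
rewrite /step divr_ge0 ?flat_ge0 ?(ltW (step_den _))//= ler_pdivrMr ?step_den// mul1r.
by rewrite lerDl flat_ge0.
Qed.

Lemma smooth_step a b : smooth (fun x => step (a * x + b)).
Proof.
have h1 : smooth (fun x => flat 0 (a * x + b - 1)).
  by have := smooth_flat 0 a (b - 1); congr smooth; apply/funext => x; rewrite addrA.
have h2 : smooth (fun x => flat 0 (2 - (a * x + b))).
  by have := smooth_flat 0 (- a) (2 - b); congr smooth; apply/funext => x; congr flat; ring.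
apply: smoothM => //; apply: smoothV; last exact: smoothD.
by move=> x; rewrite gt_eqF// step_den.
Qed.

Lemma step_der : exists (step' : R -> R) (C : R), [/\ 0 <= C, forall x : R, der step x (step' x),
  continuous step', forall x, `|step' x| <= C & forall x, ~~ (1 <= x <= 2) -> step' x = 0].
Proof.
have : smooth step by have := smooth_step 1 0; congr smooth; apply/funext => x; rewrite mul1r addr0.
move=> /smooth_der[s' ss ds]; have [s'' _ dss] := smooth_der ss.
have cs : continuous s' by move=> x; exact: der_cont (dss x).
have z x : ~~ (1 <= x <= 2) -> s' x = 0.
  rewrite negb_and -!ltNge => /orP[x1|x2]; have [_ <-] := ds x.
  - have [_ <-] : der step x 0; last by [].
    apply: der_near (derC x 0); near=> y; rewrite step0//.
    by near: y; exact: near_le.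
  - have [_ <-] : der step x 0; last by [].
    apply: der_near (derC x 1); near=> y; rewrite step1//.
    by near: y; exact: near_ge.
have [C C0 hC] := cont_bnd 1 2 cs; exists s', C; split => // x.
have [/andP[x1 x2]|nx] := boolP (1 <= x <= 2); first exact: hC.
by rewrite z// normr0.
Unshelve. all: by end_near. Qed.

End SmoothFunctions.

(** * Sines and cosines as test functions *)

Section TrigonometricTests.
Context {R : realType}.
Variable L : R.
Hypothesis L_gt0 : 0 < L.
Local Notation mu := (@lebesgue_measure R).
Local Notation dom := (dom L).
Local Notation ip := (dotL2 L).
Let md := mdom L.

Lemma test_der (eta : R -> R) : test_function L eta ->
  [/\ forall x : R, der eta x (derive1 eta x), continuous (derive1 eta), continuous eta,
      eta 0 = 0 & eta L = 0].
Proof.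
move=> [d [a [b [a0 bL z]]]].
have d0 (x : R) : der eta x (derive1 eta x).
  by have := d 0%N x; rewrite derive1n0 => h; apply: DeriveDef => //; rewrite derive1E.
have c1 : continuous (derive1 eta).
  move=> x; have := d 1%N x; rewrite derive1n1 => /derivable1_diffP h.
  exact: differentiable_continuous.
split => //; first by move=> x; exact: der_cont (d0 x).
- by apply: z; rewrite negb_and -!ltNge a0.
- by apply: z; rewrite negb_and -!ltNge bL orbT.
Qed.

Lemma ibp_test (v v' eta : R -> R) : (forall x : R, der v x (v' x)) -> continuous v' ->
  test_function L eta -> ip v (derive1 eta) = - ip v' eta.
Proof.
move=> dv cv' /test_der[de cde ce e0 eL].
have cv : continuous v by move=> x; exact: der_cont (dv x).
have h : \int[mu]_(x in dom) (v' x * eta x + v x * derive1 eta x) = 0.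
  rewrite (dom_ftc L_gt0 (F := fun x => v x * eta x)) ?eL ?e0 ?mulr0 ?subrr//.
    by move=> x; exact: derM.
  by apply: contD; exact: contM.
have s1 := sqint_cont L cv; have s2 := sqint_cont L cv'.
have s3 := sqint_cont L ce; have s4 := sqint_cont L cde.
move: h; rewrite RintegralD//; [|exact: sqint_mul|exact: sqint_mul].
by rewrite /dotL2; lra.
Qed.

Lemma H1_C1 (v v' : R -> R) : (forall x : R, der v x (v' x)) -> continuous v' -> H1 L v v'.
Proof.
move=> dv cv'; have cv : continuous v by move=> x; exact: der_cont (dv x).
split; [exact/sqint_inL2/sqint_cont|exact/sqint_inL2/sqint_cont|].
by move=> eta ht; exact: ibp_test.
Qed.

Definition dcs k (x : R) := - freq L k * sn L k x.
Definition dsn k (x : R) := freq L k * cs L k x.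

Lemma dcs_continuous k : continuous (dcs k). Proof. by apply: contZ; exact: sn_continuous. Qed.
Lemma dsn_continuous k : continuous (dsn k). Proof. by apply: contZ; exact: cs_continuous. Qed.

Lemma H1_cs k : H1 L (cs L k) (dcs k).
Proof. by apply: H1_C1; [exact: der_cs|exact: dcs_continuous]. Qed.

(* zero up to the distance d from the ends, equal to the sine from 2 d on *)
Let cut k d (x : R) := sn L k x * (step (d^-1 * x + 0) * step (- d^-1 * x + L / d)).

Let cut_test k d : 0 < d -> d < L / 4 -> test_function L (cut k d).
Proof.
move=> d0 dL; split.
  apply: smooth_derive1n; apply: smoothM; first exact: smooth_sin.
  by apply: smoothM; exact: smooth_step.
exists d, (L - d); split => //; first by rewrite gtrBl.
move=> x; rewrite negb_and -!ltNge /cut => /orP[xd|xd].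
  rewrite (step0 (x := _ * x + 0)) ?mul0r ?mulr0// addr0 ler_pdivrMl// mulr1; exact: ltW.
rewrite (step0 (x := _ * x + L / d)) ?mulr0//.
have -> : - d^-1 * x + L / d = (L - x) / d by ring.
by rewrite ler_pdivrMr// mul1r; lra.
Qed.

Lemma sn_small k (x : R) : 0 <= x -> `|sn L k x| <= freq L k * x.
Proof.
move=> x0; have f0 : 0 <= freq L k by rewrite mulr_ge0// divr_ge0 ?pi_ge0 ?ltW.
have key (s : R) : `|s| <= 1 -> (forall y : R, 0 <= y -> y <= x -> s * dsn k y <= freq L k) -> s * sn L k x <= freq L k * x.
  move=> s1 hs; pose D y := s * sn L k y - freq L k * y.
  suff : D x <= D 0 by rewrite /D sn_0 !mulr0 subrr subr_le0.
  have dD (y : R) : der D y (s * dsn k y - freq L k).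
    by apply: derB; [apply: derZ; exact: der_sn|exact: der_lin].
  apply: (@der_le0_ge _ D (fun y => s * dsn k y - freq L k)) => //.
    by apply: cont_within => y _; exact: der_cont (dD y).
  by move=> y /ltW y0 /ltW yx; split; [exact: dD|rewrite subr_le0; exact: hs].
have b (y : R) : - freq L k <= dsn k y <= freq L k.
  have /andP[c1 c2] := cs_bound L k y.
  rewrite /dsn; apply/andP; split.
    by rewrite -[leLHS]mulr1 mulNr -mulrN; exact: ler_wpM2l.
  by rewrite -[leRHS]mulr1; exact: ler_wpM2l.
rewrite ler_norml; apply/andP; split.
  rewrite lerNl -mulN1r; apply: key; first by rewrite normrN normr1.
  by move=> y _ _; rewrite mulN1r lerNl; have /andP[] := b y.
rewrite -[leLHS]mul1r; apply: key; first by rewrite normr1.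
by move=> y _ _; rewrite mul1r; have /andP[] := b y.
Qed.

Lemma cos_natpi k : `|cos (k%:R * pi) : R| = 1.
Proof.
elim: k => [|k IH]; first by rewrite mul0r cos0 normr1.
by rewrite -addn1 natrD mulrDl mul1r cosDpi normrN.
Qed.

Lemma sn_reflect k x : `|sn L k (L - x)| = `|sn L k x|.
Proof.
rewrite /sn mulrBr freqL// sinB sin_natpi mul0r sub0r normrN normrM.
by rewrite cos_natpi mul1r.
Qed.

(** A sine vanishes at both ends, so that cutting it off at distance d from them
    costs O(d) in the square of the H^1 norm: the slope 1/d of the cut-off meets
    values O(d) of the sine. *)
Lemma sn_approx k (e : R) : 0 < e -> exists2 eta, test_function L eta &
  ip (fun x => sn L k x - eta x) (fun x => sn L k x - eta x) <= e /\
  ip (fun x => dsn k x - derive1 eta x) (fun x => dsn k x - derive1 eta x) <= e.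
Proof.
move=> e0; have [s' [C [C0 ds cs' hC zs]]] := @step_der R.
pose d (n : nat) : R := L / n.+1%:R / 8.
have d0 n : 0 < d n by rewrite !divr_gt0// ltr0n.
have dL n : d n < L / 4.
  have n1 : 1 <= n.+1%:R :> R by rewrite ler1n.
  have : L / n.+1%:R <= L by rewrite ler_pdivrMr ?ltr0n// ler_peMr// ltW.
  by rewrite /d; move: (L / _) L_gt0 => q; lra.
pose c n := cut k (d n).
pose c' n x := dsn k x * (step ((d n)^-1 * x + 0) * step (- (d n)^-1 * x + L / d n)) +
  sn L k x * ((s' ((d n)^-1 * x + 0) * (d n)^-1) * step (- (d n)^-1 * x + L / d n)
     + step ((d n)^-1 * x + 0) * (s' (- (d n)^-1 * x + L / d n) * - (d n)^-1)).
have dlin (a b x : R) : der (fun y => a * y + b) x a.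
  by apply: der_eq; [apply: derD (derZ _ (derI _)) (derC _ _)|rewrite mulr1 addr0].
have dc n (x : R) : der (c n) x (c' n x).
  apply: der_eq.
    apply: derM; first exact: der_sn.
    by apply: derM; [exact: (der_comp (dlin _ _ x) (ds _))|exact: (der_comp (dlin _ _ x) (ds _))].
  by rewrite /c' /dsn.
have c'E n : derive1 (c n) = c' n by apply: der_derive1; exact: dc.
have ht n : test_function L (c n) by exact: cut_test.
pose M := freq L k + 8 * (freq L k * C).
have f0 : 0 <= freq L k by rewrite mulr_ge0// divr_ge0 ?pi_ge0 ?ltW.
have M0 : 0 <= M by rewrite /M; pos.
(* uniform bounds for the two terms in which the cut-off is differentiated *)
have b1 n x : dom x -> `|sn L k x * (s' ((d n)^-1 * x + 0) * (d n)^-1)| <= 2 * (freq L k * C).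
  rewrite /dom /= in_itv /= => /andP[x0 xL]; rewrite addr0.
  have [/andP[x1 x2]|nx] := boolP (1 <= (d n)^-1 * x <= 2); last first.
    by rewrite zs// mul0r mulr0 normr0; pos.
  rewrite mulrA normrM normrM [X in _ * X]ger0_norm ?invr_ge0 ?(ltW (d0 n))// ler_pdivrMr//.
  apply: (@le_trans _ _ ((freq L k * (2 * d n)) * C)); last first.
    by rewrite le_eqVlt; apply/orP; left; apply/eqP; ring.
  apply: ler_pM => //; apply: le_trans (sn_small k (ltW x0)) _.
  by apply: ler_wpM2l => //; rewrite -ler_pdivrMr// mulrC.
have b2 n x : dom x -> `|sn L k x * (s' (- (d n)^-1 * x + L / d n) * - (d n)^-1)| <= 2 * (freq L k * C).
  rewrite /dom /= in_itv /= => /andP[x0 xL].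
  have -> : - (d n)^-1 * x + L / d n = (d n)^-1 * (L - x) by ring.
  have [/andP[x1 x2]|nx] := boolP (1 <= (d n)^-1 * (L - x) <= 2); last first.
    by rewrite zs// mul0r mulr0 normr0; pos.
  rewrite mulrN normrM normrN normrM mulrA.
  rewrite [X in _ * X]ger0_norm ?invr_ge0 ?(ltW (d0 n))// ler_pdivrMr//.
  apply: (@le_trans _ _ ((freq L k * (2 * d n)) * C)); last first.
    by rewrite le_eqVlt; apply/orP; left; apply/eqP; ring.
  have Lx : 0 <= L - x by rewrite subr_ge0 ltW.
  apply: ler_pM => //; rewrite -sn_reflect; apply: le_trans (sn_small k Lx) _.
  by apply: ler_wpM2l => //; rewrite -ler_pdivrMr// mulrC.
have ev x : dom x -> exists N, forall n, (N <= n)%N -> c n x = sn L k x /\ c' n x = dsn k x.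
  rewrite /dom /= in_itv /= => /andP[x0 xL]; pose y := Num.min x (L - x).
  have y0 : 0 < y by rewrite lt_min x0 subr_gt0.
  exists (Num.bound (L / y)) => n Hn.
  have dy : 4 * d n < y.
    have : L / y < n.+1%:R.
      apply: lt_le_trans (archi_boundP _) _; first by rewrite divr_ge0 ?ltW.
      by rewrite ler_nat; exact: leqW.
    rewrite ltr_pdivrMr// => h; rewrite /d; have n0 : 0 < n.+1%:R :> R by rewrite ltr0n.
    have : L / n.+1%:R < y by rewrite ltr_pdivrMr// mulrC.
    by move: (L / _) y0 => q; lra.
  have [yx yL] : y <= x /\ y <= L - x by rewrite !ge_min !lexx orbT.
  have h1 : 2 < (d n)^-1 * x + 0 by rewrite addr0 mulrC ltr_pdivlMr//; have := d0 n; lra.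
  have h2 : 2 < - (d n)^-1 * x + L / d n.
    have -> : - (d n)^-1 * x + L / d n = (L - x) / d n by ring.
    by rewrite ltr_pdivlMr//; have := d0 n; lra.
  have z1 : s' ((d n)^-1 * x + 0) = 0 by apply: zs; rewrite negb_and -!ltNge h1 orbT.
  have z2 : s' (- (d n)^-1 * x + L / d n) = 0 by apply: zs; rewrite negb_and -!ltNge h2 orbT.
  by rewrite /c /cut /c' z1 z2 !(step1 (ltW h1)) !(step1 (ltW h2)); split; ring.
have cont_c n : continuous (c n) by move=> x; exact: der_cont (dc n x).
have cont_c' n : continuous (c' n) by have [_ + _ _ _] := test_der (ht n); rewrite c'E.
pose u n x := (sn L k x - c n x) ^+ 2 + (dsn k x - c' n x) ^+ 2.
have st n x : 0 <= step ((d n)^-1 * x + 0) * step (- (d n)^-1 * x + L / d n) <= 1.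
  have /andP[a1 a2] := step01 ((d n)^-1 * x + 0); have /andP[a3 a4] := step01 (- (d n)^-1 * x + L / d n).
  by rewrite mulr_ge0//= mulr_ile1.
have b0 n x : `|sn L k x - c n x| <= 1.
  rewrite /c /cut -{1}[sn L k x]mulr1 -mulrBr normrM.
  have /andP[s0 s1] := st n x.
  rewrite mulr_ile1//; last by rewrite ger0_norm; lra.
  by rewrite ler_norml /sn sin_geN1 sin_le1.
have b3 n x : dom x -> `|dsn k x - c' n x| <= M.
  move=> dx; have /andP[s0 s1] := st n x.
  set s := step _ * step _ in s0 s1.
  have -> : dsn k x - c' n x = dsn k x * (1 - s)
    - sn L k x * (s' ((d n)^-1 * x + 0) * (d n)^-1) * step (- (d n)^-1 * x + L / d n)
    - sn L k x * (s' (- (d n)^-1 * x + L / d n) * - (d n)^-1) * step ((d n)^-1 * x + 0).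
    by rewrite /c' /s; ring.
  have t1 : `|dsn k x * (1 - s)| <= freq L k.
    rewrite normrM -[leRHS]mulr1; apply: ler_pM => //; last by rewrite ger0_norm; lra.
    rewrite /dsn normrM ger0_norm// -[leRHS]mulr1; apply: ler_wpM2l => //.
    by rewrite ler_norml cs_bound.
  have t2 (a b : R) : `|a| <= 2 * (freq L k * C) -> 0 <= b <= 1 -> `|a * b| <= 2 * (freq L k * C).
    move=> ha /andP[hb0 hb1]; rewrite normrM -[leRHS]mulr1; apply: ler_pM => //.
    by rewrite ger0_norm.
  have t3 := t2 _ _ (b1 n x dx) (step01 (- (d n)^-1 * x + L / d n)).
  have t4 := t2 _ _ (b2 n x dx) (step01 ((d n)^-1 * x + 0)).
  apply: le_trans (ler_normB _ _) _; apply: le_trans (lerD (ler_normB _ _) (lexx _)) _.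
  have fC : 0 <= freq L k * C by pos.
  by rewrite /M; lra.
have [||||n hn] := @dct_small R L u (fun=> 1 + M ^+ 2) _ _ _ _ e e0.
- move=> n; apply: measurable_funTS; apply: continuous_measurable_fun.
  by apply: contD; apply: contX2; apply: contB => //; [exact: sn_continuous|exact: dsn_continuous].
- apply: (integrableS _ _ _ (continuous_itv_integrable 0 L (@cont_cst _ (1 + M ^+ 2)))) => //.
  exact: subset_itvW.
- move=> n x dx; rewrite ger0_norm ?addr_ge0 ?sqr_ge0// /u; apply: lerD.
    by rewrite -real_normK ?num_real// exprn_ile1.
  by rewrite -real_normK ?num_real//; apply: lerXn2r; rewrite ?nnegrE// b3.
- move=> x dx; have [N HN] := ev x dx; apply: cvg_near_cst; exists N => // n /= Nn.
  by have [e1 e2] := HN n Nn; rewrite /u e1 e2 !subrr expr0n addr0.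
exists (c n); first exact: ht.
rewrite c'E.
have s1 : sqint L (fun x => sn L k x - c n x) by apply: sqint_cont; apply: contB => //; exact: sn_continuous.
have s2 : sqint L (fun x => dsn k x - c' n x) by apply: sqint_cont; apply: contB => //; exact: dsn_continuous.
have h3 : ip (fun x => sn L k x - c n x) (fun x => sn L k x - c n x) +
    ip (fun x => dsn k x - c' n x) (fun x => dsn k x - c' n x) <= e.
  by move: hn; rewrite /u RintegralD//; [exact: s1.2|exact: s2.2].
have := dotL2_ge0 L (fun x => sn L k x - c n x); have := dotL2_ge0 L (fun x => dsn k x - c' n x).
by move=> h1 h2; split; apply: le_trans h3; [exact: (ler_wpDr h1)|exact: (ler_wpDl h2)].
Qed.

Lemma normL2_lt (v : R -> R) (e : R) : sqint L v -> 0 < e -> ip v v <= (e / 2) ^+ 2 -> normL2 L v < e.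
Proof.
move=> hv e0 h; apply: (@le_lt_trans _ _ (e / 2)); last by rewrite ltr_pdivrMr// ltr_pMr// ltr1n.
rewrite -(@ler_pXn2r _ 2)// ?nnegrE ?normL2_ge0 ?divr_ge0 ?(ltW e0)//.
by rewrite normL2_sqr.
Qed.

Lemma H10_sn k : H10 L (sn L k) (dsn k).
Proof.
split; first by apply: H1_C1; [exact: der_sn|exact: dsn_continuous].
move=> e e0; have e2 : 0 < (e / 2) ^+ 2 by rewrite exprn_gt0// divr_gt0.
have [eta ht [h1 h2]] := sn_approx k e2; exists eta => //.
have [_ ce' ce _ _] := test_der ht.
split; apply: normL2_lt => //; apply: sqint_cont; apply: contB => //.
  exact: sn_continuous.
exact: dsn_continuous.
Qed.

Lemma small_eq0 (a C : R) : 0 <= C -> (forall e : R, 0 < e -> `|a| <= C * e) -> a = 0.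
Proof.
move=> C0 H; apply/eqP; rewrite -normr_eq0 eq_le normr_ge0 andbT.
apply/ler_addgt0Pr => e e0; rewrite add0r.
have C1 : 0 < C + 1 by rewrite ltr_wpDl.
apply: le_trans (H (e / (C + 1)) _) _; first by rewrite divr_gt0.
by rewrite mulrA ler_pdivrMr// mulrC; apply: ler_wpM2l; [exact: ltW|rewrite lerDl].
Qed.

(** Integration by parts without boundary term: here v is a limit of test functions. *)
Lemma H10_coef (v vx : R -> R) k : H10 L v vx -> ip vx (cs L k) = freq L k * ip v (sn L k).
Proof.
move=> [[hv hvx _] happ]; have sv := inL2_sqint hv; have svx := inL2_sqint hvx.
have scs := sqint_cs L k; have ssn := sqint_sn L k.
apply/eqP; rewrite -subr_eq0; apply/eqP.
apply: (@small_eq0 _ (normL2 L (cs L k) + `|freq L k| * normL2 L (sn L k))).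
  by rewrite addr_ge0 ?mulr_ge0 ?normL2_ge0.
move=> e e0; have [eta ht [h1 h2]] := happ e e0.
have [_ ce' ce _ _] := test_der ht.
have se := sqint_cont L ce; have se' := sqint_cont L ce'.
have E : ip (derive1 eta) (cs L k) = freq L k * ip eta (sn L k).
  rewrite dotL2C (ibp_test (@der_cs _ L k) (@dcs_continuous k) ht) dotL2Zl// (dotL2C _ eta).
  by rewrite mulNr opprK.
have -> : ip vx (cs L k) - freq L k * ip v (sn L k) =
  ip (fun x => vx x - derive1 eta x) (cs L k) - freq L k * ip (fun x => v x - eta x) (sn L k).
  by rewrite !dotL2Bl// E; ring.
apply: le_trans (ler_normB _ _) _; rewrite mulrDl; apply: lerD.
  apply: le_trans (cauchy_schwarz (sqintB svx se') scs) _.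
  by rewrite mulrC; apply: ler_wpM2l; [exact: normL2_ge0|exact: ltW].
rewrite normrM -mulrA; apply: ler_wpM2l => //.
apply: le_trans (cauchy_schwarz (sqintB sv se) ssn) _.
by rewrite mulrC; apply: ler_wpM2l; [exact: normL2_ge0|exact: ltW].
Qed.

(** Integration by parts without boundary term: here the sine is a limit of test
    functions, so that v need not vanish at the ends. *)
Lemma H1_coef (v vx : R -> R) k : H1 L v vx -> ip vx (sn L k) = - freq L k * ip v (cs L k).
Proof.
move=> [hv hvx hw]; have sv := inL2_sqint hv; have svx := inL2_sqint hvx.
have scs := sqint_cs L k; have ssn := sqint_sn L k.
have sdsn : sqint L (dsn k) by exact/sqint_cont/dsn_continuous.
apply/eqP; rewrite -subr_eq0; apply/eqP.
apply: (@small_eq0 _ (normL2 L vx + normL2 L v)); first by rewrite addr_ge0 ?normL2_ge0.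
move=> e e0; have [_ happ] := H10_sn k; have [eta ht [h1 h2]] := happ e e0.
have [_ ce' ce _ _] := test_der ht.
have se := sqint_cont L ce; have se' := sqint_cont L ce'.
have -> : ip vx (sn L k) - - freq L k * ip v (cs L k) =
  ip vx (fun x => sn L k x - eta x) + ip v (fun x => dsn k x - derive1 eta x).
  by rewrite !dotL2Br// (hw _ ht) dotL2Zr//; ring.
apply: le_trans (ler_normD _ _) _; rewrite mulrDl; apply: lerD.
  apply: le_trans (cauchy_schwarz svx (sqintB ssn se)) _.
  by apply: ler_wpM2l; [exact: normL2_ge0|exact: ltW].
apply: le_trans (cauchy_schwarz sv (sqintB sdsn se')) _.
by apply: ler_wpM2l; [exact: normL2_ge0|exact: ltW].
Qed.

End TrigonometricTests.

(** * Functions on the half-line *)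

Section HalfLineCalculus.
Context {R : realType}.
Implicit Types (f a : R -> R) (t : R).

Lemma der_quotient f t (b : R) : (forall e, 0 < e -> exists2 d, 0 < d & forall s, s != t ->
  `|s - t| < d -> `|hl_quotient f t s - b| <= e) -> der f t b.
Proof.
move=> H; suff h : h^-1 *: (f (h *: (1 : R) + t) - f t) @[h --> 0^'] --> b.
  apply: DeriveDef; first by apply/cvg_ex; exists b; exact: h.
  exact/cvg_lim.
apply/cvgrPdist_le => e /H[d d0 Hd]; rewrite near_withinE.
apply/nbhs_ballP; exists d => //= h; rewrite /ball/= sub0r normrN => hd h0.
have := Hd (h + t); rewrite addrK => /(_ _ hd); rewrite -subr_eq0 addrK => /(_ h0).
by rewrite /hl_quotient addrK distrC /GRing.scale/= mulr1.
Qed.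

Lemma hl_cvgP (T : (R -> R)) t (b : R) : 
  T s @[s --> within halfline t^'] --> b <->
  (forall e, 0 < e -> exists2 d, 0 < d & forall s, 0 <= s -> s != t -> `|s - t| < d -> `|T s - b| <= e).
Proof.
split.
  move=> /cvgrPdist_le H e /H /nbhs_ballP[d /= d0 Hd].
  exists d => // s s0 st sd; rewrite distrC; apply: (Hd s) => //=.
    by rewrite /ball/= distrC.
  by rewrite /halfline/= in_itv/= s0.
move=> H; apply/cvgrPdist_le => e /H[d d0 Hd].
apply/nbhs_ballP; exists d => //= s; rewrite /ball/= distrC => sd st.
by rewrite /halfline/= in_itv/= andbT => s0; rewrite distrC; exact: Hd.
Qed.

Lemma hl_cvg_contP (T : (R -> R)) t (b : R) : 
  T s @[s --> within halfline (nbhs t)] --> b <->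
  (forall e, 0 < e -> exists2 d, 0 < d & forall s, 0 <= s -> `|s - t| < d -> `|T s - b| <= e).
Proof.
split.
  move=> /cvgrPdist_le H e /H /nbhs_ballP[d /= d0 Hd].
  exists d => // s s0 sd; rewrite distrC; apply: (Hd s) => //=.
    by rewrite /ball/= distrC.
  by rewrite /halfline/= in_itv/= s0.
move=> H; apply/cvgrPdist_le => e /H[d d0 Hd].
apply/nbhs_ballP; exists d => //= s; rewrite /ball/= distrC => sd.
by rewrite /halfline/= in_itv/= andbT => s0; rewrite distrC; exact: Hd.
Qed.

Definition hl_der f (f' : R -> R) := forall t, 0 <= t ->
  hl_quotient f t s @[s --> within halfline t^'] --> f' t.

Lemma hl_derP f : (forall t, 0 <= t -> hl_derivable f t) -> hl_der f (hl_derive f).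
Proof. by move=> H t t0; exact: H. Qed.

Lemma hl_der_der f f' t : hl_der f f' -> 0 < t -> der f t (f' t).
Proof.
move=> H t0; apply: der_quotient => e e0.
have /hl_cvgP/(_ e e0)[d d0 Hd] := H t (ltW t0).
exists (Num.min d t); first by rewrite lt_min d0.
move=> s st; rewrite lt_min => /andP[sd]; rewrite ltr_norml => /andP[s0 _].
by apply: Hd => //; move: s0; lra.
Qed.

Definition hl_cont f := forall t, 0 <= t -> f s @[s --> within halfline (nbhs t)] --> f t.

(** Extension to the line by the value at 0, which keeps continuity. *)
Definition ext f t := f (Num.max t 0).

Lemma extE f t : 0 <= t -> ext f t = f t.
Proof. by move=> t0; rewrite /ext max_l. Qed.

Lemma der_ext f (b t : R) : 0 < t -> der f t b -> der (ext f) t b.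
Proof.
move=> t0; apply: der_near; near=> s; rewrite extE//; near: s; exact: near_ge.
Unshelve. all: by end_near.
Qed.

Lemma ext_continuous f : hl_cont f -> continuous (ext f).
Proof.
move=> H t; apply/cvgrPdist_le => e e0.
have m0 : 0 <= Num.max t 0 by rewrite le_max lexx orbT.
have /hl_cvg_contP/(_ e e0)[d d0 Hd] := H _ m0.
apply/nbhs_ballP; exists d => //= s; rewrite /ball/= distrC => sd.
rewrite distrC; apply: Hd; first by rewrite le_max lexx orbT.
by apply: le_lt_trans sd; rewrite !maxEle ler_norml; have [h1 h2] := (ler_norm (s - t), ler_norm (t - s));
  rewrite (distrC t s) in h2; case: (leP s 0) => s0; case: (leP t 0) => t0; apply/andP; split; lra.
Qed.

Lemma hl_der_cont f f' : hl_der f f' -> hl_cont f.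
Proof.
move=> H t t0; apply/hl_cvg_contP => e e0.
have /hl_cvgP/(_ 1 ltr01)[d d0 Hd] := H t t0.
pose M := `|f' t| + 1; have M0 : 0 < M by rewrite ltr_wpDl.
exists (Num.min d (e / M)); first by rewrite lt_min d0 divr_gt0.
move=> s s0; rewrite lt_min => /andP[sd se].
have [->|st] := eqVneq s t; first by rewrite subrr normr0 ltW.
have q : f s - f t = (s - t) * hl_quotient f t s.
  by rewrite /hl_quotient mulrA divff ?mul1r// subr_eq0.
rewrite q normrM; have : `|hl_quotient f t s| <= M.
  rewrite -[hl_quotient f t s](subrK (f' t)) addrC; apply: le_trans (ler_normD _ _) _.
  by rewrite lerD2l; exact: Hd.
move=> h; apply: (@le_trans _ _ (e / M * M)); last by rewrite divfK// gt_eqF.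
by apply: ler_pM => //; exact: ltW.
Qed.

(** Continuation by the tangent at 0, which keeps differentiability. *)
Definition ext1 a (a' : R -> R) t := if t < 0 then a 0 + a' 0 * t else a t.

Lemma ext1E a a' t : 0 <= t -> ext1 a a' t = a t.
Proof. by move=> t0; rewrite /ext1 ltNge t0. Qed.

Lemma der_ext1 a a' t : hl_der a a' -> der (ext1 a a') t (ext a' t).
Proof.
move=> H; have [t0|t0|t0] := ltgtP t 0.
- rewrite /ext max_r ?(ltW t0)//; apply: (@der_near _ _ (fun t => a 0 + a' 0 * t)).
    by near=> s; rewrite /ext1 ifT//; near: s; exact: lt_nbhsl.
  by apply: der_eq; [apply: derD (derC _ _) (derZ _ (derI _))|rewrite add0r mulr1].
- rewrite extE ?ltW//; apply: (@der_near _ _ a); last exact: hl_der_der.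
  by near=> s; rewrite ext1E//; near: s; exact: near_ge.
rewrite t0 extE//; apply: der_quotient => e e0.
have /hl_cvgP/(_ e e0)[d d0 Hd] := H 0 (lexx _).
exists d => // s s0 sd; have [sneg|spos] := ltP s 0.
  by rewrite /hl_quotient (ext1E _ _ (lexx _)) /ext1 sneg subr0 [a 0 + _]addrC addrK mulrC mulfK// subrr normr0 ltW.
by rewrite /hl_quotient !ext1E//; exact: Hd.
Unshelve. all: by end_near.
Qed.

Lemma hl_derive_le0 f f' t : hl_nonincreasing f -> hl_der f f' -> 0 < t -> f' t <= 0.
Proof.
move=> Hf H t0; have /hl_cvgP H' := H t (ltW t0).
apply/ler_addgt0Pr => e e0; rewrite add0r; have [d d0 Hd] := H' e e0.
pose s := t + d / 2; have ts : t < s by rewrite /s ltrDl divr_gt0.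
have := Hd s; rewrite gt_eqF// => /(_ _ isT).
rewrite {2}/s addrAC subrr add0r gtr0_norm ?divr_gt0// => /(_ _ _).
have s0 : 0 <= s by apply: ltW; exact: lt_trans ts.
have d2 : d / 2 < d by rewrite ltr_pdivrMr// ltr_pMr// ltr1n.
move=> /(_ s0 d2); rewrite ler_norml => /andP[h _].
have : hl_quotient f t s <= 0.
  rewrite /hl_quotient mulr_ge0_le0 ?invr_ge0 ?subr_ge0 ?subr_le0 ?(ltW ts)//.
  by apply: Hf => //; exact: ltW.
by lra.
Qed.

End HalfLineCalculus.

(** * The modes of a weak solution *)

Section CoefficientsInTime.
Context {R : realType}.
Variable L : R.
Local Notation ip := (dotL2 L).

Lemma coef_cont (u : R -> R -> R) e : sqint L e -> (forall t, 0 <= t -> sqint L (u t)) ->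
  contL2 L u -> hl_cont (fun t => ip (u t) e).
Proof.
move=> he hu cu t t0; apply/hl_cvg_contP => r r0.
have N0 : 0 < normL2 L e + 1 by rewrite ltr_wpDl ?normL2_ge0.
have /hl_cvg_contP/(_ (r / (normL2 L e + 1)))[|d d0 Hd] := cu t t0; first exact: divr_gt0.
exists d => // s s0 sd; have := Hd s s0 sd; rewrite subr0 ger0_norm ?normL2_ge0// => h.
rewrite -dotL2Bl//; try exact: hu.
apply: le_trans (cauchy_schwarz (sqintB (hu s s0) (hu t t0)) he) _.
apply: (@le_trans _ _ (r / (normL2 L e + 1) * (normL2 L e + 1))); last by rewrite divfK// gt_eqF.
by apply: ler_pM => //; rewrite ?normL2_ge0// lerDl.
Qed.

Lemma coef_der (u ut : R -> R -> R) e : sqint L e -> (forall t, 0 <= t -> sqint L (u t)) ->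
  (forall t, 0 <= t -> sqint L (ut t)) ->
  derivL2 L u ut -> hl_der (fun t => ip (u t) e) (fun t => ip (ut t) e).
Proof.
move=> he hu hut du t t0; apply/hl_cvgP => r r0.
have N0 : 0 < normL2 L e + 1 by rewrite ltr_wpDl ?normL2_ge0.
have /hl_cvgP/(_ (r / (normL2 L e + 1)))[|d d0 Hd] := du t t0; first exact: divr_gt0.
exists d => // s s0 st sd; have := Hd s s0 st sd; rewrite subr0 ger0_norm ?normL2_ge0// => h.
have h1 := sqintB (hu s s0) (hu t t0).
have h2 := sqintZ (s - t)^-1 h1.
have -> : hl_quotient (fun t => ip (u t) e) t s - ip (ut t) e =
  ip (fun x => (s - t)^-1 * (u s x - u t x) - ut t x) e.
  by rewrite /hl_quotient dotL2Bl//; [rewrite dotL2Zl// dotL2Bl//; exact: hu|exact: hut].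
apply: le_trans (cauchy_schwarz (sqintB h2 (hut t t0)) he) _.
apply: (@le_trans _ _ (r / (normL2 L e + 1) * (normL2 L e + 1))); last by rewrite divfK// gt_eqF.
by apply: ler_pM => //; rewrite ?normL2_ge0// lerDl.
Qed.

End CoefficientsInTime.

Section SolutionModes.
Context {R : realType}.
Variables (L rho1 rho2 k k2 l : R) (g : R -> R).
Hypothesis L_gt0 : 0 < L.
Hypothesis rho1_gt0 : 0 < rho1.
Hypothesis rho2_gt0 : 0 < rho2.
Hypothesis cg : continuous (ext g).
Local Notation mu := (@lebesgue_measure R).
Local Notation ip := (dotL2 L).
Local Notation sn' n := (sn L n.+1).
Local Notation cs' n := (cs L n.+1).

Section States.
Variables (phi phix psi psix w wx : R -> R).
Hypotheses (hphi : H10 L phi phix) (hpsi : H1s L psi psix) (hw : H1s L w wx).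

Let sphi : sqint L phi. Proof. by have [[/inL2_sqint]] := hphi. Qed.
Let sphix : sqint L phix. Proof. by have [[_ /inL2_sqint]] := hphi. Qed.
Let spsi : sqint L psi. Proof. by have [[/inL2_sqint]] := hpsi. Qed.
Let sw : sqint L w. Proof. by have [[/inL2_sqint]] := hw. Qed.
Let swx : sqint L wx. Proof. by have [[_ /inL2_sqint]] := hw. Qed.

Definition shear_of x := phix x + psi x + l * w x.
Definition axial_of x := wx x - l * phi x.

Lemma sqint_shear : sqint L shear_of.
Proof. by apply: sqintD; [exact: sqintD|exact: sqintZ]. Qed.

Lemma sqint_axial : sqint L axial_of.
Proof. by apply: sqintB => //; exact: sqintZ. Qed.

Lemma shear_coef n : ip shear_of (cs L n) =
  shr l (freq L n) (ip phi (sn L n)) (ip psi (cs L n)) (ip w (cs L n)).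
Proof.
have h := sqint_cs L n; have slw := sqintZ l sw; have sD := sqintD sphix spsi.
by rewrite /shear_of dotL2Dl// dotL2Dl// dotL2Zl// (H10_coef L_gt0 _ hphi).
Qed.

Lemma axial_coef n : ip axial_of (sn L n) =
  axl l (freq L n) (ip phi (sn L n)) (ip w (cs L n)).
Proof.
have h := sqint_sn L n; have slw := sqintZ l sphi; have [H _] := hw.
by rewrite /axial_of dotL2Bl// dotL2Zl// (H1_coef L_gt0 _ H).
Qed.

End States.

Definition mode_of (phi psi w : evolution R) n : mode R := Mode
  (ext1 (fun t => ip (phi t) (sn' n)) (fun t => ip (evol_t phi t) (sn' n)))
  (ext (fun t => ip (evol_t phi t) (sn' n)))
  (ext1 (fun t => ip (psi t) (cs' n)) (fun t => ip (evol_t psi t) (cs' n)))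
  (ext (fun t => ip (evol_t psi t) (cs' n)))
  (ext1 (fun t => ip (w t) (cs' n)) (fun t => ip (evol_t w t) (cs' n)))
  (ext (fun t => ip (evol_t w t) (cs' n))).

Lemma der_ext_half (f : R -> R) (t a r : R) : r != 0 -> 0 < t -> is_derive t (1 : R) (fun s => r * f s) a ->
  der (ext f) t (a / r).
Proof.
move=> r0 t0 H; apply: (@der_near _ _ f).
  by near=> s; rewrite extE//; near: s; exact: near_ge.
apply: der_eq; last by rewrite mulrC.
have -> : f = (fun s => r^-1 * (r * f s)) by apply/funext => s; rewrite mulKf.
exact: derZ.
Unshelve. all: by end_near. Qed.

Lemma regular_sqint_H10 (u : evolution R) (t : R) : regular L (H10 L) (inL2 L) u -> 0 <= t ->
  [/\ sqint L (u t), sqint L (evol_x u t) & sqint L (evol_t u t)].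
Proof.
move=> [h _ _ _ _] /h[[[/inL2_sqint h1 /inL2_sqint h2 _] _] /inL2_sqint h3].
by split.
Qed.

Lemma regular_sqint_H1s (u : evolution R) (t : R) : regular L (H1s L) (inL2s L) u -> 0 <= t ->
  [/\ sqint L (u t), sqint L (evol_x u t) & sqint L (evol_t u t)].
Proof.
move=> [h _ _ _ _] /h[[[/inL2_sqint h1 /inL2_sqint h2 _] _] [/inL2_sqint h3 _]].
by split.
Qed.

(** The weak equations are tested with a sine for phi and with cosines for psi and w;
    [axial_coef] and [shear_coef] express the forces through the coefficients. *)
Lemma mode_ofP phi0 phi1 psi0 psi1 w0 w1 phi psi w n :
  weak_solution L rho1 rho2 k k2 k l g phi0 phi1 psi0 psi1 w0 w1 phi psi w ->
  is_mode rho1 rho2 k k2 l (freq L n.+1) (ext g) (mode_of phi psi w n).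
Proof.
move=> W; have hphi := phi_regular W; have hpsi := psi_regular W; have hw := w_regular W.
have sphi (t : R) (t0 : 0 <= t) := regular_sqint_H10 hphi t0.
have spsi (t : R) (t0 : 0 <= t) := regular_sqint_H1s hpsi t0.
have sw (t : R) (t0 : 0 <= t) := regular_sqint_H1s hw t0.
have scs := sqint_cs L n.+1; have ssn := sqint_sn L n.+1.
have [Hphi cphi cphix dphi cphit] := hphi.
have [Hpsi cpsi cpsix dpsi cpsit] := hpsi.
have [Hw cw cwx dw cwt] := hw.
have da : hl_der (fun t => ip (phi t) (sn' n)) (fun t => ip (evol_t phi t) (sn' n)).
  by apply: coef_der => // t /sphi[].
have db : hl_der (fun t => ip (psi t) (cs' n)) (fun t => ip (evol_t psi t) (cs' n)).
  by apply: coef_der => // t /spsi[].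
have dc : hl_der (fun t => ip (w t) (cs' n)) (fun t => ip (evol_t w t) (cs' n)).
  by apply: coef_der => // t /sw[].
split.
- by move=> t; split; exact: der_ext1.
- by split; apply: ext_continuous; apply: coef_cont => // t; [move=> /sphi[]|move=> /spsi[]|move=> /sw[]].
pose N t := axl l (freq L n.+1) (ip (phi t) (sn' n)) (ip (w t) (cs' n)).
pose S t := shr l (freq L n.+1) (ip (phi t) (sn' n)) (ip (psi t) (cs' n)) (ip (w t) (cs' n)).
pose f := freq L n.+1.
exists (fun t => (- k * f * S t + l * k * N t) / rho1),
  (fun t => (- k2 * f ^+ 2 * ip (psi t) (cs' n) - k * S t + f ^+ 2 * conv (ext g) (ext1 (fun t => ip (psi t) (cs' n)) (fun t => ip (evol_t psi t) (cs' n))) t) / rho2),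
  (fun t => (k * f * N t - l * k * S t) / rho1).
move=> t t_gt0; have t0 := ltW t_gt0; rewrite /= !ext1E//.
have NE : ip (axial l phi w t) (sn' n) = N t.
  exact: axial_coef (Hphi t t0).1 (Hw t t0).1 _.
have SE : ip (shear l phi psi w t) (cs' n) = S t.
  exact: shear_coef (Hphi t t0).1 (Hpsi t t0).1 (Hw t t0).1 _.
have ssh : sqint L (shear l phi psi w t).
  exact: sqint_shear (Hphi t t0).1 (Hpsi t t0).1 (Hw t t0).1.
have sax : sqint L (axial l phi w t).
  exact: sqint_axial (Hphi t t0).1 (Hw t t0).1.
split; [split| | |]; last 3 first.
- by rewrite mulrC divfK// gt_eqF.
- by rewrite mulrC divfK// gt_eqF.
- by rewrite mulrC divfK// gt_eqF.
- apply: der_ext_half; rewrite ?gt_eqF//.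
  apply: der_eq; first exact: (phi_eq W (H10_sn L_gt0 n.+1) t_gt0).
  by rewrite NE /dsn dotL2Zr// SE -/f; ring.
- apply: der_ext_half; rewrite ?gt_eqF//.
  apply: der_eq; first exact: (psi_eq W (H1_cs L_gt0 n.+1) t_gt0).
  have xE s : 0 <= s -> ip (evol_x psi s) (dcs L n.+1) = f ^+ 2 * ip (psi s) (cs' n).
    move=> s0; have [_ s2 _] := spsi s s0.
    by rewrite /dcs dotL2Zr// (H1_coef L_gt0 _ (Hpsi s s0).1.1) -/f; ring.
  rewrite xE// SE; congr (_ + _); first by rewrite mulrA.
  set b := ext1 _ _.
  have cb : continuous b by move=> s; exact: der_cont (der_ext1 s db).
  rewrite /conv -integZ; last by apply: contM => //; apply: cont_comp cb; apply: contB; [exact: cont_cst|exact: cont_id].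
  rewrite -integ_reflect//; last first.
    apply: (@contZ _ (f ^+ 2)); apply: contM => //; apply: cont_comp cb; apply: contB; [exact: cont_cst|exact: cont_id].
  apply: eq_integ => s s0 st; rewrite xE// [t - (t - s)]subKr extE ?subr_ge0// /b ext1E//; ring.
apply: der_ext_half; rewrite ?gt_eqF//.
apply: der_eq; first exact: (w_eq W (H1_cs L_gt0 n.+1) t_gt0).
by rewrite SE /dcs dotL2Zr// NE -/f; ring.
Unshelve. all: by []. Qed.

End SolutionModes.

(** * Bounds by partial sums *)

Section ParsevalBounds.
Context {R : realType}.
Variable L : R.
Hypothesis L_gt0 : 0 < L.
Local Notation ip := (dotL2 L).

Lemma pars_le e nrm f (B : R) : pars L e nrm f ->
  (forall N, \sum_(k < N) (ip f (e k)) ^+ 2 / nrm k <= B) -> ip f f <= B.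
Proof.
move=> [_ hp] hB; apply/ler_addgt0Pr => r /hp[N /(_ N (leqnn N))].
by rewrite /remainder => h; have := hB N; lra.
Qed.

Let L2 : 0 < L / 2. Proof. by rewrite divr_gt0. Qed.
Let L2V : (L / 2)^-1 = 2 / L. Proof. by rewrite invf_div. Qed.

Lemma sn_le f B : sqint L f -> (forall N, \sum_(k < N) (ip f (sn L k.+1)) ^+ 2 <= B) ->
  ip f f <= 2 / L * B.
Proof.
move=> hf hB; apply: pars_le (parseval_sn L_gt0 hf) _ => N.
by rewrite -mulr_suml L2V mulrC; apply: ler_wpM2l => //; rewrite divr_ge0// ltW.
Qed.

Lemma cs_le f B : sqint L f -> ip f (cs L 0) = 0 ->
  (forall N, \sum_(k < N) (ip f (cs L k.+1)) ^+ 2 <= B) -> ip f f <= 2 / L * B.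
Proof.
move=> hf f0 hB; have c0 : 0 <= 2 / L by rewrite divr_ge0// ltW.
apply: pars_le (parseval_cs L_gt0 hf) _ => -[|N].
  by rewrite big_ord0 mulr_ge0//; have := hB 0%N; rewrite big_ord0.
rewrite big_ord_recl /= f0 expr0n mul0r add0r.
under eq_bigr do rewrite /nrmc /= L2V.
by rewrite -mulr_suml mulrC; apply: ler_wpM2l => //; exact: (hB N).
Qed.

Lemma sn_bessel f N : sqint L f -> \sum_(k < N) (ip f (sn L k.+1)) ^+ 2 <= L / 2 * ip f f.
Proof.
move=> hf; rewrite mulrC -ler_pdivrMr// mulr_suml.
exact: (bessel (fun k => sqint_sn L k.+1) (fun=> L2) (ortho_s L_gt0) N hf).
Qed.

Lemma cs_bessel f N : sqint L f -> \sum_(k < N) (ip f (cs L k.+1)) ^+ 2 <= L / 2 * ip f f.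
Proof.
move=> hf; rewrite mulrC -ler_pdivrMr// mulr_suml.
apply: le_trans (bessel (sqint_cs L) (nrmc_gt0 L_gt0) (ortho_c L_gt0) N.+1 hf).
by rewrite big_ord_recl lerDr divr_ge0 ?sqr_ge0// ltW// nrmc_gt0.
Qed.

End ParsevalBounds.

Section Memory.
Context {R : realType}.
Variable L : R.
Hypothesis L_gt0 : 0 < L.
Local Notation mu := (@lebesgue_measure R).
Local Notation ip := (dotL2 L).
Local Notation dom := (dom L).
Let md := mdom L.

Variables (g : R -> R) (v : R -> R -> R) (q : nat -> R -> R) (t M : R).
Hypothesis cg : continuous (ext g).
Hypothesis g_ge0 : forall s : R, 0 <= ext g s.
Hypothesis jm : jointly_measurable L v.
Hypothesis hv : forall s : R, 0 <= s -> sqint L (v s).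
Hypothesis cq : forall k, continuous (q k).
Hypothesis qE : forall k s, 0 <= s -> q k s = ip (v s) (sn L k.+1).
Hypothesis t_gt0 : 0 < t.
Hypothesis hM : forall N, integ (fun s => ext g s * \sum_(k < N) (q k t - q k (t - s)) ^+ 2) t <= M.

Let I : set R := `[0, t].
Let mI : measurable I. Proof. exact: measurable_itv. Qed.
Let IP s : I s -> 0 <= s /\ s <= t.
Proof. by rewrite /I /= in_itv /= => /andP. Qed.

Let F (z : measurableTypeR R * measurableTypeR R) : R := ext g (t - z.1) * (v t z.2 - v z.1 z.2) ^+ 2.
Let D : set (measurableTypeR R * measurableTypeR R) := I `*` dom.
Let mD : measurable D. Proof. exact: measurableX. Qed.

Let mF : measurable_fun D F.
Proof.
apply: measurable_funM.
  apply: (measurable_comp (F := setT) (g := fun z : measurableTypeR R * measurableTypeR R => t - z.1) (f := ext g : measurableTypeR R -> R)) => //.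
    exact: continuous_measurable_fun.
  by apply: measurable_funTS; apply: measurable_funB => //; exact: measurable_fst.
apply: measurable_funX; apply: measurable_funB.
  apply: (measurable_comp (F := dom) (g := fun z : measurableTypeR R * measurableTypeR R => z.2) (f := v t : measurableTypeR R -> R)) => //.
  - by move=> x [z [_ zd] <-].
  - by have [] := hv (ltW t_gt0).
  - by apply: measurable_funTS; exact: measurable_snd.
apply: measurable_funS jm; first by apply: measurableX => //; exact: measurable_itv.
by move=> z [/IP[z1 _] z2]; split => //; rewrite /halfline /= in_itv /= z1.
Qed.

Let Fe z : \bar R := ((EFin \o F) \_ D) z.
Let mFe : measurable_fun setT Fe.
Proof. by apply/(measurable_restrictT _ _).1 => //; exact/measurable_EFinP. Qed.

Let Fe_ge0 z : (0 <= Fe z)%E.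
Proof.
by apply: erestrict_ge0 => y _; rewrite lee_fin mulr_ge0 ?sqr_ge0.
Qed.

Let h s := ip (fun x => v t x - v s x) (fun x => v t x - v s x).
Let P N s := ext g (t - s) * (2 / L * \sum_(k < N) (q k t - q k s) ^+ 2).

Let FeE s x : I s -> dom x -> Fe (s, x) = (F (s, x))%:E.
Proof. by move=> h1 h2; rewrite /Fe patchT//; apply/mem_set. Qed.

Let Fe0 s x : ~ (I s /\ dom x) -> Fe (s, x) = 0%E.
Proof. by move=> nD; rewrite /Fe patchN//; apply/negP => /set_mem. Qed.

Let slice_x s : I s -> (\int[mu]_x Fe (s, x) = (ext g (t - s) * h s)%:E)%E.
Proof.
move=> Is; have [s0 st] := IP Is.
have [_ iq] := sqintB (hv (ltW t_gt0)) (hv s0).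
rewrite (_ : (\int[mu]_x Fe (s, x))%E = (\int[mu]_(x in dom) (F (s, x))%:E)%E); last first.
  rewrite [RHS]integral_mkcond; apply: eq_integral => x _; have [dx|dx] := pselect (dom x).
    by rewrite FeE// patchT//; apply/mem_set.
  by rewrite Fe0 ?patchN//; [apply/negP => /set_mem|case].
have iF : mu.-integrable dom (EFin \o (fun x => ext g (t - s) * (v t x - v s x) ^+ 2)).
  exact: integrable_mulR.
by rewrite /h /dotL2 -RintegralZl// /Rintegral fineK//; exact: integrable_fin_num.
Qed.

Let slice_x0 s : ~ I s -> (\int[mu]_x Fe (s, x) = 0)%E.
Proof.
by move=> nI; apply: integral0_eq => x _; apply: Fe0; case.
Qed.

Let slice_s x : dom x -> (\int[mu]_s Fe (s, x) = \int[mu]_(s in I) (g (t - s) * (v t x - v s x) ^+ 2)%:E)%E.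
Proof.
move=> dx; rewrite [RHS]integral_mkcond; apply: eq_integral => s _.
have [Is|nI] := pselect (I s); last by rewrite Fe0 ?patchN//; [apply/negP => /set_mem|case].
have [s0 st] := IP Is.
by rewrite FeE// patchT ?/F/= ?extE ?subr_ge0//; apply/mem_set.
Qed.

Let h_cvg s : I s -> P ^~ s @ \oo --> ext g (t - s) * h s.
Proof.
move=> Is; have [s0 st] := IP Is; have st0 := hv (ltW t_gt0); have ss0 := hv s0.
apply: cvgMr; have [_ hp] := parseval_sn L_gt0 (sqintB st0 ss0).
apply/cvgrPdist_le => e /hp[N0 H]; exists N0 => // N /= NN.
have -> : 2 / L * \sum_(k < N) (q k t - q k s) ^+ 2 = \sum_(k < N) (ip (fun x => v t x - v s x) (sn L k.+1)) ^+ 2 / (L / 2).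
  rewrite mulr_sumr; apply: eq_bigr => k _.
  by rewrite dotL2Bl ?qE ?(ltW t_gt0)//; [rewrite invf_div mulrC|exact: sqint_sn].
rewrite ger0_norm; first exact: H.
exact: (remainder_ge0 (fun k => sqint_sn L k.+1) (fun=> divr_gt0 L_gt0 (ltr0n _ 2)) (ortho_s L_gt0) N (sqintB st0 ss0)).
Qed.

Let cP N : continuous (P N).
Proof.
have ct : continuous (fun s : R => t - s) by apply: contB; [exact: cont_cst|exact: cont_id].
apply: contM; first exact: cont_comp ct cg.
apply: contZ; apply: (cont_sum (f := fun k s => (q k t - q k s) ^+ 2)) => k.
by apply: contX2; apply: contB => //; exact: cont_cst.
Qed.

Let P_ge0 N s : 0 <= P N s.
Proof. by rewrite !mulr_ge0 ?sumr_ge0 ?invr_ge0 ?(ltW L_gt0)// => k _; exact: sqr_ge0. Qed.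

Let P_mono s m n : (m <= n)%N -> P m s <= P n s.
Proof.
move=> mn; rewrite /P; apply: ler_wpM2l => //; apply: ler_wpM2l; first by rewrite divr_ge0// ltW.
have F0 (k : nat) : 0 <= (q k t - q k s) ^+ 2 by exact: sqr_ge0.
rewrite -!(big_mkord xpredT (fun k => (q k t - q k s) ^+ 2)) (@big_cat_nat _ _ _ m 0 n)//=.
by rewrite lerDl sumr_ge0.
Qed.

Let P_int N : (\int[mu]_(s in I) (P N s)%:E <= (2 / L * M)%:E)%E.
Proof.
have E : \int[mu]_(s in I) P N s <= 2 / L * M.
  have -> : \int[mu]_(s in I) P N s = 2 / L * integ (fun s => ext g s * \sum_(k < N) (q k t - q k (t - s)) ^+ 2) t.
    have ct : continuous (fun s : R => t - s) by apply: contB; [exact: cont_cst|exact: cont_id].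
    have cf : continuous (fun s => ext g s * \sum_(k < N) (q k t - q k (t - s)) ^+ 2).
      apply: contM => //; apply: (cont_sum (f := fun k s => (q k t - q k (t - s)) ^+ 2)) => k; apply: contX2; apply: (contB (@cont_cst _ _)) => //.
      exact: cont_comp ct (@cq k).
    rewrite -integZ// -/(integ _ _) -[LHS]integ_reflect ?(ltW t_gt0)//.
    apply: eq_integ => s s0 st; rewrite /P [t - (t - s)]subKr; ring.
  by apply: ler_wpM2l => //; rewrite divr_ge0// ltW.
have iP : mu.-integrable I (EFin \o P N) by exact: continuous_itv_integrable.
rewrite -[leLHS]fineK ?lee_fin//; apply: integrable_fin_num => //; exact: mI.
Qed.

(** Tonelli's theorem turns the memory into the integral in s of the squared norm of
    v t - v s, to which monotone convergence applies along the partial sums of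
    Parseval's identity.  Real integrals of infinite quantities are 0, hence only an
    inequality in the first step. *)
Lemma memory_le : memory L g v t <= 2 / L * M.
Proof.
have mI' := mI; have md' := md.
rewrite /memory /Rintegral -lee_fin.
pose G x := (\int[mu]_s Fe (s, x))%E.
have mG : measurable_fun [set: measurableTypeR R] (G : measurableTypeR R -> \bar R).
  exact: (measurable_fun_fubini_tonelli_G (m1 := mu) _ mFe Fe_ge0).
have G0 x : (0 <= G x)%E by apply: integral_ge0 => s _; exact: Fe_ge0.
have fine_le (X : \bar R) : (0 <= X)%E -> ((fine X)%:E <= X)%E.
  by case: X => [r| |]//= _; rewrite leey.
have mfG : measurable_fun dom (fun x => (fine (G x))%:E).
  by apply/measurable_EFinP; apply: measurable_funTS; apply: measurableT_comp mG.
have -> : (\int[mu]_(x in dom) (fine (\int[mu]_(s in I) (g (t - s) * (v t x - v s x) ^+ 2)%:E))%:E)%E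
   = (\int[mu]_(x in dom) (fine (G x))%:E)%E.
  by apply: eq_integral => x /set_mem dx; rewrite /G slice_s.
apply: le_trans (fine_le _ _) _.
  by apply: integral_ge0 => x _; rewrite lee_fin fine_ge0.
apply: (@le_trans _ _ (\int[mu]_(x in dom) G x)%E).
  apply: ge0_le_integral => //.
  - by move=> x _; rewrite lee_fin fine_ge0.
  - exact: measurable_funTS.
  - by move=> x _; exact: fine_le.
apply: (@le_trans _ _ (\int[mu]_x G x)%E).
  by apply: ge0_subset_integral.
rewrite /G -(fubini_tonelli (m1 := mu) (m2 := mu) _ mFe Fe_ge0).
rewrite (_ : (\int[mu]_x _)%E = (\int[mu]_(s in I) (limn (fun N => (P N s)%:E)))%E); last first.
  rewrite [RHS]integral_mkcond; apply: eq_integral => s _.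
  have [Is|nI] := pselect (I s); last by rewrite slice_x0 ?patchN//; apply/negP => /set_mem.
  rewrite slice_x// patchT; last by apply/mem_set.
  by apply/esym/cvg_lim => //; apply: cvg_EFin; [exact: nearW|exact: h_cvg].
rewrite monotone_convergence//.
- apply: lime_le; last by apply: nearW => N; exact: P_int.
  apply: ereal_nondecreasing_is_cvgn => m n mn; apply: ge0_le_integral => //.
  + by move=> s _; rewrite lee_fin.
  + by apply/measurable_EFinP; apply: measurable_funTS; apply: continuous_measurable_fun.
  + by apply/measurable_EFinP; apply: measurable_funTS; apply: continuous_measurable_fun.
  + by move=> s _; rewrite lee_fin; exact: P_mono.
- by move=> N; apply/measurable_EFinP; apply: measurable_funTS; apply: continuous_measurable_fun.
- by move=> N s _; rewrite lee_fin.
- by move=> s _ m n mn; rewrite lee_fin; exact: P_mono.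
Qed.

End Memory.

(** * The energy and its modes *)

Section EnergyOfModes.
Context {R : realType}.
Variables (L rho1 rho2 k k2 l kap : R) (g : R -> R).
Hypothesis L_gt0 : 0 < L.
Hypothesis rho1_gt0 : 0 < rho1.
Hypothesis rho2_gt0 : 0 < rho2.
Hypothesis k_gt0 : 0 < k.
Hypothesis k2_gt0 : 0 < k2.
Hypothesis kap_gt0 : 0 < kap.
Hypothesis cg : continuous (ext g).
Hypothesis g_ge0 : forall s : R, 0 <= ext g s.
Hypothesis G_le : forall t : R, 0 <= t -> kap <= k2 - integ (ext g) t.
Local Notation mu := (@lebesgue_measure R).
Local Notation ip := (dotL2 L).
Local Notation dom := (dom L).
Local Notation sn' n := (sn L n.+1).
Local Notation cs' n := (cs L n.+1).
Let md := mdom L.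

Lemma nrj_parts m a b c p q u G W2 : 0 <= k2 - G -> 0 <= W2 ->
  let E2 := 2 * nrj rho1 rho2 k k2 l m a b c p q u G W2 in
  [/\ [/\ rho1 * p ^+ 2 <= E2, rho2 * q ^+ 2 <= E2, rho1 * u ^+ 2 <= E2
        & (k2 - G) * (m * b) ^+ 2 <= E2],
      k * axl l m a c ^+ 2 <= E2, k * shr l m a b c ^+ 2 <= E2 & m ^+ 2 * W2 <= E2].
Proof.
move=> G0 W0 /=; rewrite /nrj mulrA divff// mul1r.
set A := axl _ _ _ _; set S := shr _ _ _ _ _.
have : 0 <= rho1 * p ^+ 2 by pos.
have : 0 <= rho2 * q ^+ 2 by pos.
have : 0 <= rho1 * u ^+ 2 by pos.
have : 0 <= (k2 - G) * (m * b) ^+ 2 by pos.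
have : 0 <= k * A ^+ 2 by pos.
have : 0 <= k * S ^+ 2 by pos.
have : 0 <= m ^+ 2 * W2 by pos.
by move=> *; repeat split; lra.
Qed.

Lemma eqL2_dot (u v e : R -> R) : sqint L u -> sqint L v -> sqint L e -> eqL2 L u v -> ip u e = ip v e.
Proof.
move=> hu hv he uv; have [mu_ _] := hu; have [mv_ _] := hv; have [me _] := he.
rewrite /dotL2 /Rintegral; congr fine; apply: ae_eq_integral => //.
- by apply/measurable_EFinP; exact: measurable_funM.
- by apply/measurable_EFinP; exact: measurable_funM.
case: uv => A [mA A0 sA]; exists A; split => // x nx; apply: sA => H; apply: nx => dx.
by rewrite /= H.
Qed.

Section Solution.
Variables (phi0 phi1 psi0 psi1 w0 w1 : R -> R) (phi psi w : evolution R).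
Hypothesis W : weak_solution L rho1 rho2 k k2 k l g phi0 phi1 psi0 psi1 w0 w1 phi psi w.

Definition modes_nrj N t := nrjs rho1 rho2 k k2 (ext g) l (fun i : 'I_N => freq L i.+1)
  (fun i : 'I_N => mode_of L phi psi w i) t.

Lemma modes_family N : family rho1 rho2 k k2 (pi / L) (ext g) l (fun i : 'I_N => freq L i.+1)
  (fun i : 'I_N => mode_of L phi psi w i).
Proof.
split=> i; last exact: mode_ofP W.
by rewrite /freq ler_peMl ?divr_ge0 ?pi_ge0 ?(ltW L_gt0)// ler1n.
Qed.

Let hphi := phi_regular W.
Let hpsi := psi_regular W.
Let hw := w_regular W.

Let sphi (t : R) (t0 : 0 <= t) := regular_sqint_H10 hphi t0.
Let spsi (t : R) (t0 : 0 <= t) := regular_sqint_H1s hpsi t0.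
Let sw (t : R) (t0 : 0 <= t) := regular_sqint_H1s hw t0.

Let Hphi (t : R) : 0 <= t -> H10 L (phi t) (evol_x phi t).
Proof. by move=> t0; have [h _ _ _ _] := hphi; exact: (h t t0).1. Qed.
Let Hpsi (t : R) : 0 <= t -> H1s L (psi t) (evol_x psi t).
Proof. by move=> t0; have [h _ _ _ _] := hpsi; exact: (h t t0).1. Qed.
Let Hw (t : R) : 0 <= t -> H1s L (w t) (evol_x w t).
Proof. by move=> t0; have [h _ _ _ _] := hw; exact: (h t t0).1. Qed.

Let ssh t : 0 <= t -> sqint L (shear l phi psi w t).
Proof. by move=> t0; exact: sqint_shear (Hphi t0) (Hpsi t0) (Hw t0). Qed.

Let sax t : 0 <= t -> sqint L (axial l phi w t).
Proof. by move=> t0; exact: sqint_axial (Hphi t0) (Hw t0). Qed.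

Let mean0_cs0 v : mean0 L v -> ip v (cs L 0) = 0.
Proof.
move=> h; rewrite -[RHS]h /dotL2; apply: eq_Rintegral => x _; by rewrite cs0 mulr1.
Qed.

Let coefs n t : 0 <= t -> let z := mode_of L phi psi w n in let f := freq L n.+1 in
  [/\ [/\ ma' z t = ip (evol_t phi t) (sn' n), mb' z t = ip (evol_t psi t) (cs' n)
        & mc' z t = ip (evol_t w t) (cs' n)],
      (f * mb z t) ^+ 2 = ip (evol_x psi t) (sn' n) ^+ 2,
      axl l f (ma z t) (mc z t) = ip (axial l phi w t) (sn' n)
    & shr l f (ma z t) (mb z t) (mc z t) = ip (shear l phi psi w t) (cs' n)].
Proof.
move=> t0; rewrite /= !extE// !ext1E//; split=> //.
- by rewrite (H1_coef L_gt0 _ (Hpsi t0).1) mulNr sqrrN.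
- exact/esym/(axial_coef l L_gt0 (Hphi t0) (Hw t0)).
- exact/esym/(shear_coef l L_gt0 (Hphi t0) (Hpsi t0) (Hw t0)).
Qed.

Let mode_der n (t : R) : der (mb (mode_of L phi psi w n)) t (mb' (mode_of L phi psi w n) t).
Proof. by have [h _ _] := mode_ofP L_gt0 rho1_gt0 rho2_gt0 cg n W; have [_ d _] := h t. Qed.

Let mode_cont n : continuous (mb (mode_of L phi psi w n)).
Proof. by move=> t; exact: der_cont (mode_der n t). Qed.

Let part_le (X : (R -> R)) (r B : R) (e : nat -> R -> R) (E : nat -> R) : 0 < r -> 
  (forall n, r * (ip X (e n)) ^+ 2 <= 2 * E n) -> (forall N, \sum_(i < N) E i <= B) ->
  forall N, \sum_(i < N) (ip X (e i)) ^+ 2 <= 2 * B / r.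
Proof.
move=> r0 h hB N; rewrite ler_pdivlMr// mulrC mulr_sumr.
apply: le_trans (_ : \sum_(i < N) (2 * E i) <= _); first by apply: ler_sum => i _; exact: h.
by rewrite -mulr_sumr; apply: ler_wpM2l.
Qed.

(** Each of the seven terms of the energy is bounded separately, as all seven parts of
    the energy of a mode are nonnegative; hence the factor 14 instead of 2.  The cosine
    of frequency 0 does not contribute, by the mean value conditions. *)
Lemma energy_le (t M : R) : 0 < t -> (forall N, modes_nrj N t <= M) ->
  energy L rho1 rho2 k k2 k l g phi psi w t <= 14 / L * M.
Proof.
move=> t_gt0 HM; have t0 := ltW t_gt0.
pose z := mode_of L phi psi w; pose f n := freq L n.+1.
have G0 : 0 < k2 - integ (ext g) t by apply: lt_le_trans (G_le t0).
have mem0 n : 0 <= mem2 (ext g) (mb (z n)) t.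
  rewrite (mem2E cg (mode_der n)); apply: integ_ge0 => s _ _; by rewrite mulr_ge0 ?sqr_ge0.
have P n := nrj_parts (f n) (ma (z n) t) (mb (z n) t) (mc (z n) t) (ma' (z n) t) (mb' (z n) t) (mc' (z n) t)
  (ltW G0) (mem0 n).
pose E n := nrjm rho1 rho2 k k2 l (f n) (ext g) (z n) t.
have HE N : \sum_(i < N) E i <= M by exact: HM.
have [_ sx1 st1] := sphi t0; have [sv2 sx2 st2] := spsi t0; have [sv3 _ st3] := sw t0.
have fold (r y X : R) : 0 < r -> X <= 2 / L * (2 * M / r) -> r * X <= 4 / L * M.
  move=> r0 h; rewrite mulrC -ler_pdivlMr//; apply: le_trans h _.
  by rewrite le_eqVlt; apply/orP; left; apply/eqP; field; rewrite !gt_eqF.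
have e1 : rho1 * ip (evol_t phi t) (evol_t phi t) <= 4 / L * M.
  apply: fold => //; apply: (sn_le L_gt0 st1); apply: (part_le (e := fun n => sn' n) (E := E)) => // n.
  by have [[<- _ _] _ _ _] := coefs n t0; have [[h _ _ _] _ _ _] := P n; exact: h.
have e2 : rho2 * ip (evol_t psi t) (evol_t psi t) <= 4 / L * M.
  apply: fold => //; apply: (cs_le L_gt0 st2).
    by apply: mean0_cs0; have [h _ _ _ _] := hpsi; exact: (h t t0).2.2.
  apply: (part_le (e := fun n => cs' n) (E := E)) => // n.
  by have [[_ <- _] _ _ _] := coefs n t0; have [[_ h _ _] _ _ _] := P n; exact: h.
have e3 : rho1 * ip (evol_t w t) (evol_t w t) <= 4 / L * M.
  apply: fold => //; apply: (cs_le L_gt0 st3).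
    by apply: mean0_cs0; have [h _ _ _ _] := hw; exact: (h t t0).2.2.
  apply: (part_le (e := fun n => cs' n) (E := E)) => // n.
  by have [[_ _ <-] _ _ _] := coefs n t0; have [[_ _ h _] _ _ _] := P n; exact: h.
have e4 : (k2 - integ (ext g) t) * ip (evol_x psi t) (evol_x psi t) <= 4 / L * M.
  apply: fold => //; apply: (sn_le L_gt0 sx2).
  apply: (part_le (e := fun n => sn' n) (E := E)) => // n.
  by have [_ <- _ _] := coefs n t0; have [[_ _ _ h] _ _ _] := P n; exact: h.
have e5 : k * ip (axial l phi w t) (axial l phi w t) <= 4 / L * M.
  apply: fold => //; apply: (sn_le L_gt0 (sax t0)).
  apply: (part_le (e := fun n => sn' n) (E := E)) => // n.
  by have [_ _ <- _] := coefs n t0; have [_ h _ _] := P n; exact: h.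
have e6 : k * ip (shear l phi psi w t) (shear l phi psi w t) <= 4 / L * M.
  apply: fold => //; apply: (cs_le L_gt0 (ssh t0)).
    rewrite (shear_coef l L_gt0 (Hphi t0) (Hpsi t0) (Hw t0)) /shr.
    by rewrite (mean0_cs0 (Hpsi t0).2) (mean0_cs0 (Hw t0).2) /freq !mul0r mulr0 !addr0.
  apply: (part_le (e := fun n => cs' n) (E := E)) => // n.
  by have [_ _ _ <-] := coefs n t0; have [_ _ h _] := P n; exact: h.
have e7 : memory L g (evol_x psi) t <= 4 / L * M.
  have -> : 4 / L * M = 2 / L * (2 * M) by field; rewrite gt_eqF.
  apply: (memory_le (q := fun n s => - f n * mb (z n) s) L_gt0 cg g_ge0 (psi_x_measurable W)) => //.
  - by move=> s /spsi[].
  - by move=> n; apply: contZ.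
  - by move=> n s s0; rewrite /= ext1E// (H1_coef L_gt0 _ (Hpsi s0).1).
  move=> N; have [_ fz] := modes_family N.
  have := memsE cg fz t; rewrite /mems /rho => h.
  rewrite (_ : integ _ t = \sum_(i < N) (f i ^+ 2 * mem2 (ext g) (mb (z i)) t)); last first.
    rewrite h; apply: eq_integ => s _ _; congr (_ * _); apply: eq_bigr => i _.
    by rewrite -mulrBr exprMn sqrrN.
  apply: le_trans (_ : \sum_(i < N) (2 * E i) <= _); last by rewrite -mulr_sumr ler_wpM2l.
  by apply: ler_sum => i _; have [_ _ _] := P i.
rewrite /energy (_ : \int[mu]_(s in `[0, t]) g s = integ (ext g) t); last first.
  by apply: eq_Rintegral => s /set_mem; rewrite /= in_itv /= => /andP[s0 _]; rewrite extE.
have sqD (f1 f2 : R -> R) (r : R) : mu.-integrable dom (EFin \o f1) -> sqint L f2 ->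
  mu.-integrable dom (EFin \o (fun x => f1 x + r * f2 x ^+ 2)) /\
  \int[mu]_(x in dom) (f1 x + r * f2 x ^+ 2) = \int[mu]_(x in dom) f1 x + r * ip f2 f2.
  move=> i1 [_ i2]; have i3 := integrable_mulR r i2.
  split; first exact: integrable_addR.
  by rewrite RintegralD// RintegralZl.
have i1 : mu.-integrable dom (EFin \o (fun x => rho1 * evol_t phi t x ^+ 2)).
  by apply: integrable_mulR; have [] := st1.
have [i2 E2] := sqD _ _ rho2 i1 st2.
have [i3 E3] := sqD _ _ rho1 i2 st3.
have [i4 E4] := sqD _ _ (k2 - integ (ext g) t) i3 sx2.
have [i5 E5] := sqD _ _ k i4 (sax t0).
have [i6 E6] := sqD _ _ k i5 (ssh t0).
rewrite E6 E5 E4 E3 E2 RintegralZl//; last by have [] := st1.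
move: e1 e2 e3 e4 e5 e6 e7; rewrite {1}/dotL2.
have -> : 14 / L * M = 7 / 2 * (4 / L * M) by field; rewrite gt_eqF.
move: (4 / L * M) => Y; rewrite /dotL2; lra.
Qed.

Lemma init_modes_le phi0x psi0x w0x N : H10 L phi0 phi0x -> H1s L psi0 psi0x -> H1s L w0 w0x ->
  sqint L phi1 -> sqint L psi1 -> sqint L w1 ->
  modes_nrj N 0 <= L / 4 * (rho1 * ip phi1 phi1 + rho2 * ip psi1 psi1 + rho1 * ip w1 w1
    + k2 * ip psi0x psi0x + k * ip (axial_of l phi0 w0x) (axial_of l phi0 w0x)
    + k * ip (shear_of l phi0x psi0 w0) (shear_of l phi0x psi0 w0)).
Proof.
move=> h1 h2 h3 s1 s2 s3; have t0 := lexx (0 : R).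
have [sv1 sx1 st1] := sphi t0; have [sv2 sx2 st2] := spsi t0; have [sv3 sx3 st3] := sw t0.
have [p0 p1] := phi_init W; have [q0 q1] := psi_init W; have [r0 r1] := w_init W.
have [[s1' _ _] _] := h1; have [[s2' s2x _] _] := h2; have [[s3' _ _] _] := h3.
have {}s1' := inL2_sqint s1'; have {}s2' := inL2_sqint s2'; have {}s3' := inL2_sqint s3'; have {}s2x := inL2_sqint s2x.
have nE n : nrjm rho1 rho2 k k2 l (freq L n.+1) (ext g) (mode_of L phi psi w n) 0 =
  2^-1 * (rho1 * ip phi1 (sn' n) ^+ 2 + rho2 * ip psi1 (cs' n) ^+ 2 + rho1 * ip w1 (cs' n) ^+ 2
    + k2 * ip psi0x (sn' n) ^+ 2 + k * ip (axial_of l phi0 w0x) (sn' n) ^+ 2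
    + k * ip (shear_of l phi0x psi0 w0) (cs' n) ^+ 2).
  have sc := sqint_cs L n.+1; have ss := sqint_sn L n.+1.
  rewrite /nrjm /mode_nrj /nrj (mem2E cg (mode_der n)) !integ0 mulr0 addr0 subr0.
  rewrite (axial_coef l L_gt0 h1 h3) (shear_coef l L_gt0 h1 h2 h3) (H1_coef L_gt0 _ h2.1) mulNr sqrrN.
  rewrite /= !extE// !ext1E//.
  rewrite (eqL2_dot sv1 s1' ss p0) (eqL2_dot st1 s1 ss p1).
  rewrite (eqL2_dot sv2 s2' sc q0) (eqL2_dot st2 s2 sc q1).
  by rewrite (eqL2_dot sv3 s3' sc r0) (eqL2_dot st3 s3 sc r1).
rewrite /modes_nrj /nrjs; under eq_bigr => i _ do rewrite nE.
rewrite -mulr_sumr !big_split /= -!mulr_sumr.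
have b1 := sn_bessel L_gt0 N s1; have b2 := cs_bessel L_gt0 N s2; have b3 := cs_bessel L_gt0 N s3.
have b4 := sn_bessel L_gt0 N s2x; have b5 := sn_bessel L_gt0 N (sqint_axial l h1 h3).
have b6 := cs_bessel L_gt0 N (sqint_shear l h1 h2 h3).
have scale (r X Y : R) : 0 < r -> X <= L / 2 * Y -> r * X <= L / 2 * (r * Y).
  by move=> r_gt0 h; rewrite mulrCA; apply: ler_wpM2l => //; exact: ltW.
have := scale _ _ _ rho1_gt0 b1; have := scale _ _ _ rho2_gt0 b2; have := scale _ _ _ rho1_gt0 b3.
have := scale _ _ _ k2_gt0 b4; have := scale _ _ _ k_gt0 b5; have := scale _ _ _ k_gt0 b6.
have -> : L / 4 = 2^-1 * (L / 2) by field.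
rewrite -!(mulrA 2^-1) => *; apply: ler_wpM2l => //; rewrite !mulrDr.
by repeat apply: lerD.
Qed.

End Solution.
End EnergyOfModes.

(** * Decay of the energy *)

Section TailIntegral.
Context {R : realType}.
Local Notation mu := (@lebesgue_measure R).

(** Splits the time integral at t0: the energy is bounded before and has an integrable
    bound after. *)
Lemma integ_tail_le (f h : R -> R) (t0 e0 C J t : R) : continuous f -> continuous h ->
  0 <= t0 -> 0 <= C -> (forall s, 0 <= h s) -> (forall s, 0 <= s -> s <= t0 -> f s <= e0) ->
  (forall s, t0 <= s -> f s <= C * h s) ->
  (\int[mu]_(s in `[t0, +oo[) (h s)%:E <= J%:E)%E -> t0 <= t -> integ f t <= e0 * t0 + C * J.
Proof.
move=> cf ch t00 C0 h0 fe fh hJ tt.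
have ch1 : \int[mu]_(s in `[t0, t]) h s <= J.
  rewrite -lee_fin; apply: le_trans hJ; rewrite /Rintegral fineK; last first.
    by apply: integrable_fin_num => //; exact: continuous_itv_integrable.
  apply: ge0_subset_integral => //.
  - by apply/measurable_EFinP; apply: measurable_funTS; exact: continuous_measurable_fun.
  - by move=> s _; rewrite lee_fin.
  - by move=> s; rewrite /= !in_itv /= andbT => /andP[].
have h1 : integ f t0 <= e0 * t0.
  rewrite -(integ_cst _ t00).
  by apply: le_integ => //; exact: cont_cst.
have h2 : \int[mu]_(s in `[t0, t]) f s <= C * J.
  apply: (@le_trans _ _ (C * \int[mu]_(s in `[t0, t]) h s)); last exact: ler_wpM2l.
  rewrite -RintegralZl//; last exact: continuous_itv_integrable.
  apply: le_Rintegral => //; try exact: continuous_itv_integrable.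
    by apply: continuous_itv_integrable; exact: contZ.
  by move=> s; rewrite /= in_itv /= => /andP[s0 _]; exact: fh.
by rewrite -(subrK (integ f t0) (integ f t)) -integ_itv// addrC; exact: lerD.
Qed.

End TailIntegral.

Section Main.
Context {R : realType}.
Variables (L rho1 rho2 k1 k2 : R) (g : R -> R).
Hypothesis L_gt0 : 0 < L.
Hypothesis rho1_gt0 : 0 < rho1.
Hypothesis rho2_gt0 : 0 < rho2.
Hypothesis k1_gt0 : 0 < k1.
Hypothesis k2_gt0 : 0 < k2.
Hypothesis hA1 : hypA1 k2 g.
Local Notation mu := (@lebesgue_measure R).

Lemma kernel_continuous : continuous (ext g).
Proof.
by have [_ _ /hl_derP h _ _] := hA1; exact/ext_continuous/(hl_der_cont h).
Qed.

Lemma kernel_ge0 s : 0 <= ext g s.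
Proof. by have [h _ _ _ _] := hA1; apply: h; rewrite le_max lexx orbT. Qed.

Lemma kernel_der (t : R) : 0 < t -> der (ext g) t (hl_derive g t).
Proof. by move=> t0; have [_ _ /hl_derP h _ _] := hA1; exact/der_ext/hl_der_der. Qed.

Lemma kernel_decr s t : 0 <= s -> s <= t -> ext g t <= ext g s.
Proof.
by have [_ h _ _ _] := hA1 => s0 st; rewrite !extE ?(le_trans s0)//; exact: h.
Qed.

Lemma kernel_bound : exists2 kap : R, 0 < kap & forall t, 0 <= t -> kap <= k2 - integ (ext g) t.
Proof.
have [_ _ _ _] := hA1; set X := (\int[mu]_(s in _) _)%E => hX.
have XE : X = (\int[mu]_(s in halfline) (ext g s)%:E)%E.
  by apply: eq_integral => s /set_mem; rewrite /halfline /= in_itv /= andbT => s0; rewrite extE.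
have X0 : (0 <= X)%E by rewrite XE; apply: integral_ge0 => s _; rewrite lee_fin kernel_ge0.
case: X hX X0 XE => [x| |]//=; rewrite -?EFinB ?lte_fin// => x0 _ XE.
exists (k2 - x) => // t t0; rewrite lerD2l lerN2 -lee_fin XE /integ /Rintegral fineK; last first.
  by apply: integrable_fin_num => //; apply: continuous_itv_integrable; exact: kernel_continuous.
apply: ge0_subset_integral => //.
- exact: measurable_itv.
- by apply/measurable_EFinP; apply: measurable_funTS; apply: continuous_measurable_fun; exact: kernel_continuous.
- by move=> s _; rewrite lee_fin kernel_ge0.
- by move=> s; rewrite /halfline /= !in_itv /= andbT => /andP[].
Qed.

Lemma weight_good (xi : R -> R) (p : R) : hypA2 g xi p ->
  good_weight (ext g) (hl_derive g) (ext xi) (hl_derive xi) (xi 0) p.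
Proof.
move=> [x0 xdecr /hl_derP dx _ gx]; split.
- exact/ext_continuous/(hl_der_cont dx).
- by move=> t; apply: x0; rewrite le_max lexx orbT.
- by move=> t; apply: xdecr; rewrite // le_max lexx orbT.
- by move=> s t s0 st; rewrite !extE ?(le_trans s0)//; exact: xdecr.
split=> t t0.
- exact/der_ext/hl_der_der.
- exact: hl_derive_le0 xdecr dx t0.
- by have t0' := ltW t0; rewrite !extE//; exact: gx.
Qed.

(** The constants of the theorem must not depend on the solution, hence a bound chosen
    before it. *)
Lemma data_bound l phi0 phi1 psi0 psi1 w0 w1 : admissible_data L phi0 phi1 psi0 psi1 w0 w1 ->
  exists2 e0 : R, 0 < e0 & forall phi psi w,
    weak_solution L rho1 rho2 k1 k2 k1 l g phi0 phi1 psi0 psi1 w0 w1 phi psi w ->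
    forall N, modes_nrj L rho1 rho2 k1 k2 l g phi psi w N 0 <= e0.
Proof.
move=> [[[phi0x h1] /inL2_sqint s1] [[psi0x h2] [/inL2_sqint s2 _]] [[w0x h3] [/inL2_sqint s3 _]]].
pose e1 := L / 4 * (rho1 * dotL2 L phi1 phi1 + rho2 * dotL2 L psi1 psi1 + rho1 * dotL2 L w1 w1
    + k2 * dotL2 L psi0x psi0x + k1 * dotL2 L (axial_of l phi0 w0x) (axial_of l phi0 w0x)
    + k1 * dotL2 L (shear_of l phi0x psi0 w0) (shear_of l phi0x psi0 w0)).
have e10 : 0 <= e1 by rewrite /e1; have D := dotL2_ge0 L; pos.
have cg := kernel_continuous.
exists (e1 + 1) => [|phi psi w W N]; first by rewrite ltr_wpDl.
apply: le_trans (init_modes_le _ _ _ _ _ _ W _ h1 h2 h3 s1 s2 s3) _ => //.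
by rewrite lerDl.
Qed.

End Main.

Theorem theorem4p1 (R : realType) (L rho1 rho2 k1 k2 k3 : R)
    (hL : 0 < L) (hrho1 : 0 < rho1) (hrho2 : 0 < rho2)
    (hk1 : 0 < k1) (hk2 : 0 < k2) (hk3 : 0 < k3)
    (g : R -> R) (hA1 : hypA1 k2 g)
    (hspeed : k1 / rho1 = k2 / rho2) (hk13 : k1 = k3) :
  exists2 l0 : R, 0 < l0 &
  forall (xi : R -> R) (p : R), hypA2 g xi p ->
  forall l : R, 0 < l < l0 -> forall t0 : R, 0 < t0 ->
  [/\ p = 1 ->
      exists2 lambda : R, 0 < lambda &
      forall phi0 phi1 psi0 psi1 w0 w1 : R -> R,
      admissible_data L phi0 phi1 psi0 psi1 w0 w1 ->
      exists2 C : R, 0 < C &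
      forall phi psi w : evolution R,
      weak_solution L rho1 rho2 k1 k2 k3 l g
        phi0 phi1 psi0 psi1 w0 w1 phi psi w ->
      forall t : R, t0 < t ->
      energy L rho1 rho2 k1 k2 k3 l g phi psi w t <=
        C * expR (- lambda * \int[lebesgue_measure]_(s in `[t0, t]) xi s),
      1 < p ->
      forall phi0 phi1 psi0 psi1 w0 w1 : R -> R,
      admissible_data L phi0 phi1 psi0 psi1 w0 w1 ->
      exists2 C : R, 0 < C &
      forall phi psi w : evolution R,
      weak_solution L rho1 rho2 k1 k2 k3 l g
        phi0 phi1 psi0 psi1 w0 w1 phi psi w ->
      forall t : R, t0 < t ->
      energy L rho1 rho2 k1 k2 k3 l g phi psi w t <=
        C * (1 / (1 + \int[lebesgue_measure]_(s in `[t0, t])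
                        (xi s `^ (2 * p - 1)))) `^ (1 / (2 * p - 2))
    & 1 < p ->
      (\int[lebesgue_measure]_(t in `[t0, +oo[)
         ((1 / (1 + \int[lebesgue_measure]_(s in `[t0, t])
                      (xi s `^ (2 * p - 1)))) `^ (1 / (2 * p - 2)))%R%:E
         < +oo)%E ->
      forall phi0 phi1 psi0 psi1 w0 w1 : R -> R,
      admissible_data L phi0 phi1 psi0 psi1 w0 w1 ->
      exists2 C : R, 0 < C &
      forall phi psi w : evolution R,
      weak_solution L rho1 rho2 k1 k2 k3 l g
        phi0 phi1 psi0 psi1 w0 w1 phi psi w ->
      forall t : R, t0 < t ->
      energy L rho1 rho2 k1 k2 k3 l g phi psi w t <=
        C * (1 / (1 + \int[lebesgue_measure]_(s in `[t0, t])
                        (xi s `^ p))) `^ (1 / (p - 1))].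
Proof.
have cg := kernel_continuous hA1; have g0 := kernel_ge0 hA1; have dg := kernel_der hA1.
have gd := kernel_decr hA1; have [_ gni /hl_derP hdg g0_gt0 _] := hA1.
have g0e : 0 < ext g 0 by rewrite extE.
rewrite -{}hk13 {k3 hk3}.
have speed : rho2 = rho1 * k2 / k1.
  have -> : rho2 = rho2 * (k1 / rho1) * (rho1 / k1) by field; rewrite !gt_eqF.
  by rewrite hspeed; field; rewrite !gt_eqF.
have [kap kap0 Gle] := kernel_bound hA1.
have mu0 : 0 < pi / L by rewrite divr_gt0// pi_gt0.
have [l0 l0_gt0 H] := modes_decay hrho1 hrho2 hk1 hk2 kap0 mu0 speed cg g0 gd g0e dg Gle.
exists l0 => // xi p hA2 l /andP[l_gt0 l_lt] t0 t0_gt0.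
have hW := weight_good hA2; have [xi0 _ _ /andP[p1 p2] _] := hA2.
have [H1 H2 H3] := H _ _ _ _ hW p1 p2 l t0 l_gt0 l_lt t0_gt0.
have xiE (F : R -> R) t : \int[lebesgue_measure]_(s in `[t0, t]) F (ext xi s) =
    \int[lebesgue_measure]_(s in `[t0, t]) F (xi s).
  apply: eq_Rintegral => s /set_mem; rewrite /= in_itv /= => /andP[s0 _].
  by rewrite extE// (le_trans (ltW t0_gt0)).
have C14 (C : R) : 0 < C -> 0 < 14 / L * C by move=> C0; rewrite mulr_gt0// divr_gt0.
split.
- move=> p_eq; have [lam lam0 HC] := H1 p_eq; exists lam => // phi0 phi1 psi0 psi1 w0 w1 hadm.
  have [e0 e0_gt0 He] := data_bound hL hrho1 hrho2 hk1 hk2 hA1 l hadm.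
  have [C C0 HE] := HC e0 e0_gt0; exists (14 / L * C); first exact: C14.
  move=> phi psi w W t tt; have t_gt0 := lt_trans t0_gt0 tt.
  rewrite -(mulrA (14 / L)); apply: (energy_le hL hrho1 hrho2 hk1 kap0 cg g0 Gle W t_gt0) => N.
  have := HE N _ _ (modes_family hL hrho1 hrho2 cg W N) (He _ _ _ W N) t (ltW tt).
  by rewrite (xiE id).
- move=> p_gt1 phi0 phi1 psi0 psi1 w0 w1 hadm.
  have [e0 e0_gt0 He] := data_bound hL hrho1 hrho2 hk1 hk2 hA1 l hadm.
  have [C C0 HE] := H2 p_gt1 e0 e0_gt0; exists (14 / L * C); first exact: C14.
  move=> phi psi w W t tt; have t_gt0 := lt_trans t0_gt0 tt.
  rewrite -(mulrA (14 / L)); apply: (energy_le hL hrho1 hrho2 hk1 kap0 cg g0 Gle W t_gt0) => N.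
  have := HE N _ _ (modes_family hL hrho1 hrho2 cg W N) (He _ _ _ W N) t (ltW tt).
  by rewrite (xiE (fun x => x `^ (2 * p - 1))).
move=> p_gt1 hint phi0 phi1 psi0 psi1 w0 w1 hadm.
have [e0 e0_gt0 He] := data_bound hL hrho1 hrho2 hk1 hk2 hA1 l hadm.
have [C2 C20 HE2] := H2 p_gt1 e0 e0_gt0.
have [cxi xi_gt0 _ _ _] := hW.
(* h is the rate of the second claim, written so as to be continuous on the line. *)
pose f s := ext xi s `^ (2 * p - 1).
have cf : continuous f by exact: powR_continuous.
pose y s := 1 + (integ f (Num.max s t0) - integ f t0).
have y_ge1 s : 1 <= y s.
  by rewrite lerDl subr_ge0; apply: integ_le => //; rewrite ?le_max ?lexx ?orbT ?(ltW t0_gt0)// => r _; exact: powR_ge0.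
have y_gt0 s : 0 < y s by exact: lt_le_trans (y_ge1 s).
have cy : continuous y.
  apply: contD; first exact: cont_cst.
  apply: contB; last exact: cont_cst.
  apply: (cont_comp _ (integ_continuous cf)) => s.
  by apply: continuous_max; [exact: cvg_id|exact: cvg_cst].
pose h s := (1 / y s) `^ (1 / (2 * p - 2)).
have ch : continuous h.
  apply: powR_continuous => s; last by rewrite divr_gt0.
  by apply: cvgM; [exact: cvg_cst|apply: cvgV; [rewrite gt_eqF|exact: cy]].
have hE s : t0 <= s -> (1 / (1 + \int[lebesgue_measure]_(r in `[t0, s]) (xi r `^ (2 * p - 1))))
    `^ (1 / (2 * p - 2)) = h s.
  move=> ts; rewrite /h /y max_l// -(integ_itv cf (ltW t0_gt0) ts).
  by rewrite -(xiE (fun x => x `^ (2 * p - 1)) s).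
have h_ge0 s : 0 <= h s by exact: powR_ge0.
have [J J0 hJ] : exists2 J : R, 0 <= J & (\int[lebesgue_measure]_(s in `[t0, +oo[) (h s)%:E <= J%:E)%E.
  have {hint} : (\int[lebesgue_measure]_(s in `[t0, +oo[) (h s)%:E < +oo)%E.
    rewrite (le_lt_trans _ hint)// le_eqVlt; apply/orP; left; apply/eqP; apply: eq_integral => s /set_mem.
    by rewrite /= in_itv /= andbT => ts; rewrite hE.
  have : (0 <= \int[lebesgue_measure]_(s in `[t0, +oo[) (h s)%:E)%E.
    by apply: integral_ge0 => s _; rewrite lee_fin.
  by case: (\int[_]_(_ in _) _)%E => // J J0 _; exists J.
have B0 : 0 < e0 * t0 + C2 * J by rewrite ltr_wpDr ?mulr_gt0// mulr_ge0// ltW.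
have [C C0 HE] := H3 p_gt1 e0 _ e0_gt0 B0; exists (14 / L * C); first exact: C14.
move=> phi psi w W t tt; have t_gt0 := lt_trans t0_gt0 tt.
rewrite -(mulrA (14 / L)); apply: (energy_le hL hrho1 hrho2 hk1 kap0 cg g0 Gle W t_gt0) => N.
have fz := modes_family hL hrho1 hrho2 cg W N; have He0 := He _ _ _ W N.
have := HE N _ _ fz He0 _ t (ltW tt); rewrite (xiE (fun x => x `^ p)); apply=> s ts.
have [mu_ge zP] := fz.
apply: (integ_tail_le (nrjs_continuous cg zP) ch (ltW t0_gt0) (ltW C20) h_ge0 _ _ hJ ts).
  move=> r r0 rt0; apply: le_trans He0.
  (* the energy decreases whatever the lower bound of -g', hence the weight 0 *)
  apply: (nrjs_decr hrho1 hrho2 hk2 kap0 cg g0 gd g0e dg Gle (@cont_cst _ 0) _ _ mu_ge zP (lexx _) r0) => //.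
  by move=> q q0; rewrite oppr0; exact: hl_derive_le0 gni hdg q0.
move=> r tr; rewrite -hE//.
by have := HE2 N _ _ fz He0 r tr; rewrite (xiE (fun x => x `^ (2 * p - 1))).
Qed.
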